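(* There is a (local) one-to-one correspondence between variational orthopath geometries and divergence equivalence classes of generalized (pseudo-)Finsler structures.
   Context: **Variational orthopath geometries.** An $n$-dimensional path geometry is a $(2n-1)$-manifold $\mathcal C$ with a line field $\mathcal E$ and an integrable rank $n-1$ distribution $\mathcal V$ such that $\mathcal E\cap\mathcal V=0$ and the Lie bracket induces an isomorphism $\mathcal E\otimes\mathcal V\cong T\mathcal C/(\mathcal E\oplus\mathcal V)$; $\nu:\mathcal C\to M$ is the local leaf space of $\mathcal V$. An orthopath geometry of signature $(p,q)$, $p+q=n-1\geq2$, is a path geometry with a conformal class $[\mathbf h]$ of non-degenerate bundle metrics of signature $(p,q)$ on $\mathcal V$. It is variational if it has a compatible conformally quasi-symplectic structure: near each point there is a closed 2-form $\rho$ on $\mathcal C$ of maximal rank with kernel $\mathcal E$, $\rho|_{\mathcal V\times\mathcal V}=0$, and such that $(X,Y)\mapsto\rho([e,X],Y)$ on $\mathcal V$ lies in $[\mathbf h]$ for $e\in\Gamma(\mathcal E)$ nowhere zero. **Generalized (pseudo-)Finsler structures.** A generalized (pseudo-)Finsler structure of signature $(p+1,q)$ is a triple $(\mathcal C,\alpha^0,M)$ with a fibration $\nu:\mathcal C\to M$, $\dim\mathcal C=2n-1$, $\dim M=n$, a contact form $\alpha^0$ on $\mathcal C$ (the Hilbert form) for which there is a coframing $(\alpha^0,\omega^a,\theta^a)_{a=1}^{n-1}$ such that $(\alpha^0,\omega^a)$ are semi-basic for $\nu$ and $$d\alpha^0=\varepsilon_{ab}\theta^a\wedge\omega^b,\qquad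 d\omega^a\equiv\alpha^0\wedge\theta^a\ \bmod\{\omega^1,\dots,\omega^{n-1}\},$$ where $\varepsilon_{ab}$ is symmetric constant of signature $(p,q)$, $p+q=n-1$. Its geodesics are the projections of the integral curves of the Reeb field of $\alpha^0$. **Divergence equivalence.** Two such structures $(\mathcal C_1,\alpha^0,M_1)$, $(\mathcal C_2,\beta^0,M_2)$ are locally divergence equivalent at $x_i\in\mathcal C_i$ if there are open neighbourhoods $U_i\ni x_i$ and a diffeomorphism $g:U_1\to U_2$ with $g(x_1)=x_2$ and $g^*\beta^0=c\,\alpha^0+df$ for some $c\in\mathbb R^*$ and $f\in C^\infty(\nu(U_1),\mathbb R)$ (pulled back to $U_1$). The correspondence: to $(\mathcal C,\alpha^0,M)$ one associates $\mathcal E$ = span of the Reeb field of $\alpha^0$, $\mathcal V$ = vertical bundle of $\nu$, $[\mathbf h]=[\varepsilon_{ab}\theta^a\circ\theta^b]$ on $\mathcal V$, $\rho=d\alpha^0$.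
   Formalization: Divergence equivalence additionally requires the diffeomorphism g to map the vertical bundle of the first fibration to that of the second; without this, Darboux's theorem makes all structures of equal dimension divergence equivalent and the claim false. *)

(* Defs.v *)
From HB Require Import structures.
From mathcomp Require Import all_boot all_order all_algebra.
From mathcomp Require Import all_classical all_reals all_analysis.
Import Order.TTheory GRing.Theory Num.Theory.
Import numFieldNormedType.Exports.

Set Implicit Arguments.
Unset Strict Implicit.
Unset Printing Implicit Defensive.

Local Open Scope classical_set_scope.
Local Open Scope ring_scope.

(* The correspondence is local, hence a statement about germs, and every germ
   is represented in a coordinate chart: the (2n-1)-manifold C and the
   n-manifold M are open subsets of R^(2n-1) and R^n.  With k = n - 1 these are
   'rV_(k.+1 + k) and 'rV_k.+1.  At a point,
   - a tangent vector is a row v, a 1-form is a column a, with a(v) = v *m a;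
   - a bilinear form (2-form, metric) is a square matrix r, with
     r(v, w) = v *m r *m w^T;
   - a linear subspace of the tangent space is the row space of a matrix;
   - the differential of a map g sends v to v *m jacobian g x. *)

Definition pder (R : realType) (m : nat) (i : 'I_m) (f : 'rV[R]_m -> R)
    (x : 'rV[R]_m) : R := 'D_(delta_mx 0 i) f x.

Fixpoint diff_times (R : realType) (m r : nat) (U : set 'rV[R]_m)
    (f : 'rV[R]_m -> R) : Prop :=
  if r is r'.+1 then
    (forall x, U x -> differentiable f x) /\
    (forall i : 'I_m, diff_times r' U (pder i f))
  else True.

(* C^oo on the open set U; values outside U are irrelevant. *)
Definition smooth (R : realType) (m : nat) (U : set 'rV[R]_m)
    (f : 'rV[R]_m -> R) : Prop := forall r, diff_times r U f.

Definition smooth_mx (R : realType) (m a b : nat) (U : set 'rV[R]_m)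
    (F : 'rV[R]_m -> 'M[R]_(a, b)) : Prop :=
  forall i j, smooth U (fun x => F x i j).

Definition diffeo (R : realType) (m : nat) (U W : set 'rV[R]_m)
    (g : 'rV[R]_m -> 'rV[R]_m) : Prop :=
  [/\ open U, open W, smooth_mx U g, set_fun U W g &
      exists g' : 'rV[R]_m -> 'rV[R]_m,
        [/\ smooth_mx W g', set_fun W U g',
            {in U, cancel g g'} & {in W, cancel g' g}]].

Definition lie_bracket (R : realType) (m : nat)
    (X Y : 'rV[R]_m -> 'rV[R]_m) (x : 'rV[R]_m) : 'rV[R]_m :=
  'D_(X x) Y x - 'D_(Y x) X x.

Definition ext_d0 (R : realType) (m : nat) (f : 'rV[R]_m -> R)
    (x : 'rV[R]_m) : 'cV[R]_m := \col_i pder i f x.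

(* Convention: (da)(X, Y) = X (a(Y)) - Y (a(X)) - a([X, Y]). *)
Definition ext_d1 (R : realType) (m : nat) (a : 'rV[R]_m -> 'cV[R]_m)
    (x : 'rV[R]_m) : 'M[R]_m :=
  \matrix_(i, j) (pder i (fun y => a y j 0) x - pder j (fun y => a y i 0) x).

(* (a /\ b)(v, w) = a(v) b(w) - a(w) b(v) *)
Definition wedge (R : realType) (m : nat) (a b : 'cV[R]_m) : 'M[R]_m :=
  a *m b^T - b *m a^T.

Definition closed_2form (R : realType) (m : nat) (U : set 'rV[R]_m)
    (r : 'rV[R]_m -> 'M[R]_m) : Prop :=
  forall x, U x -> forall i j l : 'I_m,
    pder i (fun y => r y j l) x + pder j (fun y => r y l i) x
      + pder l (fun y => r y i j) x = 0.

Definition smooth_distribution (R : realType) (m r : nat) (C : set 'rV[R]_m)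
    (D : 'rV[R]_m -> 'M[R]_m) : Prop :=
  forall x, C x -> exists U (B : 'rV[R]_m -> 'M[R]_(r, m)),
    [/\ open_nbhs x U, U `<=` C, smooth_mx U B &
        forall y, U y -> row_free (B y) /\ (B y :=: D y)%MS].

Definition local_section (R : realType) (m : nat)
    (D : 'rV[R]_m -> 'M[R]_m) (x : 'rV[R]_m) (X : 'rV[R]_m -> 'rV[R]_m)
    : Prop :=
  exists U, [/\ open_nbhs x U, smooth_mx U X &
                forall y, U y -> (X y <= D y)%MS].

(* nu is a surjection of C onto M which, near every point of C, is the
   projection of a product. *)
Definition fibration (R : realType) (k : nat) (C : set 'rV[R]_(k.+1 + k))
    (M : set 'rV[R]_k.+1) (nu : 'rV[R]_(k.+1 + k) -> 'rV[R]_k.+1) : Prop :=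
  [/\ open C, open M, smooth_mx C nu, nu @` C = M &
      forall x, C x -> exists U W (phi : 'rV[R]_(k.+1 + k) -> 'rV[R]_(k.+1 + k)),
        [/\ open_nbhs x U, U `<=` C, diffeo U W phi &
            forall y, U y -> nu y = lsubmx (phi y)]].

Definition vertical (R : realType) (k : nat)
    (nu : 'rV[R]_(k.+1 + k) -> 'rV[R]_k.+1) (x : 'rV[R]_(k.+1 + k))
    : 'M[R]_(k.+1 + k) := kermx (jacobian nu x).

(* The distribution V is tangent to a foliation: near every point it is the
   vertical bundle of the projection nu to a local leaf space. *)
Definition integrable_distribution (R : realType) (k : nat)
    (C : set 'rV[R]_(k.+1 + k))
    (V : 'rV[R]_(k.+1 + k) -> 'M[R]_(k.+1 + k)) : Prop :=
  forall x, C x -> exists U nu,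
    [/\ open_nbhs x U, U `<=` C, fibration U (nu @` U) nu &
        forall y, U y -> (V y :=: vertical nu y)%MS].

Definition has_signature (R : realType) (p q : nat) (G : 'M[R]_(p + q))
    : Prop :=
  G^T = G /\ exists2 P, P \in unitmx &
    P *m G *m P^T = block_mx (1%:M : 'M[R]_p) 0 0 ((-1)%:M : 'M[R]_q).
Arguments has_signature {R} p q G.

(* The restrictions of h and h' to V define the same conformal class on U.
   The factor may have either sign: the class of rho([e, -], -) must not depend
   on the choice between e and -e.  Fixing the signature (p, q) of one
   representative fixes the sign back when p <> q. *)
Definition conformal (R : realType) (m : nat) (U : set 'rV[R]_m)
    (V h h' : 'rV[R]_m -> 'M[R]_m) : Prop :=
  exists lam : 'rV[R]_m -> R,
    [/\ smooth U lam, (forall x, U x -> lam x != 0) &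
        forall x, U x -> V x *m h' x *m (V x)^T
                           = lam x *: (V x *m h x *m (V x)^T)].

(* The conformal class is given by a representative, itself given by a
   symmetric bilinear form on the whole tangent space of which only the
   restriction to the vertical distribution is meaningful. *)
Record orthopath_data (R : realType) (k : nat) := OrthopathData {
  ocar : set 'rV[R]_(k.+1 + k);
  oline : 'rV[R]_(k.+1 + k) -> 'M[R]_(k.+1 + k);
  overt : 'rV[R]_(k.+1 + k) -> 'M[R]_(k.+1 + k);
  omet : 'rV[R]_(k.+1 + k) -> 'M[R]_(k.+1 + k) }.

Definition orestrict (R : realType) (k : nat) (O : orthopath_data R k)
    (U : set 'rV[R]_(k.+1 + k)) : orthopath_data R k :=
  OrthopathData U (oline O) (overt O) (omet O).

(* e (x) X |-> [e, X] mod E + V is an isomorphism from E (x) V to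
   TC / (E + V): as E is a line, injectivity and surjectivity can be tested
   with e fixed. *)
Definition bracket_iso (R : realType) (m : nat) (C : set 'rV[R]_m)
    (E V : 'rV[R]_m -> 'M[R]_m) : Prop :=
  forall x, C x -> forall e, local_section E x e -> e x != 0 ->
    (forall X, local_section V x X ->
       (lie_bracket e X x <= E x + V x)%MS -> X x = 0) /\
    (forall w : 'rV[R]_m, exists2 X, local_section V x X &
       (w - lie_bracket e X x <= E x + V x)%MS).

Definition path_geometry (R : realType) (k : nat) (C : set 'rV[R]_(k.+1 + k))
    (E V : 'rV[R]_(k.+1 + k) -> 'M[R]_(k.+1 + k)) : Prop :=
  open C /\
  [/\ smooth_distribution 1 C E, smooth_distribution k C V,
      integrable_distribution C V,
      (forall x, C x -> (E x :&: V x)%MS = 0) &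
      bracket_iso C E V].

Definition orthopath (R : realType) (p q : nat)
    (O : orthopath_data R (p + q)) : Prop :=
  [/\ path_geometry (ocar O) (oline O) (overt O),
      smooth_mx (ocar O) (omet O),
      (forall x, ocar O x -> (omet O x)^T = omet O x) &
      forall x, ocar O x ->
        exists2 B : 'M[R]_(p + q, (p + q).+1 + (p + q)),
          (B :=: overt O x)%MS & has_signature p q (B *m omet O x *m B^T)].
Arguments orthopath {R} p q O.

Definition compatible_quasi_symplectic (R : realType) (k : nat) (O : orthopath_data R k)
    (U : set 'rV[R]_(k.+1 + k))
    (rho : 'rV[R]_(k.+1 + k) -> 'M[R]_(k.+1 + k)) : Prop :=
  [/\ smooth_mx U rho /\ (forall x, U x -> (rho x)^T = - rho x),
      closed_2form U rho,
      (forall x, U x -> \rank (rho x) = (k + k)%N /\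
                        (kermx (rho x) :=: oline O x)%MS),
      (forall x, U x -> overt O x *m rho x *m (overt O x)^T = 0) &
      forall W (e : 'rV[R]_(k.+1 + k) -> 'rV[R]_(k.+1 + k)),
        open W -> W `<=` U -> smooth_mx W e ->
        (forall y, W y -> (e y <= oline O y)%MS /\ e y != 0) ->
        exists lam : 'rV[R]_(k.+1 + k) -> R,
          [/\ smooth W lam, (forall y, W y -> lam y != 0) &
              forall y X Y, W y ->
                local_section (overt O) y X -> local_section (overt O) y Y ->
                lie_bracket e X y *m rho y *m (Y y)^T
                  = lam y *: (X y *m omet O y *m (Y y)^T)]].

Definition variational (R : realType) (k : nat) (O : orthopath_data R k)
    : Prop :=
  forall x, ocar O x -> exists U rho,
    [/\ open_nbhs x U, U `<=` ocar O & compatible_quasi_symplectic O U rho].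

(* Equality of the germs (O1, x1) and (O2, x2) up to diffeomorphism. *)
Definition orthopath_equivalent (R : realType) (k : nat)
    (O1 : orthopath_data R k) (x1 : 'rV[R]_(k.+1 + k))
    (O2 : orthopath_data R k) (x2 : 'rV[R]_(k.+1 + k)) : Prop :=
  exists U1 U2 (g : 'rV[R]_(k.+1 + k) -> 'rV[R]_(k.+1 + k)),
    [/\ open_nbhs x1 U1 /\ U1 `<=` ocar O1,
        open_nbhs x2 U2 /\ U2 `<=` ocar O2,
        diffeo U1 U2 g /\ g x1 = x2,
        (forall y, U1 y ->
           (oline O1 y *m jacobian g y :=: oline O2 (g y))%MS /\
           (overt O1 y *m jacobian g y :=: overt O2 (g y))%MS) &
        conformal U1 (overt O1) (omet O1)
          (fun y => jacobian g y *m omet O2 (g y) *m (jacobian g y)^T)].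

Record finsler_data (R : realType) (k : nat) := FinslerData {
  fcar : set 'rV[R]_(k.+1 + k);
  fbase : set 'rV[R]_k.+1;
  fproj : 'rV[R]_(k.+1 + k) -> 'rV[R]_k.+1;
  fhilbert : 'rV[R]_(k.+1 + k) -> 'cV[R]_(k.+1 + k) }.

(* The pointwise condition says that a /\ (da)^((m-1)/2) has no zero. *)
Definition contact_form (R : realType) (m : nat) (C : set 'rV[R]_m)
    (a : 'rV[R]_m -> 'cV[R]_m) : Prop :=
  smooth_mx C a /\
  forall x, C x -> a x != 0 /\
    forall v : 'rV[R]_m, v *m a x = 0 ->
      (forall w : 'rV[R]_m, w *m a x = 0 -> v *m ext_d1 a x *m w^T = 0) ->
      v = 0.

Definition is_reeb (R : realType) (m : nat) (a : 'rV[R]_m -> 'cV[R]_m)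
    (x : 'rV[R]_m) (r : 'rV[R]_m) : Prop :=
  r *m a x = 1%:M /\ r *m ext_d1 a x = 0.

Definition semibasic (R : realType) (k b : nat) (C : set 'rV[R]_(k.+1 + k))
    (nu : 'rV[R]_(k.+1 + k) -> 'rV[R]_k.+1)
    (a : 'rV[R]_(k.+1 + k) -> 'M[R]_(k.+1 + k, b)) : Prop :=
  forall x, C x -> vertical nu x *m a x = 0.

(* The forms omega^a and theta^a are the columns of om and th. *)
Definition adapted_coframing (R : realType) (p q : nat)
    (S : finsler_data R (p + q)) (eps : 'M[R]_(p + q))
    (om th : 'rV[R]_((p + q).+1 + (p + q)) ->
             'M[R]_((p + q).+1 + (p + q), p + q)) : Prop :=
  [/\ has_signature p q eps,
      smooth_mx (fcar S) om /\ smooth_mx (fcar S) th,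
      (forall x, fcar S x ->
         row_free (row_mx (fhilbert S x) (row_mx (om x) (th x)))),
      semibasic (fcar S) (fproj S) (fhilbert S) /\
      semibasic (fcar S) (fproj S) om &
      forall x, fcar S x ->
        ext_d1 (fhilbert S) x =
          \sum_a \sum_b eps a b *: wedge (col a (th x)) (col b (om x)) /\
        forall a : 'I_(p + q),
          exists P : 'I_(p + q) -> 'cV[R]_((p + q).+1 + (p + q)),
            ext_d1 (fun y => col a (om y)) x =
              wedge (fhilbert S x) (col a (th x))
              + \sum_b wedge (P b) (col b (om x))].
Arguments adapted_coframing {R} p q S eps om th.

(* generalized (pseudo-)Finsler structure of signature (p + 1, q) *)
Definition finsler_structure (R : realType) (p q : nat)
    (S : finsler_data R (p + q)) : Prop :=
  [/\ fibration (fcar S) (fbase S) (fproj S),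
      contact_form (fcar S) (fhilbert S) &
      exists eps om th, adapted_coframing p q S eps om th].
Arguments finsler_structure {R} p q S.

(* The diffeomorphism g is an isomorphism of
   fibred manifolds, i.e. it respects the vertical bundles.  Without this
   requirement the fibrations would play no role and Darboux's theorem
   for contact forms would identify all structures of the same dimension. *)
Definition divergence_equivalent (R : realType) (k : nat)
    (S1 : finsler_data R k) (x1 : 'rV[R]_(k.+1 + k))
    (S2 : finsler_data R k) (x2 : 'rV[R]_(k.+1 + k)) : Prop :=
  exists U1 U2 (g : 'rV[R]_(k.+1 + k) -> 'rV[R]_(k.+1 + k)),
    [/\ open_nbhs x1 U1 /\ U1 `<=` fcar S1,
        open_nbhs x2 U2 /\ U2 `<=` fcar S2,
        diffeo U1 U2 g /\ g x1 = x2,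
        (forall y, U1 y ->
           (vertical (fproj S1) y *m jacobian g y
              :=: vertical (fproj S2) (g y))%MS) &
        exists (c : R) (f : 'rV[R]_k.+1 -> R),
          [/\ c != 0, smooth (fproj S1 @` U1) f &
              forall y, U1 y ->
                jacobian g y *m fhilbert S2 (g y)
                  = c *: fhilbert S1 y + ext_d0 (f \o fproj S1) y]].

(* O is the geometry associated with S: E is spanned by the Reeb field, V is
   the vertical bundle and [h] = [eps_ab theta^a o theta^b] on V, whichever
   adapted coframing is used. *)
Definition corresponds (R : realType) (p q : nat)
    (S : finsler_data R (p + q)) (O : orthopath_data R (p + q)) : Prop :=
  [/\ ocar O = fcar S,
      (forall x, fcar S x ->
         exists2 r, is_reeb (fhilbert S) x r & (r :=: oline O x)%MS),
      (forall x, fcar S x -> (overt O x :=: vertical (fproj S) x)%MS) &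
      forall eps om th, adapted_coframing p q S eps om th ->
        conformal (fcar S) (overt O) (omet O)
          (fun x => th x *m eps *m (th x)^T)].
Arguments corresponds {R} p q S O.

(* Main.v *)
(* For [e] along the Reeb field and [X], [Y] vertical, da([e, X], Y) = a(e) h(X, Y),
   so the Hilbert form [a] determines the conformal class [h].  Conversely, when
   k >= 2, a closed 2-form that has the Reeb line in its kernel, vanishes on V
   and induces the same conformal class is a constant multiple of da.  An
   isomorphism of orthopath geometries therefore pulls da2 back to c da1, and
   the difference of a2 and c a1 is a closed semi-basic form, hence locally the
   differential of a function on the base.  Finally, a compatible
   quasi-symplectic form has a semi-basic primitive by a Poincare lemma relative
   to the fibres; its coframe is dual to the Reeb field r, a frame T of V that
   makes the metric constant, and a correction of the brackets [r, T]. *)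

Require Import Defs.
From HB Require Import structures.
From mathcomp Require Import all_boot all_order all_algebra.
From mathcomp Require Import all_classical all_reals all_analysis.
From mathcomp Require Import ring lra zify.
Import Order.TTheory GRing.Theory Num.Theory.
Import numFieldNormedType.Exports.

Set Implicit Arguments.
Unset Strict Implicit.
Unset Printing Implicit Defensive.

Local Open Scope classical_set_scope.
Local Open Scope ring_scope.

(** * Smooth functions and matrices *)

(** The metric is visible only through brackets of the Reeb field with vertical fields, so forms are
    compared by evaluating them on a frame [r], [N], [T] dual to the coframe, and a congruence
    modulo the omega^a becomes an identity on their common kernel. For two structures the ratio of
    the metrics, scaled by a2(r), is at first a function [mu]. Closedness alone makes it constant,
    and here k >= 2 enters: dmu /\ da = 0 leaves room for a nonzero dmu when da has rank 2.
    Constancy of [mu] and the function on the base need a connected domain that splits into base and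
    fibre directions, hence cubes for the sup norm in a fibred chart. The radial homotopy operator
    would give primitives with components along the fibres, so that V would not lie in ker a;
    integrating one coordinate at a time avoids them. Finally E carries no orientation, so rho does
    not fix the sign of a(e). The freedom of adding to [a] the pull-back of a closed form on the
    base is spent on choosing it, since the wrong sign would turn the signature (p, q) into (q,
    p). *)

Lemma differentiable_linear_approx {K : numFieldType} {V W : normedModType K}
    (f : V -> W) x (df : {linear V -> W}) : continuous df ->
  (forall e, 0 < e -> \forall h \near (0 : V),
     `|f (h + x) - f x - df h| <= e * `|h|) ->
  differentiable f x /\ 'd f x = df :> (V -> W).
Proof.
move=> dfc H.
have E : f \o shift x = cst (f x) + df +o_ 0 id.
  apply/eqaddoP => e e0; have := H _ e0; apply: filterS => h /=.
  by rewrite ![in X in _ -> X]fctE /= opprD addrA.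
have dE := diff_unique dfc E; split=> //.
by apply/diff_locallyP; rewrite dE.
Qed.

Section Differentiability.
Context {R : realType} {m : nat}.
Implicit Types (f : 'rV[R]_m -> R) (x v : 'rV[R]_m) (U : set 'rV[R]_m).

Lemma lin_col_continuous (a : 'cV[R]_m) :
  continuous (fun h : 'rV[R]_m => (h *m a) 0 0 : R).
Proof.
move=> x; apply: differentiable_continuous.
have -> : (fun h : 'rV[R]_m => (h *m a) 0 0 : R) =
   (fun h => \sum_(j < m) (fun y : 'rV[R]_m => a j 0 *: (y 0 j)) h).
  by apply/funext => h; rewrite mxE; apply: eq_bigr => j _; rewrite mulrC.
rewrite (_ : (fun h => _) = \sum_(j < m) (fun y : 'rV[R]_m => a j 0 *: (y 0 j))); last first.
  by apply/funext => h; rewrite fct_sumE.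
apply: differentiable_sum => j; apply: differentiableZ.
exact: differentiable_coord.
Qed.

Lemma differentiable_approx f x (a : 'cV[R]_m) :
  (forall e, 0 < e -> \forall h \near (0 : 'rV[R]_m),
     `|f (h + x) - f x - (h *m a) 0 0| <= e * `|h|) ->
  differentiable f x /\ forall v, 'D_v f x = (v *m a) 0 0.
Proof.
move=> H.
pose g := fun h : 'rV[R]_m => (h *m a) 0 0 : R.
have gl : linear g.
  by move=> c u w; rewrite /g mulmxDl -scalemxAl mxE [X in X + _]mxE.
pose gM := GRing.isLinear.Build R _ _ _ g gl.
pose df : {linear 'rV[R]_m -> R} := HB.pack g gM.
have dfc : continuous df by exact: lin_col_continuous.
have [d E] := @differentiable_linear_approx _ _ _ f x df dfc H.
by split=> // v; rewrite deriveE // E.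
Qed.

Lemma pder_approx f x (a : 'cV[R]_m) :
  (forall e, 0 < e -> \forall h \near (0 : 'rV[R]_m),
     `|f (h + x) - f x - (h *m a) 0 0| <= e * `|h|) ->
  differentiable f x /\ forall j, pder j f x = a j 0.
Proof.
move=> /differentiable_approx[d E]; split=> // j.
by rewrite [LHS]E -rowE mxE.
Qed.

Lemma diff_approx f x : differentiable f x ->
  forall e, 0 < e -> \forall h \near (0 : 'rV[R]_m),
     `|f (h + x) - f x - 'd f x h| <= e * `|h|.
Proof.
move=> /diff_locally/eqaddoP H e e0; have := H _ e0; apply: filterS => h /=.
by rewrite ![in X in X -> _]fctE /= opprD addrA.
Qed.

Lemma near_eq_differentiable f g x :
  (\forall y \near x, f y = g y) -> differentiable f x -> differentiable g x.
Proof.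
move=> fg df.
apply: (proj1 (@differentiable_approx _ _ (\col_i 'd f x (delta_mx 0 i)) _)).
move=> e e0; have := diff_approx df e0.
have : \forall h \near (0 : 'rV[R]_m), f (h + x) = g (h + x).
  by have := fg; rewrite (near_shift 0) subr0.
apply: filterS2 => h <-; rewrite (nbhs_singleton fg).
suff -> : 'd f x h = (h *m \col_i 'd f x (delta_mx 0 i)) 0 0 by [].
rewrite [in LHS](row_sum_delta h) linear_sum mxE.
by apply: eq_bigr => i _; rewrite linearZ !mxE.
Qed.

Lemma derive_pder f x v : differentiable f x ->
  'D_v f x = \sum_i v 0 i * pder i f x.
Proof.
move=> df; rewrite deriveE // [in LHS](row_sum_delta v) linear_sum.
by apply: eq_bigr => i _; rewrite linearZ /= /pder deriveE.
Qed.

Lemma is_derive_line f x v (t : R) : derivable f (t *: v + x) v ->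
  is_derive t 1 (fun s : R => f (s *: v + x)) ('D_v f (t *: v + x)).
Proof.
have E : (fun h : R => h^-1 *: (((fun s : R => f (s *: v + x)) \o shift t) (h *: 1) - f (t *: v + x))) =
  (fun h : R => h^-1 *: ((f \o shift (t *: v + x)) (h *: v) - f (t *: v + x))).
  apply/funext => h /=; congr (_ *: (f _ - _)).
  by rewrite [h%:A]mulr1 scalerDl addrA.
by move=> d; split; rewrite /derivable /derive E.
Qed.

Lemma mvt_line f x v (c : R) :
  (forall t : R, `|t| <= `|c| -> derivable f (t *: v + x) v) ->
  exists2 t : R, `|t| <= `|c| & f (c *: v + x) - f x = c * 'D_v f (t *: v + x).
Proof.
move=> d; have [c0|c0] := leP 0 c.
  have dI t : t \in `[0, c] -> `|t| <= `|c|.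
    by rewrite in_itv /= => /andP[t0 tc]; rewrite !ger0_norm.
  have [||t] := @MVT_segment R (fun s : R => f (s *: v + x))
    (fun s => 'D_v f (s *: v + x)) 0 c c0.
  - by move=> t /subset_itv_oo_cc /dI /d; exact: is_derive_line.
  - apply: derivable_within_continuous => s /dI /d st.
    by have [] := is_derive_line st.
  - by move=> /dI tI; rewrite scale0r add0r subr0 mulrC => E; exists t.
have dI t : t \in `[c, 0] -> `|t| <= `|c|.
  by rewrite in_itv /= => /andP[t0 tc]; rewrite !ler0_norm ?lerN2 // ltW.
have [||t] := @MVT_segment R (fun s : R => f (s *: v + x))
  (fun s => 'D_v f (s *: v + x)) c 0 (ltW c0).
- by move=> t /subset_itv_oo_cc /dI /d; exact: is_derive_line.
- apply: derivable_within_continuous => s /dI /d st.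
  by have [] := is_derive_line st.
- move=> /dI tI; rewrite scale0r add0r sub0r mulrN mulrC => E; exists t => //.
  by apply/eqP; rewrite -eqr_opp opprB E.
Qed.

End Differentiability.

Lemma mx_norm_entry {R : realType} {a b : nat} (M : 'M[R]_(a, b)) i j :
  `|M i j| <= `|M|.
Proof.
rewrite [leRHS]/Num.Def.normr/= mx_normrE.
exact: (le_bigmax _ (fun ij : 'I_a * 'I_b => `|M ij.1 ij.2|) (i, j)).
Qed.

Lemma mx_norm_leP {R : realType} {a b : nat} (M : 'M[R]_(a, b)) c : 0 <= c ->
  (forall i j, `|M i j| <= c) -> `|M| <= c.
Proof.
move=> c0 H; rewrite [leLHS]/Num.Def.normr/= mx_normrE.
by apply: bigmax_le => // -[i j] _ /=.
Qed.

Lemma near_dist {K : numFieldType} {V : normedModType K} (x : V) (P : V -> Prop) :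
  (\forall y \near x, P y) <-> exists2 d : K, 0 < d & forall y, `|y - x| < d -> P y.
Proof.
split=> [/nbhs_normP[d d0 H]|[d d0 H]].
  by exists d => // y yx; apply: H; rewrite /= distrC.
by apply/nbhs_normP; exists d => // y /=; rewrite distrC => /H.
Qed.

(** * Symmetry of second partial derivatives *)

Section ContinuouslyDifferentiable.
Context {R : realType} {m : nat}.
Implicit Types (f : 'rV[R]_m -> R) (x v : 'rV[R]_m) (U : set 'rV[R]_m).

Lemma differentiable_translate (c x : 'rV[R]_m) :
  differentiable (fun z : 'rV[R]_m => c + z) x.
Proof.
have -> : (fun z : 'rV[R]_m => c + z) = cst c + id by exact/funext.
by apply: differentiableD.
Qed.

(** Two uses of the mean value theorem: along e_i for the increment g y = f (t e_j + y) - f y, then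
    along e_j for the i-th partial derivative of f. All points met lie within 2t of [x], whence t +
    t < d. *)
Lemma second_difference f x (i j : 'I_m) (d t : R) :
  (forall y, `|y - x| < d -> differentiable f y /\ differentiable (pder i f) y) ->
  0 < t -> t + t < d ->
  exists2 y, `|y - x| < d &
    f (t *: delta_mx 0 j + (t *: delta_mx 0 i + x)) - f (t *: delta_mx 0 i + x)
     - (f (t *: delta_mx 0 j + x) - f x) = t * (t * pder j (pder i f) y).
Proof.
move=> H t0 td; pose ei : 'rV[R]_m := delta_mx 0 i; pose ej : 'rV[R]_m := delta_mx 0 j.
have ne (a b : R) : `|a| <= `|t| -> `|b| <= `|t| -> `|a *: ej + (b *: ei + x) - x| < d.
  move=> at_ bt; rewrite addrA addrK; apply: le_lt_trans td.
  apply: mx_norm_leP => [|p q]; first by rewrite addr_ge0 // ltW.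
  rewrite !mxE; apply: le_trans (ler_normD _ _) _.
  rewrite (gtr0_norm t0) in at_ bt.
  have le_t (c : R) (k : bool) : `|c| <= t -> `|c * k%:R| <= t.
    by case: k; rewrite ?mulr1 // mulr0 normr0 => _; exact: ltW.
  by apply: lerD; apply: le_t.
pose g y := f (t *: ej + y) - f y.
have shift_diff y : differentiable f (t *: ej + y) -> differentiable (fun z => f (t *: ej + z)) y.
  move=> dfy; have dt := differentiable_translate (t *: ej) y.
  exact: (differentiable_comp dt dfy).
have dg y : differentiable f (t *: ej + y) -> differentiable f y -> differentiable g y.
  by move=> d1 d2; apply: differentiableB => //; exact: shift_diff.
have dgE y : differentiable f (t *: ej + y) -> differentiable f y ->
    'D_ei g y = pder i f (t *: ej + y) - pder i f y.
  move=> d1 d2; rewrite deriveB; [|exact/diff_derivable/shift_diff|exact/diff_derivable].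
  have -> : 'D_ei (fun z => f (t *: ej + z)) y = pder i f (t *: ej + y).
    apply: (congr1 (fun F : R -> R => lim (F h @[h --> 0^']))); apply/funext => h /=.
    by rewrite addrCA.
  by [].
have n0 (b : R) : `|b| <= `|t| -> `|b *: ei + x - x| < d.
  by move=> bt; have := ne 0 b; rewrite normr0 scale0r add0r; apply.
have [|b bt E] := @mvt_line _ _ g x ei t.
  move=> b bt; apply: diff_derivable; apply: dg; apply: (proj1 (H _ _)).
    exact: ne.
  exact: n0.
rewrite dgE in E; last 2 first.
- exact: (proj1 (H _ (ne _ _ _ _))).
- exact: (proj1 (H _ (n0 _ _))).
have [|a at_ E2] := @mvt_line _ _ (pder i f) (b *: ei + x) ej t.
  by move=> a at_; apply: diff_derivable; apply: (proj2 (H _ _)); exact: ne.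
exists (a *: ej + (b *: ei + x)); first exact: ne.
by rewrite -/ei -/ej -[LHS]/(g (t *: ei + x) - g x) E E2.
Qed.

Lemma continuous_dist f x e : {for x, continuous f} -> 0 < e ->
  exists2 d : R, 0 < d & forall y, `|y - x| < d -> `|f x - f y| < e.
Proof. by move=> /cvgrPdist_lt fx e0; apply/near_dist; exact: fx. Qed.

(** The two orders of differentiation yield two different mean value points about which only their
    closeness to [x] is known. The limit is therefore taken by comparing values, with half of a
    supposed gap as the tolerance. *)
Lemma eq_of_near_values (F G : 'rV[R]_m -> R) x :
  {for x, continuous F} -> {for x, continuous G} ->
  (forall d : R, 0 < d -> exists y z, [/\ `|y - x| < d, `|z - x| < d & F y = G z]) ->
  F x = G x.
Proof.
move=> cF cG H; apply/eqP; rewrite -subr_eq0; apply/negP => /negP ne0.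
have e0 : 0 < `|F x - G x| / 2 by rewrite divr_gt0 // normr_gt0.
have [d2 d20 H2] := continuous_dist cF e0.
have [d3 d30 H3] := continuous_dist cG e0.
have [|y [z []]] := H (Num.min d2 d3); first by rewrite lt_min d20.
rewrite !lt_min => /andP[/H2 Fy _] /andP[_ /H3 Gz] E.
suff : `|F x - G x| < `|F x - G x| by rewrite ltxx.
rewrite [ltRHS]splitr -[in ltLHS](subrKA (F y)).
by apply: le_lt_trans (ler_normD _ _) _; apply: ltrD => //; rewrite E distrC.
Qed.

(* Both iterated derivatives are limits of the symmetric second difference. *)
Lemma pder_comm_C2 f x (i j : 'I_m) :
  (\forall y \near x, [/\ differentiable f y, differentiable (pder i f) y &
     differentiable (pder j f) y]) ->
  {for x, continuous (pder i (pder j f))} ->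
  {for x, continuous (pder j (pder i f))} ->
  pder i (pder j f) x = pder j (pder i f) x.
Proof.
move=> /near_dist[d1 d10 H1] ci cj; apply: eq_of_near_values => // d d0.
have {}d0 : 0 < Num.min d d1 by rewrite lt_min d0.
set d' := Num.min d d1 in d0; pose t := d' / 4.
have t0 : 0 < t by rewrite divr_gt0.
have td : t + t < d' by rewrite /t; lra.
have d'd y : `|y - x| < d' -> `|y - x| < d /\ `|y - x| < d1.
  by rewrite lt_min => /andP[].
have [|y /d'd[yx _] Ey] := @second_difference f x i j d' t _ t0 td.
  by move=> y /d'd[_ /H1[]].
have [|z /d'd[zx _] Ez] := @second_difference f x j i d' t _ t0 td.
  by move=> z /d'd[_ /H1[]].
exists z, y; split=> //; move: Ey Ez.
move: (pder j (pder i f) y) (pder i (pder j f) z) => a b Ey Ez.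
(* Both second differences combine the same four values of [f], so only the factor t^2 has to be
   cancelled. *)
apply: (mulfI (lt0r_neq0 t0)); apply: (mulfI (lt0r_neq0 t0)); rewrite -Ey -Ez.
by rewrite [in X in X - _ - _]addrCA; ring.
Qed.
End ContinuouslyDifferentiable.

Local Opaque derive.

(** * Rules of differentiation for scalar functions *)

Section PartialDerivatives.
Context {R : realType} {m : nat}.
Implicit Types (f g : 'rV[R]_m -> R) (x v : 'rV[R]_m) (U : set 'rV[R]_m).

Lemma open_near U x : open U -> U x -> \forall y \near x, U y.
Proof. by move=> oU Ux; apply: open_nbhs_nbhs. Qed.

Lemma derive_eq_on {W : normedModType R} U (f g : 'rV[R]_m -> W) x v :
  open U -> U x -> (forall y, U y -> f y = g y) -> 'D_v f x = 'D_v g x.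
Proof.
move=> oU Ux fg; apply: near_eq_derive.
by have := open_near oU Ux; apply: filterS => y /fg.
Qed.

Lemma pder_eq_on U f g x i :
  open U -> U x -> (forall y, U y -> f y = g y) -> pder i f x = pder i g x.
Proof. exact: derive_eq_on. Qed.

Lemma differentiable_eq_on U f g x :
  open U -> U x -> (forall y, U y -> f y = g y) ->
  differentiable f x -> differentiable g x.
Proof.
move=> oU Ux fg; apply: near_eq_differentiable.
by have := open_near oU Ux; apply: filterS => y /fg.
Qed.

Lemma deriveD_fun f g x v : differentiable f x -> differentiable g x ->
  'D_v (fun y => f y + g y) x = 'D_v f x + 'D_v g x.
Proof. by move=> df dg; rewrite -deriveD //; exact: diff_derivable. Qed.

Lemma deriveM_fun f g x v : differentiable f x -> differentiable g x ->
  'D_v (fun y => f y * g y) x = 'D_v f x * g x + f x * 'D_v g x.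
Proof.
move=> df dg; rewrite [LHS](@deriveM _ _ f g); [|exact: diff_derivable..].
by rewrite addrC [_ *: _]mulrC.
Qed.

Lemma derive_sum_fun (I : Type) (s : seq I) (F : I -> 'rV[R]_m -> R) x v :
  (forall i, differentiable (F i) x) ->
  differentiable (fun y => \sum_(i <- s) F i y) x /\
  'D_v (fun y => \sum_(i <- s) F i y) x = \sum_(i <- s) 'D_v (F i) x.
Proof.
move=> dF; elim: s => [|i s [d IH]].
  have E : (fun y => \sum_(i <- [::]) F i y) = cst 0.
    by apply/funext => y; rewrite big_nil.
  by rewrite E derive_cst big_nil; split=> //; exact: differentiable_cst.
have E : (fun y => \sum_(j <- i :: s) F j y) = (fun y => F i y + \sum_(j <- s) F j y).
  by apply/funext => y; rewrite big_cons.
rewrite E big_cons deriveD_fun // IH; split=> //.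
exact: differentiableD.
Qed.

Lemma derive_comp_fun n (g : 'rV[R]_m -> 'rV[R]_n) (f : 'rV[R]_n -> R) x v :
  (forall j, differentiable (fun y => g y 0 j) x) -> differentiable f (g x) ->
  differentiable (f \o g) x /\
  'D_v (f \o g) x = \sum_j 'D_v (fun y => g y 0 j) x * pder j f (g x).
Proof.
move=> dg df.
have dgx : differentiable g x.
  have -> : g = (fun y => \sum_j g y 0 j *: delta_mx 0 j).
    by apply/funext => y; exact: row_sum_delta.
  rewrite (_ : (fun y => _) = \sum_(j < n) (fun y => g y 0 j *: (delta_mx 0 j : 'rV[R]_n))).
    by apply: differentiable_sum => j; exact: differentiableZl.
  by apply/funext => y; rewrite fct_sumE.
have d : differentiable (f \o g) x by exact: differentiable_comp.
split=> //; rewrite deriveE // diff_comp //= -!deriveE // derive_pder //.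
by apply: eq_bigr => j _; rewrite derive_mx ?mxE //; exact: diff_derivable.
Qed.

Lemma deriveV_fun f x v : differentiable f x -> f x != 0 ->
  'D_v (fun y => (f y)^-1) x = - 'D_v f x * ((f x)^-1 * (f x)^-1).
Proof.
move=> df f0; rewrite [LHS](@deriveV _ _ f) //; last exact: diff_derivable.
by rewrite [_ *: _]mulrC mulNr mulrN -exprVn expr2.
Qed.

Lemma derive_sqrt_fun f x v : differentiable f x -> 0 < f x ->
  differentiable (fun y => Num.sqrt (f y)) x /\
  'D_v (fun y => Num.sqrt (f y)) x = 'D_v f x * (2^-1 * (Num.sqrt (f x))^-1).
Proof.
move=> df f0; have [dr dv] := is_derive1_sqrt f0.
have ds : differentiable (@Num.sqrt R) (f x) by apply/derivable1_diffP.
have d : differentiable (fun y => Num.sqrt (f y)) x by exact: (differentiable_comp df ds).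
split=> //; rewrite deriveE // [X in X v = _](@diff_comp _ _ _ _ f (@Num.sqrt R)) //=.
have L c : 'd (@Num.sqrt R) (f x) c = c * 'd (@Num.sqrt R) (f x) 1.
  by rewrite -[in LHS](mulr1 c) -[c * 1]/(c *: (1 : R)) linearZ.
by rewrite L -(deriveE v df) -(deriveE (1 : R) ds) dv invfM.
Qed.

Lemma derive_coord (j : 'I_m) x v : 'D_v (fun y : 'rV[R]_m => y 0 j) x = v 0 j.
Proof.
have @f : {linear 'rV[R]_m -> R}.
  by exists (fun N : 'rV[R]_m => N 0 j); do 2![eexists]; do ?[constructor];
     rewrite ?mxE// => ? *; rewrite ?mxE//; move=> ?; rewrite !mxE.
rewrite deriveE; last exact: differentiable_coord.
by rewrite (_ : (fun _ => _) = f) // diff_lin //; exact: coord_continuous.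
Qed.

End PartialDerivatives.

(** * Closure properties of smooth functions *)

Section SmoothFunctions.
Context {R : realType} {m : nat}.
Implicit Types (f g : 'rV[R]_m -> R) (x v : 'rV[R]_m) (U : set 'rV[R]_m) (r : nat).

Lemma diff_times_eq r U f g : open U -> (forall y, U y -> f y = g y) ->
  diff_times r U f -> diff_times r U g.
Proof.
move=> oU; elim: r f g => // r IH f g fg [df pf]; split=> [x Ux|i].
  exact: (differentiable_eq_on oU Ux fg (df x Ux)).
by apply: IH (pf i) => y Uy; exact: (pder_eq_on _ oU Uy fg).
Qed.

Lemma diff_times_sub r U U' f : U' `<=` U -> diff_times r U f -> diff_times r U' f.
Proof.
move=> sU; elim: r f => // r IH f [df pf]; split=> [x /sU/df //|i]; exact: IH (pf i).
Qed.

Lemma diff_timesW r U f : diff_times r.+1 U f -> diff_times r U f.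
Proof.
elim: r f => // r IH f [df pf]; split=> // i; exact: IH (pf i).
Qed.

Lemma diff_times_cst r U (c : R) : diff_times r U (fun=> c).
Proof.
elim: r c => // r IH c; split=> [x _|i]; first exact: differentiable_cst.
have -> : pder i (fun=> c) = fun=> 0 :> R by apply/funext => x; exact: derive_cst.
exact: IH.
Qed.

Lemma diff_timesD r U f g : open U ->
  diff_times r U f -> diff_times r U g -> diff_times r U (fun x => f x + g x).
Proof.
move=> oU; elim: r f g => // r IH f g [df pf] [dg pg]; split=> [x Ux|i].
  by apply: differentiableD; [exact: df|exact: dg].
apply: (diff_times_eq oU _ (IH _ _ (pf i) (pg i))) => x Ux.
by rewrite [RHS]deriveD_fun //; [exact: df|exact: dg].
Qed.

Lemma diff_timesM r U f g : open U ->
  diff_times r U f -> diff_times r U g -> diff_times r U (fun x => f x * g x).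
Proof.
move=> oU; elim: r f g => // r IH f g F G; split=> [x Ux|i].
  by apply: differentiableM; [exact: F.1|exact: G.1].
have A := diff_timesD oU (IH _ _ (F.2 i) (diff_timesW G)) (IH _ _ (diff_timesW F) (G.2 i)).
apply: (diff_times_eq oU _ A) => x Ux.
by rewrite [RHS]deriveM_fun //; [exact: F.1|exact: G.1].
Qed.

Lemma diff_times_sum r U (I : Type) (s : seq I) (F : I -> 'rV[R]_m -> R) : open U ->
  (forall i, diff_times r U (F i)) -> diff_times r U (fun x => \sum_(i <- s) F i x).
Proof.
move=> oU dF; elim: s => [|i s IH].
  by apply: (diff_times_eq oU _ (diff_times_cst r U 0)) => x _; rewrite big_nil.
apply: (diff_times_eq oU _ (diff_timesD oU (dF i) IH)) => x _.
by rewrite big_cons.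
Qed.

(** The derivative of 1/f is a product of -1, f', 1/f and 1/f, in which 1/f is needed only to the
    lower order; this closes the induction. The square root below is treated in the same way. *)
Lemma diff_timesV r U f : open U -> (forall x, U x -> f x != 0) ->
  diff_times r U f -> diff_times r U (fun x => (f x)^-1).
Proof.
move=> oU f0; elim: r => // r IH F; split=> [x Ux|i].
  by apply: differentiableV; [exact: F.1|exact: f0].
have V := IH (diff_timesW F).
have A := diff_timesM oU (diff_timesM oU (diff_times_cst r U (-1)) (F.2 i)) (diff_timesM oU V V).
apply: (diff_times_eq oU _ A) => x Ux.
rewrite [RHS]deriveV_fun //; [by rewrite mulN1r|exact: F.1|exact: f0].
Qed.

Lemma diff_times_sqrt r U f : open U -> (forall x, U x -> 0 < f x) ->
  diff_times r U f -> diff_times r U (fun x => Num.sqrt (f x)).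
Proof.
move=> oU f0; elim: r => // r IH F; split=> [x Ux|i].
  exact: (derive_sqrt_fun 0 (F.1 x Ux) (f0 x Ux)).1.
have s0 x : U x -> Num.sqrt (f x) != 0.
  by move=> Ux; rewrite gt_eqF // sqrtr_gt0; exact: f0.
have V := diff_timesV oU s0 (IH (diff_timesW F)).
have A := diff_timesM oU (F.2 i) (diff_timesM oU (diff_times_cst r U 2^-1) V).
apply: (diff_times_eq oU _ A) => x Ux.
by rewrite [RHS](derive_sqrt_fun _ (F.1 x Ux) (f0 x Ux)).2.
Qed.

Lemma diff_times_coord r U (j : 'I_m) : diff_times r U (fun x => x 0 j).
Proof.
case: r => // r; split=> [x _|i]; first exact: differentiable_coord.
rewrite (_ : pder i _ = fun=> (delta_mx 0 i : 'rV[R]_m) 0 j); last first.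
  by apply/funext => x; exact: derive_coord.
exact: diff_times_cst.
Qed.

Lemma smooth_diff U f x : smooth U f -> U x -> differentiable f x.
Proof. by move=> /(_ 1%N)[+ _]; apply. Qed.

Lemma smooth_pder U f i : smooth U f -> smooth U (pder i f).
Proof. by move=> sf r; have [_] := sf r.+1; apply. Qed.

Lemma smooth_continuous U f x : smooth U f -> U x -> {for x, continuous f}.
Proof. by move=> sf Ux; apply: differentiable_continuous; exact: smooth_diff Ux. Qed.

Lemma smooth_eq U f g : open U -> (forall y, U y -> f y = g y) ->
  smooth U f -> smooth U g.
Proof. by move=> oU fg sf r; exact: diff_times_eq (sf r). Qed.

Lemma smooth_sub U U' f : U' `<=` U -> smooth U f -> smooth U' f.
Proof. by move=> sU sf r; exact: diff_times_sub (sf r). Qed.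

Lemma smooth_cst U (c : R) : smooth U (fun=> c).
Proof. by move=> r; exact: diff_times_cst. Qed.

Lemma smoothD U f g : open U -> smooth U f -> smooth U g ->
  smooth U (fun x => f x + g x).
Proof. by move=> oU sf sg r; exact: diff_timesD. Qed.

Lemma smoothM U f g : open U -> smooth U f -> smooth U g ->
  smooth U (fun x => f x * g x).
Proof. by move=> oU sf sg r; exact: diff_timesM. Qed.

Lemma smoothN U f : open U -> smooth U f -> smooth U (fun x => - f x).
Proof.
move=> oU sf; apply: (smooth_eq oU _ (smoothM oU (smooth_cst U (-1)) sf)) => x _.
by rewrite mulN1r.
Qed.

Lemma smoothB U f g : open U -> smooth U f -> smooth U g ->
  smooth U (fun x => f x - g x).
Proof. by move=> oU sf sg; apply: smoothD => //; exact: smoothN. Qed.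

Lemma smooth_sum U (I : Type) (s : seq I) (F : I -> 'rV[R]_m -> R) : open U ->
  (forall i, smooth U (F i)) -> smooth U (fun x => \sum_(i <- s) F i x).
Proof. by move=> oU sF r; apply: diff_times_sum => // i; exact: sF. Qed.

Lemma smooth_prod U (I : Type) (s : seq I) (F : I -> 'rV[R]_m -> R) : open U ->
  (forall i, smooth U (F i)) -> smooth U (fun x => \prod_(i <- s) F i x).
Proof.
move=> oU sF; elim: s => [|i s IH].
  by apply: (smooth_eq oU _ (smooth_cst U 1)) => x _; rewrite big_nil.
by apply: (smooth_eq oU _ (smoothM oU (sF i) IH)) => x _; rewrite big_cons.
Qed.

Lemma smoothV U f : open U -> (forall x, U x -> f x != 0) -> smooth U f ->
  smooth U (fun x => (f x)^-1).
Proof. by move=> oU f0 sf r; exact: diff_timesV. Qed.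

Lemma smooth_sqrt U f : open U -> (forall x, U x -> 0 < f x) -> smooth U f ->
  smooth U (fun x => Num.sqrt (f x)).
Proof. by move=> oU f0 sf r; exact: diff_times_sqrt. Qed.

Lemma smooth_coord U (j : 'I_m) : smooth U (fun x => x 0 j).
Proof. by move=> r; exact: diff_times_coord. Qed.

Lemma pder_comm U f i j x : open U -> smooth U f -> U x ->
  pder i (pder j f) x = pder j (pder i f) x.
Proof.
move=> oU sf Ux; apply: pder_comm_C2.
- have := open_near oU Ux; apply: filterS => y Uy; split.
  + exact: smooth_diff Uy.
  + exact: (smooth_diff (smooth_pder i sf) Uy).
  + exact: (smooth_diff (smooth_pder j sf) Uy).
- exact: (smooth_continuous (smooth_pder i (smooth_pder j sf)) Ux).
- exact: (smooth_continuous (smooth_pder j (smooth_pder i sf)) Ux).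
Qed.

End SmoothFunctions.

Lemma diff_times_comp {R : realType} {m n : nat} r (U : set 'rV[R]_m)
    (W : set 'rV[R]_n) (g : 'rV[R]_m -> 'rV[R]_n) (f : 'rV[R]_n -> R) :
  open U -> (forall x, U x -> W (g x)) ->
  (forall j, diff_times r U (fun y => g y 0 j)) -> diff_times r W f ->
  diff_times r U (f \o g).
Proof.
move=> oU gW; elim: r f => // r IH f G F; split=> [x Ux|i].
  by apply: (derive_comp_fun 0 _ (F.1 _ (gW _ Ux))).1 => j; exact: (G j).1.
have A : diff_times r U (fun x => \sum_j pder i (fun y => g y 0 j) x * (pder j f \o g) x).
  apply: diff_times_sum => // j; apply: diff_timesM => //; first exact: (G j).2.
  by apply: IH => [l|]; [exact: diff_timesW (G l)|exact: F.2].
apply: (diff_times_eq oU _ A) => x Ux.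
by rewrite [RHS](derive_comp_fun _ _ (F.1 _ (gW _ Ux))).2 // => j; exact: (G j).1.
Qed.

Lemma smooth_comp {R : realType} {m n : nat} (U : set 'rV[R]_m)
    (W : set 'rV[R]_n) (g : 'rV[R]_m -> 'rV[R]_n) (f : 'rV[R]_n -> R) :
  open U -> (forall x, U x -> W (g x)) -> smooth_mx U g -> smooth W f ->
  smooth U (f \o g).
Proof. by move=> oU gW sg sf r; apply: diff_times_comp gW _ (sf r) => // j; exact: sg. Qed.

Lemma eq_derive {R : realType} {V W : normedModType R} (f g : V -> W) x v :
  f =1 g -> 'D_v f x = 'D_v g x.
Proof. by move=> /funext ->. Qed.

(** * Matrix-valued functions and Jacobians *)

Section SmoothMatrices.
Context {R : realType} {m : nat}.
Implicit Types (x v w : 'rV[R]_m) (U : set 'rV[R]_m).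

Lemma smooth_mx_eq {a b} U (F G : 'rV[R]_m -> 'M[R]_(a, b)) : open U ->
  (forall y, U y -> F y = G y) -> smooth_mx U F -> smooth_mx U G.
Proof.
by move=> oU FG sF i j; apply: (smooth_eq oU _ (sF i j)) => y Uy; rewrite FG.
Qed.

Lemma smooth_mx_sub {a b} U U' (F : 'rV[R]_m -> 'M[R]_(a, b)) :
  U' `<=` U -> smooth_mx U F -> smooth_mx U' F.
Proof. by move=> sU sF i j; exact: smooth_sub (sF i j). Qed.

Lemma smooth_mx_cst {a b} U (A : 'M[R]_(a, b)) : smooth_mx U (fun=> A).
Proof. by move=> i j; exact: smooth_cst. Qed.

Lemma smooth_mx_id U : smooth_mx U (fun x : 'rV[R]_m => x).
Proof. by move=> i j; rewrite (ord1 i); exact: smooth_coord. Qed.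

Lemma smooth_mxD {a b} U (F G : 'rV[R]_m -> 'M[R]_(a, b)) : open U ->
  smooth_mx U F -> smooth_mx U G -> smooth_mx U (fun y => F y + G y).
Proof.
move=> oU sF sG i j; apply: (smooth_eq oU _ (smoothD oU (sF i j) (sG i j))) => y _.
by rewrite mxE.
Qed.

Lemma smooth_mxZ {a b} U f (F : 'rV[R]_m -> 'M[R]_(a, b)) : open U ->
  smooth U f -> smooth_mx U F -> smooth_mx U (fun y => f y *: F y).
Proof.
move=> oU sf sF i j; apply: (smooth_eq oU _ (smoothM oU sf (sF i j))) => y _.
by rewrite mxE.
Qed.

Lemma smooth_mxN {a b} U (F : 'rV[R]_m -> 'M[R]_(a, b)) : open U ->
  smooth_mx U F -> smooth_mx U (fun y => - F y).
Proof.
move=> oU sF i j; apply: (smooth_eq oU _ (smoothN oU (sF i j))) => y _.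
by rewrite mxE.
Qed.

Lemma smooth_mxB {a b} U (F G : 'rV[R]_m -> 'M[R]_(a, b)) : open U ->
  smooth_mx U F -> smooth_mx U G -> smooth_mx U (fun y => F y - G y).
Proof. by move=> oU sF sG; apply: smooth_mxD => //; exact: smooth_mxN. Qed.

Lemma smooth_mxM {a b c} U (F : 'rV[R]_m -> 'M[R]_(a, b))
    (G : 'rV[R]_m -> 'M[R]_(b, c)) : open U ->
  smooth_mx U F -> smooth_mx U G -> smooth_mx U (fun y => F y *m G y).
Proof.
move=> oU sF sG i j.
have A : smooth U (fun y => \sum_l F y i l * G y l j).
  by apply: smooth_sum => // l; apply: smoothM.
by apply: (smooth_eq oU _ A) => y _; rewrite mxE.
Qed.

Lemma smooth_mxT {a b} U (F : 'rV[R]_m -> 'M[R]_(a, b)) : open U ->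
  smooth_mx U F -> smooth_mx U (fun y => (F y)^T).
Proof. by move=> oU sF i j; apply: (smooth_eq oU _ (sF j i)) => y _; rewrite mxE. Qed.

Lemma smooth_row_mx {a b c} U (F : 'rV[R]_m -> 'M[R]_(a, b))
    (G : 'rV[R]_m -> 'M[R]_(a, c)) : open U ->
  smooth_mx U F -> smooth_mx U G -> smooth_mx U (fun y => row_mx (F y) (G y)).
Proof.
move=> oU sF sG i j; case: (split_ordP j) => l ->.
  by apply: (smooth_eq oU _ (sF i l)) => y _; rewrite row_mxEl.
by apply: (smooth_eq oU _ (sG i l)) => y _; rewrite row_mxEr.
Qed.

Lemma smooth_col_mx {a b c} U (F : 'rV[R]_m -> 'M[R]_(a, c))
    (G : 'rV[R]_m -> 'M[R]_(b, c)) : open U ->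
  smooth_mx U F -> smooth_mx U G -> smooth_mx U (fun y => col_mx (F y) (G y)).
Proof.
move=> oU sF sG i j; case: (split_ordP i) => l ->.
  by apply: (smooth_eq oU _ (sF l j)) => y _; rewrite col_mxEu.
by apply: (smooth_eq oU _ (sG l j)) => y _; rewrite col_mxEd.
Qed.

Lemma smooth_det {a} U (F : 'rV[R]_m -> 'M[R]_a) : open U ->
  smooth_mx U F -> smooth U (fun y => \det (F y)).
Proof.
move=> oU sF; apply: smooth_sum => // s; apply: smoothM => //; first exact: smooth_cst.
by apply: smooth_prod => // i; exact: sF.
Qed.

Lemma smooth_adj {a} U (F : 'rV[R]_m -> 'M[R]_a) : open U ->
  smooth_mx U F -> smooth_mx U (fun y => \adj (F y)).
Proof.
move=> oU sF i j; apply: (smooth_eq (f := fun y => (-1) ^+ (j + i) * \det (row' j (col' i (F y)))) oU).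
  by move=> y _; rewrite mxE.
apply: smoothM => //; first exact: smooth_cst.
apply: smooth_det => // p q; apply: (smooth_eq oU _ (sF (lift j p) (lift i q))) => y _.
by rewrite !mxE.
Qed.

Lemma smooth_invmx {a} U (F : 'rV[R]_m -> 'M[R]_a) : open U ->
  (forall y, U y -> F y \in unitmx) -> smooth_mx U F ->
  smooth_mx U (fun y => invmx (F y)).
Proof.
move=> oU uF sF.
apply: (smooth_mx_eq (F := fun y => (\det (F y))^-1 *: \adj (F y)) oU).
  by move=> y Uy; rewrite /invmx uF.
apply: smooth_mxZ => //; last exact: smooth_adj.
apply: smoothV => //; last exact: smooth_det.
by move=> y Uy; have := uF y Uy; rewrite unitmxE unitfE.
Qed.

Lemma smooth_mx_derivable {a b} U (F : 'rV[R]_m -> 'M[R]_(a, b)) x v :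
  smooth_mx U F -> U x -> derivable F x v.
Proof.
by move=> sF Ux; apply/derivable_mxP => i j; apply: diff_derivable; exact: (smooth_diff (sF i j) Ux).
Qed.

Lemma derive_mxE {a b} U (F : 'rV[R]_m -> 'M[R]_(a, b)) x v i j :
  smooth_mx U F -> U x -> ('D_v F x) i j = 'D_v (fun y => F y i j) x.
Proof. by move=> sF Ux; rewrite derive_mx ?mxE //; exact: smooth_mx_derivable Ux. Qed.

Lemma derive_mx_pder {a b} U (F : 'rV[R]_m -> 'M[R]_(a, b)) x v i j :
  smooth_mx U F -> U x -> ('D_v F x) i j = \sum_l v 0 l * pder l (fun y => F y i j) x.
Proof.
move=> sF Ux; rewrite (derive_mxE _ _ _ sF Ux) derive_pder //.
exact: (smooth_diff (sF i j) Ux).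
Qed.

Lemma derive_mx_linear {a b} U (F : 'rV[R]_m -> 'M[R]_(a, b)) x c v w :
  smooth_mx U F -> U x -> 'D_(c *: v + w) F x = c *: 'D_v F x + 'D_w F x.
Proof.
move=> sF Ux; apply/matrixP => i j; rewrite mxE [in RHS]mxE.
rewrite [LHS](derive_mx_pder (c *: v + w) i j sF Ux).
rewrite (derive_mx_pder v i j sF Ux) (derive_mx_pder w i j sF Ux).
rewrite mulr_sumr -big_split /=.
by apply: eq_bigr => l _; rewrite !mxE mulrDl mulrA.
Qed.

Lemma derive_mxZv {a b} U (F : 'rV[R]_m -> 'M[R]_(a, b)) x c v :
  smooth_mx U F -> U x -> 'D_(c *: v) F x = c *: 'D_v F x.
Proof. by move=> sF Ux; rewrite -[c *: v]addr0 (derive_mx_linear _ _ _ sF Ux) derive0 addr0. Qed.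

Lemma derive_mxD {a b} U (F G : 'rV[R]_m -> 'M[R]_(a, b)) x v :
  smooth_mx U F -> smooth_mx U G -> U x ->
  'D_v (fun y => F y + G y) x = 'D_v F x + 'D_v G x.
Proof. by move=> sF sG Ux; rewrite -deriveD //; exact: smooth_mx_derivable Ux. Qed.

Lemma derive_mxZ {a b} U f (F : 'rV[R]_m -> 'M[R]_(a, b)) x v : open U ->
  smooth U f -> smooth_mx U F -> U x ->
  'D_v (fun y => f y *: F y) x = 'D_v f x *: F x + f x *: 'D_v F x.
Proof.
move=> oU sf sF Ux; have sfF := smooth_mxZ oU sf sF.
apply/matrixP => i j; rewrite (derive_mxE _ _ _ sfF Ux) !mxE (derive_mxE _ _ _ sF Ux).
rewrite -deriveM_fun; [|exact: smooth_diff Ux|exact: (smooth_diff (sF i j) Ux)].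
by apply: eq_derive => y; rewrite mxE.
Qed.

Lemma derive_mxM {a b c} U (F : 'rV[R]_m -> 'M[R]_(a, b))
    (G : 'rV[R]_m -> 'M[R]_(b, c)) x v : open U ->
  smooth_mx U F -> smooth_mx U G -> U x ->
  'D_v (fun y => F y *m G y) x = 'D_v F x *m G x + F x *m 'D_v G x.
Proof.
move=> oU sF sG Ux; apply/matrixP => i j.
rewrite (derive_mxE _ _ _ (smooth_mxM oU sF sG) Ux) !mxE -big_split /=.
rewrite (_ : (fun y => _) = (fun y => \sum_l F y i l * G y l j)); last first.
  by apply/funext => y; rewrite mxE.
rewrite (derive_sum_fun _ _ _).2 => [|l]; last first.
  by apply: differentiableM; [exact: (smooth_diff (sF i l) Ux)|exact: (smooth_diff (sG l j) Ux)].
apply: eq_bigr => l _; rewrite (derive_mxE _ _ _ sF Ux) (derive_mxE _ _ _ sG Ux).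
by rewrite deriveM_fun //; [exact: (smooth_diff (sF i l) Ux)|exact: (smooth_diff (sG l j) Ux)].
Qed.

Lemma derive_mxT {a b} U (F : 'rV[R]_m -> 'M[R]_(a, b)) x v : open U ->
  smooth_mx U F -> U x -> 'D_v (fun y => (F y)^T) x = ('D_v F x)^T.
Proof.
move=> oU sF Ux; apply/matrixP => i j.
rewrite (derive_mxE _ _ _ (smooth_mxT oU sF) Ux) mxE (derive_mxE _ _ _ sF Ux).
by apply: eq_derive => y; rewrite mxE.
Qed.

Lemma smooth_derive_mx {a b} U (X : 'rV[R]_m -> 'rV[R]_m) (F : 'rV[R]_m -> 'M[R]_(a, b)) :
  open U -> smooth_mx U X -> smooth_mx U F -> smooth_mx U (fun y => 'D_(X y) F y).
Proof.
move=> oU sX sF i j.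
have A : smooth U (fun x => \sum_l X x 0 l * pder l (fun y => F y i j) x).
  by apply: smooth_sum => // l; apply: smoothM => //; apply: smooth_pder; exact: sF.
by apply: (smooth_eq oU _ A) => y Uy; rewrite (derive_mx_pder _ _ _ sF Uy).
Qed.

Lemma smooth_lie_bracket U (X Y : 'rV[R]_m -> 'rV[R]_m) : open U ->
  smooth_mx U X -> smooth_mx U Y -> smooth_mx U (lie_bracket X Y).
Proof. by move=> oU sX sY; apply: smooth_mxB => //; exact: smooth_derive_mx. Qed.

Lemma differentiable_row n (g : 'rV[R]_m -> 'rV[R]_n) x :
  (forall j, differentiable (fun y => g y 0 j) x) -> differentiable g x.
Proof.
move=> dg.
have -> : g = (fun y => \sum_j g y 0 j *: delta_mx 0 j).
  by apply/funext => y; exact: row_sum_delta.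
rewrite (_ : (fun y => _) = \sum_(j < n) (fun y => g y 0 j *: (delta_mx 0 j : 'rV[R]_n))).
  by apply: differentiable_sum => j; exact: differentiableZl.
by apply/funext => y; rewrite fct_sumE.
Qed.

Lemma derive_jacobian n U (g : 'rV[R]_m -> 'rV[R]_n) x v :
  smooth_mx U g -> U x -> 'D_v g x = v *m jacobian g x.
Proof.
move=> sg Ux; rewrite deriveEjacobian //; apply: differentiable_row => j.
exact: (smooth_diff (sg 0 j) Ux).
Qed.

Lemma jacobianE n U (g : 'rV[R]_m -> 'rV[R]_n) x i j :
  smooth_mx U g -> U x -> jacobian g x i j = pder i (fun y => g y 0 j) x.
Proof.
move=> sg Ux; rewrite /pder -(derive_mxE _ _ _ sg Ux) (derive_jacobian _ sg Ux).
by rewrite -rowE [RHS]mxE.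
Qed.

Lemma smooth_jacobian n U (g : 'rV[R]_m -> 'rV[R]_n) :
  open U -> smooth_mx U g -> smooth_mx U (jacobian g).
Proof.
move=> oU sg i j; apply: (smooth_eq oU _ (smooth_pder i (sg 0 j))) => y Uy.
by rewrite (jacobianE _ _ sg Uy).
Qed.

End SmoothMatrices.

(** * The chain rule *)

Section ChainRule.
Context {R : realType} {m n : nat}.
Implicit Types (x v w : 'rV[R]_m) (U : set 'rV[R]_m) (W : set 'rV[R]_n).

Lemma smooth_mx_comp {a b} U W (g : 'rV[R]_m -> 'rV[R]_n) (F : 'rV[R]_n -> 'M[R]_(a, b)) :
  open U -> (forall x, U x -> W (g x)) -> smooth_mx U g -> smooth_mx W F ->
  smooth_mx U (fun y => F (g y)).
Proof.
move=> oU gW sg sF i j.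
have A := smooth_comp oU gW sg (sF i j).
exact A.
Qed.

Lemma derive_mx_comp {a b} U W (g : 'rV[R]_m -> 'rV[R]_n) (F : 'rV[R]_n -> 'M[R]_(a, b)) x v :
  open U -> (forall x, U x -> W (g x)) -> smooth_mx U g -> smooth_mx W F -> U x ->
  'D_v (fun y => F (g y)) x = 'D_(v *m jacobian g x) F (g x).
Proof.
move=> oU gW sg sF Ux; apply/matrixP => i j.
rewrite (derive_mxE _ _ _ (smooth_mx_comp oU gW sg sF) Ux).
rewrite (derive_mx_pder _ _ _ sF (gW _ Ux)).
have dF : differentiable (fun y => F y i j) (g x) := smooth_diff (sF i j) (gW _ Ux).
have dg l : differentiable (fun y => g y 0 l) x := smooth_diff (sg 0 l) Ux.
rewrite [LHS](derive_comp_fun v dg dF).2; apply: eq_bigr => l _; congr (_ * _).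
by rewrite -(derive_jacobian _ sg Ux) (derive_mxE _ _ _ sg Ux).
Qed.

Lemma jacobian_comp l U W (g : 'rV[R]_m -> 'rV[R]_n) (F : 'rV[R]_n -> 'rV[R]_l) x :
  open U -> (forall x, U x -> W (g x)) -> smooth_mx U g -> smooth_mx W F -> U x ->
  jacobian (F \o g) x = jacobian g x *m jacobian F (g x).
Proof.
move=> oU gW sg sF Ux; apply/row_matrixP => i; rewrite !rowE mulmxA.
rewrite -(derive_jacobian _ (smooth_mx_comp oU gW sg sF) Ux).
by rewrite (derive_mx_comp _ oU gW sg sF Ux) (derive_jacobian _ sF (gW _ Ux)).
Qed.

(* Symmetry of the second derivative of [g]. *)
Lemma derive_jacobian_sym U (g : 'rV[R]_m -> 'rV[R]_n) x v w :
  open U -> smooth_mx U g -> U x ->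
  w *m 'D_v (jacobian g) x = v *m 'D_w (jacobian g) x.
Proof.
move=> oU sg Ux; apply/rowP => j; rewrite [LHS]mxE [RHS]mxE.
have E (u : 'rV[R]_m) i : ('D_u (jacobian g) x) i j =
    \sum_l u 0 l * pder l (pder i (fun y => g y 0 j)) x.
  rewrite (derive_mx_pder _ _ _ (smooth_jacobian oU sg) Ux).
  apply: eq_bigr => l _; congr (_ * _); apply: (pder_eq_on _ oU Ux) => y Uy.
  exact: (jacobianE _ _ sg Uy).
have EE (u u' : 'rV[R]_m) : \sum_i u' 0 i * ('D_u (jacobian g) x) i j =
    \sum_i \sum_l u' 0 i * (u 0 l * pder l (pder i (fun y => g y 0 j)) x).
  by apply: eq_bigr => i _; rewrite E mulr_sumr.
apply: etrans (EE v w) (etrans _ (esym (EE w v))).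
rewrite exchange_big /=; apply: eq_bigr => i _; apply: eq_bigr => l _.
by rewrite mulrCA (pder_comm _ _ oU (sg 0 j) Ux).
Qed.

End ChainRule.

(** * Differential forms *)

Lemma mx_bilinP {R : pzRingType} {a b} (A B : 'M[R]_(a, b)) :
  (forall (v : 'rV[R]_a) (w : 'rV[R]_b), v *m A *m w^T = v *m B *m w^T) -> A = B.
Proof.
move=> H; apply/matrixP => i j; have := H (delta_mx 0 i) (delta_mx 0 j).
by rewrite -!rowE trmx_delta -!colE => /matrixP/(_ 0 0); rewrite !mxE.
Qed.

Lemma mx_bilinE {R : pzRingType} {a b} (A : 'M[R]_(a, b)) (v : 'rV_a) (w : 'rV_b) :
  (v *m A *m w^T) 0 0 = \sum_i \sum_j v 0 i * A i j * w 0 j.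
Proof.
rewrite mxE exchange_big /=; apply: eq_bigr => j _; rewrite [in LHS]mxE mulr_suml.
by apply: eq_bigr => i _; rewrite [w^T _ _]mxE.
Qed.

Lemma scal_mxP {R : pzRingType} (A B : 'M[R]_1) : A 0 0 = B 0 0 -> A = B.
Proof. by move=> E; apply/matrixP => i j; rewrite !ord1. Qed.

Lemma mx_delta_bilin {R : pzRingType} {a b} (A : 'M[R]_(a, b)) i j :
  ((delta_mx 0 i : 'rV_a) *m A *m (delta_mx 0 j : 'rV_b)^T) 0 0 = A i j.
Proof. by rewrite trmx_delta -rowE -colE !mxE. Qed.

(** The exterior derivative of the 2-form [s] on the constant fields [u], [v], [w]. Their brackets
    vanish, so only the cyclic sum of derivatives is left. *)
Definition d2_at {R : realType} {m : nat} (s : 'rV[R]_m -> 'M[R]_m) (x u v w : 'rV[R]_m)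
    : 'M[R]_1 :=
  v *m 'D_u s x *m w^T + w *m 'D_v s x *m u^T + u *m 'D_w s x *m v^T.

Section ExteriorDerivative.
Context {R : realType} {m : nat}.
Implicit Types (x u v w : 'rV[R]_m) (U : set 'rV[R]_m) (X Y : 'rV[R]_m -> 'rV[R]_m).
Implicit Types (a : 'rV[R]_m -> 'cV[R]_m) (s : 'rV[R]_m -> 'M[R]_m).

Lemma ext_d1_bilin U a x v w : smooth_mx U a -> U x ->
  v *m ext_d1 a x *m w^T = w *m 'D_v a x - v *m 'D_w a x.
Proof.
move=> sa Ux; apply: scal_mxP; rewrite mx_bilinE [RHS]mxE [X in _ + X]mxE.
have E (p q : 'rV[R]_m) : (q *m 'D_p a x) 0 0 =
    \sum_j \sum_i q 0 j * (p 0 i * pder i (fun y => a y j 0) x).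
  by rewrite mxE; apply: eq_bigr => j _; rewrite (derive_mx_pder p j 0 sa Ux) mulr_sumr.
apply: etrans (esym (congr2 (fun p q : R => p - q) (E v w) (E w v))).
rewrite [X in X - _]exchange_big /= -sumrB; apply: eq_bigr => i _.
by rewrite -sumrB; apply: eq_bigr => j _; rewrite mxE; ring.
Qed.

Lemma smooth_ext_d1 U a : open U -> smooth_mx U a -> smooth_mx U (ext_d1 a).
Proof.
move=> oU sa i j.
have A : smooth U (fun x => pder i (fun y => a y j 0) x - pder j (fun y => a y i 0) x).
  by apply: smoothB => //; apply: smooth_pder; exact: sa.
by apply: (smooth_eq oU _ A) => y _; rewrite mxE.
Qed.

Lemma smooth_ext_d0 U f : open U -> smooth U f -> smooth_mx U (ext_d0 f).
Proof.
move=> oU sf i j; apply: (smooth_eq oU _ (smooth_pder i sf)) => y _.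
by rewrite mxE.
Qed.

Lemma ext_d1_eq_on U a b x : open U -> U x -> (forall y, U y -> a y = b y) ->
  ext_d1 a x = ext_d1 b x.
Proof.
move=> oU Ux ab; apply/matrixP => i j; rewrite [LHS]mxE [RHS]mxE.
by congr (_ - _); apply: (pder_eq_on _ oU Ux) => y Uy; rewrite ab.
Qed.

Lemma ext_d1_skew a x : (ext_d1 a x)^T = - ext_d1 a x.
Proof.
by apply/matrixP => i j; rewrite !mxE opprB.
Qed.

Lemma ext_d1_comb U a b c x : open U -> smooth_mx U a -> smooth_mx U b -> U x ->
  ext_d1 (fun y => c *: a y + b y) x = c *: ext_d1 a x + ext_d1 b x.
Proof.
move=> oU sa sb Ux; have sca := smooth_mxZ oU (smooth_cst U c) sa.
have sD := smooth_mxD oU sca sb; apply: mx_bilinP => v w.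
have E u : 'D_u (fun y => c *: a y + b y) x = c *: 'D_u a x + 'D_u b x.
  rewrite (derive_mxD u sca sb Ux) (derive_mxZ u oU (smooth_cst U c) sa Ux).
  by rewrite derive_cst scale0r add0r.
rewrite (ext_d1_bilin v w sD Ux) mulmxDr mulmxDl -scalemxAr -scalemxAl.
rewrite (ext_d1_bilin v w sa Ux) (ext_d1_bilin v w sb Ux) !E !mulmxDr -!scalemxAr.
move: (w *m _) (v *m 'D_w a x) (w *m 'D_v b x) (v *m 'D_w b x) => p q p' q'.
by rewrite scalerBr opprD addrACA.
Qed.

Lemma ext_d1_ext_d0 U f x : open U -> smooth U f -> U x -> ext_d1 (ext_d0 f) x = 0.
Proof.
move=> oU sf Ux; apply/matrixP => i j; rewrite [LHS]mxE [RHS]mxE.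
have E p q : pder p (fun y => ext_d0 f y q 0) x = pder p (pder q f) x.
  by apply: (pder_eq_on _ oU Ux) => y _; rewrite mxE.
by rewrite E E (pder_comm _ _ oU sf Ux) subrr.
Qed.

Lemma derive_ext_d0 f x v : differentiable f x -> v *m ext_d0 f x = ('D_v f x)%:M.
Proof.
move=> df; apply: scal_mxP; rewrite derive_pder // [RHS]mxE eqxx mulr1n [LHS]mxE.
by apply: eq_bigr => i _; rewrite [ext_d0 _ _ _ _]mxE.
Qed.

Lemma lie_bracketZl U f X Y x : open U -> smooth U f -> smooth_mx U X -> smooth_mx U Y ->
  U x -> lie_bracket (fun y => f y *: X y) Y x =
     f x *: lie_bracket X Y x - 'D_(Y x) f x *: X x.
Proof.
move=> oU sf sX sY Ux; rewrite /lie_bracket (derive_mxZv (f x) (X x) sY Ux).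
by rewrite (derive_mxZ (Y x) oU sf sX Ux) scalerBr opprD [- _ - _]addrC addrA.
Qed.

(** Cartan's formula. Leibniz's rule applied to a(Y) and a(X) produces the terms with derivatives of
    [X] and [Y], and these combine into the bracket. *)
Lemma ext_d1_fields U a X Y x : open U -> smooth_mx U a -> smooth_mx U X -> smooth_mx U Y ->
  U x -> X x *m ext_d1 a x *m (Y x)^T =
    'D_(X x) (fun y => Y y *m a y) x - 'D_(Y x) (fun y => X y *m a y) x
    - lie_bracket X Y x *m a x.
Proof.
move=> oU sa sX sY Ux; rewrite (ext_d1_bilin (X x) (Y x) sa Ux).
rewrite (derive_mxM (X x) oU sY sa Ux) (derive_mxM (Y x) oU sX sa Ux).
rewrite mulmxBl; move: ('D_(X x) Y x *m a x) ('D_(Y x) X x *m a x) => p q.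
move: (Y x *m 'D_(X x) a x) (X x *m 'D_(Y x) a x) => p' q'.
by rewrite !opprD !opprK; apply/matrixP => i j; rewrite !mxE; ring.
Qed.

Lemma derive_const {p q} U (F : 'rV[R]_m -> 'M[R]_(p, q)) A x v : open U -> U x ->
  (forall y, U y -> F y = A) -> 'D_v F x = 0.
Proof. by move=> oU Ux FA; rewrite (derive_eq_on v oU Ux FA) derive_cst. Qed.

Lemma derive_bilin U s x u v w : smooth_mx U s -> U x ->
  (v *m 'D_u s x *m w^T) 0 0 =
    \sum_i \sum_j \sum_l u 0 i * v 0 j * w 0 l * pder i (fun y => s y j l) x.
Proof.
move=> ss Ux; rewrite mx_bilinE [RHS]exchange_big /=; apply: eq_bigr => j _.
rewrite [RHS]exchange_big /=; apply: eq_bigr => l _.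
rewrite (derive_mx_pder u j l ss Ux) mulr_sumr mulr_suml; apply: eq_bigr => i _.
by ring.
Qed.

(** The index identity is the case of basis vectors; the general case follows by trilinearity once
    the three cyclic sums are brought to a common order of summation. *)
Lemma closed_2formP U s : smooth_mx U s ->
  closed_2form U s <-> forall x, U x -> forall u v w, d2_at s x u v w = 0.
Proof.
move=> ss; split=> [H x Ux u v w|H x Ux i j l].
  apply: scal_mxP; rewrite [LHS]mxE [X in X + _]mxE [RHS]mxE.
  rewrite (derive_bilin u v w ss Ux) (derive_bilin v w u ss Ux) (derive_bilin w u v ss Ux).
  have E2 : \sum_i \sum_j \sum_l v 0 i * w 0 j * u 0 l * pder i (fun y => s y j l) x =
      \sum_i \sum_j \sum_l u 0 i * v 0 j * w 0 l * pder j (fun y => s y l i) x.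
    rewrite [RHS]exchange_big; apply: eq_bigr => j _.
    rewrite [RHS]exchange_big; apply: eq_bigr => l _; apply: eq_bigr => i _ /=; ring.
  have E3 : \sum_i \sum_j \sum_l w 0 i * u 0 j * v 0 l * pder i (fun y => s y j l) x =
      \sum_i \sum_j \sum_l u 0 i * v 0 j * w 0 l * pder l (fun y => s y i j) x.
    rewrite exchange_big; apply: eq_bigr => i _.
    rewrite exchange_big; apply: eq_bigr => j _; apply: eq_bigr => l _ /=; ring.
  rewrite E2 E3 -!big_split big1 // => i _ /=; rewrite -!big_split big1 // => j _ /=.
  by rewrite -!big_split big1 // => l _ /=; rewrite -!mulrDr H // mulr0.
have K : d2_at s x (delta_mx 0 i) (delta_mx 0 j) (delta_mx 0 l) 0 0 = 0.
  by rewrite H // mxE.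
have E p q t : pder p (fun y => s y q t) x =
    ((delta_mx 0 q : 'rV_m) *m 'D_(delta_mx 0 p) s x *m (delta_mx 0 t : 'rV_m)^T) 0 0.
  by rewrite mx_delta_bilin (derive_mxE _ _ _ ss Ux).
apply: etrans (congr2 (fun p q : R => p + q) (congr2 (fun p q : R => p + q)
  (E i j l) (E j l i)) (E l i j)) _.
rewrite -[RHS]K /d2_at [RHS]mxE [X in _ = X + _]mxE.
reflexivity.
Qed.

Lemma ext_d1_closed U a : open U -> smooth_mx U a -> closed_2form U (ext_d1 a).
Proof.
move=> oU sa x Ux i j l.
have E p q t : pder p (fun y => ext_d1 a y q t) x =
   pder p (pder q (fun y => a y t 0)) x - pder p (pder t (fun y => a y q 0)) x.
  rewrite (pder_eq_on (g := fun y => pder q (fun y => a y t 0) y + -1 * pder t (fun y => a y q 0) y) _ oU Ux).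
    rewrite /pder deriveD_fun; last 2 first.
    - exact: (smooth_diff (smooth_pder q (sa t 0)) Ux).
    - exact: (smooth_diff (smoothM oU (smooth_cst U (-1)) (smooth_pder t (sa q 0))) Ux).
    rewrite [X in _ + X]deriveM_fun; last 2 first.
    - exact: differentiable_cst.
    - exact: (smooth_diff (smooth_pder t (sa q 0)) Ux).
    by rewrite derive_cst mul0r add0r mulN1r.
  by move=> y _; rewrite mxE mulN1r.
rewrite !E (pder_comm i j oU (sa l 0) Ux) (pder_comm i l oU (sa j 0) Ux).
rewrite (pder_comm j l oU (sa i 0) Ux).
move: (pder j (pder i _) x) (pder l (pder i _) x) (pder l (pder j _) x) => p q t.
ring.
Qed.

(** Cartan's formula for a 2-form with both fields in its kernel. Differentiating X s = 0 and Y s =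
    0 moves each derivative from [s] to the field, and only the bracket term survives. *)
Lemma d2_null U s X Y x w : open U -> smooth_mx U s -> smooth_mx U X -> smooth_mx U Y ->
  (forall y, U y -> (s y)^T = - s y) ->
  (forall y, U y -> X y *m s y = 0) -> (forall y, U y -> Y y *m s y = 0) -> U x ->
  d2_at s x (X x) (Y x) w = - (lie_bracket X Y x *m s x *m w^T).
Proof.
move=> oU ss sX sY sk X0 Y0 Ux.
have EX u : X x *m 'D_u s x = - ('D_u X x *m s x).
  apply/eqP; rewrite -addr_eq0 addrC -(derive_mxM u oU sX ss Ux).
  by rewrite (derive_const u oU Ux X0).
have EY u : Y x *m 'D_u s x = - ('D_u Y x *m s x).
  apply/eqP; rewrite -addr_eq0 addrC -(derive_mxM u oU sY ss Ux).
  by rewrite (derive_const u oU Ux Y0).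
have skD u : ('D_u s x)^T = - 'D_u s x.
  rewrite -(derive_mxT u oU ss Ux) (derive_eq_on u oU Ux sk).
  rewrite (eq_derive (g := fun y => (fun=> -1) y *: s y)); last by move=> y; rewrite scaleN1r.
  rewrite (derive_mxZ u oU (smooth_cst U (-1)) ss Ux) derive_cst scale0r add0r.
  by rewrite scaleN1r.
have tr1 (A : 'M[R]_1) : A^T = A by apply: scal_mxP; rewrite mxE.
have E2 : w *m 'D_(Y x) s x *m (X x)^T = 'D_(Y x) X x *m s x *m w^T.
  rewrite -[LHS]tr1 !trmx_mul trmxK skD mulmxA mulmxN EX opprK.
  by [].
have E3 : X x *m 'D_w s x *m (Y x)^T = 0.
  rewrite EX mulNmx -mulmxA -[s x *m _]trmxK trmx_mul trmxK (sk x Ux) mulmxN Y0 //.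
  by rewrite oppr0 trmx0 mulmx0 oppr0.
rewrite /d2_at.
apply: etrans (congr2 +%R (congr2 +%R (congr1 (fun A => A *m w^T) (EY (X x))) E2) E3) _.
rewrite addr0 /lie_bracket; move: ('D_(X x) Y x) ('D_(Y x) X x) => p q.
by rewrite mulmxBl mulmxBl opprB mulNmx addrC.
Qed.

End ExteriorDerivative.

(** Serves the pull-back of a closed 2-form. The vectors [p], [q], [t] are second derivatives of the
    map; each occurs once on the left and once on the right of [S], and the two occurrences cancel
    because [S] is skew. *)
Lemma cyclic_skew_sum {R : comPzRingType} {m : nat} (S : 'M[R]_m) (U V W p q t : 'rV[R]_m)
    (A B C : 'M[R]_1) : S^T = - S -> A + B + C = 0 ->
  (p *m S *m W^T + A + V *m S *m q^T) + (t *m S *m U^T + B + W *m S *m p^T)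
   + (q *m S *m V^T + C + U *m S *m t^T) = 0.
Proof.
move=> sk H.
have K (a b : 'rV[R]_m) : a *m S *m b^T = - (b *m S *m a^T).
  rewrite -[LHS]trmxK [(_ *m _)^T](_ : _ = - (b *m S *m a^T)).
    by apply/matrixP => i j; rewrite !ord1 !mxE.
  by rewrite !trmx_mul trmxK sk mulNmx mulmxN mulmxA.
rewrite (K V) (K W p) (K U) -[RHS]H.
move: (p *m _ *m _) (q *m _ *m _) (t *m _ *m _) => a b c.
by apply/matrixP => i j; rewrite !mxE; ring.
Qed.

(** * Pull-back of 1-forms and 2-forms *)

Section Pullback.
Context {R : realType} {m : nat}.
Implicit Types (x u v w : 'rV[R]_m) (U W : set 'rV[R]_m) (g : 'rV[R]_m -> 'rV[R]_m).
Implicit Types (a : 'rV[R]_m -> 'cV[R]_m) (s : 'rV[R]_m -> 'M[R]_m).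

Definition pull1 {b : nat} g (a : 'rV[R]_m -> 'M[R]_(m, b)) y := jacobian g y *m a (g y).
Definition pull2 g s y := jacobian g y *m s (g y) *m (jacobian g y)^T.

Lemma smooth_pull1 {b : nat} U W g (a : 'rV[R]_m -> 'M[R]_(m, b)) : open U ->
  (forall x, U x -> W (g x)) -> smooth_mx U g -> smooth_mx W a -> smooth_mx U (pull1 g a).
Proof.
move=> oU gW sg sa; apply: smooth_mxM => //; first exact: smooth_jacobian.
exact: smooth_mx_comp gW sg sa.
Qed.

Lemma smooth_pull2 U W g s : open U ->
  (forall x, U x -> W (g x)) -> smooth_mx U g -> smooth_mx W s -> smooth_mx U (pull2 g s).
Proof.
move=> oU gW sg ss; have sJ := smooth_jacobian oU sg.
apply: smooth_mxM => //; last exact: smooth_mxT.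
apply: smooth_mxM => //; exact: smooth_mx_comp gW sg ss.
Qed.

(** The only terms besides the pull-back of da contain second derivatives of [g], and these are
    symmetric in the two arguments. *)
Lemma ext_d1_pull U W g a x : open U ->
  (forall x, U x -> W (g x)) -> smooth_mx U g -> smooth_mx W a -> U x ->
  ext_d1 (pull1 g a) x = pull2 g (ext_d1 a) x.
Proof.
move=> oU gW sg sa Ux; apply: mx_bilinP => v w.
have sJ := smooth_jacobian oU sg; have sag := smooth_mx_comp oU gW sg sa.
have -> : v *m pull2 g (ext_d1 a) x *m w^T =
    (v *m jacobian g x) *m ext_d1 a (g x) *m (w *m jacobian g x)^T.
  by rewrite /pull2 trmx_mul !mulmxA.
rewrite (ext_d1_bilin _ _ sa (gW _ Ux)).
rewrite (ext_d1_bilin v w (smooth_pull1 oU gW sg sa) Ux).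
have E u : 'D_u (pull1 g a) x =
    'D_u (jacobian g) x *m a (g x) + jacobian g x *m 'D_(u *m jacobian g x) a (g x).
  by rewrite (derive_mxM u oU sJ sag Ux) (derive_mx_comp u oU gW sg sa Ux).
rewrite E E !mulmxDr !mulmxA (derive_jacobian_sym v w oU sg Ux).
by rewrite opprD addrACA subrr add0r.
Qed.

Lemma pull2_skew g s x : (s (g x))^T = - s (g x) -> (pull2 g s x)^T = - pull2 g s x.
Proof. by move=> E; rewrite /pull2 !trmx_mul trmxK E mulNmx mulmxN mulmxA. Qed.

Lemma closed_2form_pull U W g s : open U -> open W ->
  (forall x, U x -> W (g x)) -> smooth_mx U g -> smooth_mx W s ->
  (forall y, W y -> (s y)^T = - s y) ->
  closed_2form W s -> closed_2form U (pull2 g s).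
Proof.
move=> oU oW gW sg ss sk /(closed_2formP ss) cs.
apply/(closed_2formP (smooth_pull2 oU gW sg ss)) => x Ux u v w.
have sJ := smooth_jacobian oU sg; have ssg := smooth_mx_comp oU gW sg ss.
set J := jacobian g x; set S := s (g x).
have E p q t (c d : 'rV[R]_m) : q *m 'D_p (jacobian g) x = c -> t *m 'D_p (jacobian g) x = d ->
    q *m 'D_p (pull2 g s) x *m t^T =
    c *m S *m (t *m J)^T + (q *m J) *m 'D_(p *m J) s (g x) *m (t *m J)^T +
    (q *m J) *m S *m d^T.
  move=> <- <-.
  rewrite (derive_mxM p oU (smooth_mxM oU sJ ssg) (smooth_mxT oU sJ) Ux).
  rewrite (derive_mxM p oU sJ ssg Ux) (derive_mxT p oU sJ Ux).
  rewrite (derive_mx_comp p oU gW sg ss Ux) -/J -/S !trmx_mul.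
  move: ('D_p _ x) ('D_(p *m J) s (g x)) => A B.
  by rewrite mulmxDl !mulmxDr !mulmxDl !mulmxA.
(* Symmetry of the second derivative of [g] reduces its six occurrences to three vectors, placed as
   [cyclic_skew_sum] requires. *)
apply: etrans (congr2 +%R (congr2 +%R
  (E u v w _ _ erefl erefl) (E v w u _ _ erefl (derive_jacobian_sym v u oU sg Ux)))
  (E w u v _ _ (derive_jacobian_sym w u oU sg Ux) (derive_jacobian_sym w v oU sg Ux))) _.
apply: cyclic_skew_sum; [exact: sk (gW _ Ux)|exact: (cs _ (gW _ Ux) (u *m J) (v *m J) (w *m J))].
Qed.

End Pullback.

(** * Antiderivatives and the Poincare lemma *)

Section UnitIntegral.
Context {R : realType}.
Implicit Types (f g F : R -> R).

(** Continuity is two-sided even at the end points. The integrands below come from functions on an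
    open cube and so provide it. *)
Definition continuous01 f := forall s : R, 0 <= s <= 1 -> {for s, continuous f}.

Definition int01 f : R := \int[lebesgue_measure]_(s in `[0, 1]) f s.

Lemma continuous01_within f : continuous01 f -> {within `[0, 1], continuous f}.
Proof.
move=> cf; apply: continuous_in_subspaceT => s; rewrite inE /= in_itv /= => sI.
exact: cf.
Qed.

Lemma continuous01_integrable f : continuous01 f ->
  lebesgue_measure.-integrable `[0, 1] (EFin \o f).
Proof.
move=> cf; apply: continuous_compact_integrable; first exact: segment_compact.
exact: continuous01_within.
Qed.

Lemma continuous01D f g : continuous01 f -> continuous01 g ->
  continuous01 (fun s => f s + g s).
Proof. by move=> cf cg s sI; apply: continuousD; [exact: cf|exact: cg]. Qed.

Lemma continuous01M f g : continuous01 f -> continuous01 g ->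
  continuous01 (fun s => f s * g s).
Proof. by move=> cf cg s sI; apply: continuousM; [exact: cf|exact: cg]. Qed.

Lemma continuous01_cst (k : R) : continuous01 (fun=> k).
Proof. by move=> s _; exact: cst_continuous. Qed.

Lemma continuous01_sum n (F : 'I_n -> R -> R) : (forall i, continuous01 (F i)) ->
  continuous01 (fun s => \sum_(i < n) F i s).
Proof.
elim: n F => [|n IH] F cF.
  have -> : (fun s => \sum_(i < 0) F i s) = fun=> 0 by apply/funext => s; rewrite big_ord0.
  exact: continuous01_cst.
have -> : (fun s => \sum_(i < n.+1) F i s) =
    fun s => F ord0 s + \sum_(i < n) F (lift ord0 i) s.
  by apply/funext => s; rewrite big_ord_recl.
by apply: continuous01D => //; apply: IH.
Qed.

Lemma int01D f g : continuous01 f -> continuous01 g ->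
  int01 (fun s => f s + g s) = int01 f + int01 g.
Proof. by move=> cf cg; rewrite /int01 RintegralD //; exact: continuous01_integrable. Qed.

Lemma int01Z f (k : R) : continuous01 f -> int01 (fun s => k * f s) = k * int01 f.
Proof. by move=> cf; rewrite /int01 RintegralZl //; exact: continuous01_integrable. Qed.

Lemma int01_eq f g : (forall s, 0 <= s <= 1 -> f s = g s) -> int01 f = int01 g.
Proof. by move=> fg; apply: eq_Rintegral => s; rewrite inE /= in_itv /= => /fg. Qed.

Lemma int01_0 : int01 (fun=> 0) = 0.
Proof. by rewrite /int01 Rintegral_cst // mul0r. Qed.

Lemma int01_sum n (F : 'I_n -> R -> R) : (forall i, continuous01 (F i)) ->
  int01 (fun s => \sum_(i < n) F i s) = \sum_(i < n) int01 (F i).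
Proof.
elim: n F => [|n IH] F cF.
  by rewrite big_ord0 -[RHS]int01_0; apply: int01_eq => s _; rewrite big_ord0.
rewrite big_ord_recl -IH // -int01D //; last exact: continuous01_sum.
by apply: int01_eq => s _; rewrite big_ord_recl.
Qed.

Lemma int01_bound f (k : R) : continuous01 f ->
  (forall s, 0 <= s <= 1 -> `|f s| <= k) -> `|int01 f| <= k.
Proof.
move=> cf fk; have fi := continuous01_integrable cf.
apply: le_trans (le_normr_Rintegral _ fi) _ => //.
have -> : k = \int[lebesgue_measure]_(s in `[0, 1]%classic) k.
  rewrite Rintegral_cst //= lebesgue_measure_itv /= lte_fin ltr01 -EFinB subr0 /=.
  by rewrite mulr1.
apply: le_Rintegral => //.
  apply: continuous01_integrable => s sI.
  exact: (continuous_comp (cf s sI) (@norm_continuous _ R^o (f s))).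
apply: continuous01_integrable; exact: continuous01_cst.
Qed.

Lemma int01_FTC f F : continuous01 f ->
  (forall s : R, 0 <= s <= 1 -> is_derive s 1 F (f s)) -> int01 f = F 1 - F 0.
Proof.
move=> cf dF.
have cF s : 0 <= s <= 1 -> {for s, continuous F}.
  by move=> sI; apply/differentiable_continuous/derivable1_diffP; have [] := dF s sI.
have I0 : 0 <= (0 : R) <= 1 by rewrite lexx ler01.
have I1 : 0 <= (1 : R) <= 1 by rewrite lexx ler01.
rewrite /int01 /Rintegral (@continuous_FTC2 _ f F 0 1) //.
- exact: continuous01_within.
- split.
  + move=> s; rewrite in_itv /= => /andP[s0 s1].
    by have [] : is_derive s 1 F (f s) by apply: dF; rewrite !ltW.
  + apply: cvg_at_right_filter; exact: cF.
  + apply: cvg_at_left_filter; exact: cF.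
- move=> s; rewrite in_itv /= => /andP[s0 s1]; rewrite derive1E.
  by have [] : is_derive s 1 F (f s) by apply: dF; rewrite !ltW.
Qed.

End UnitIntegral.

(** * Mean value and Taylor estimates on closed balls *)

Section LocalBounds.
Context {R : realType} {m : nat}.
Implicit Types (f g : 'rV[R]_m -> R) (c x y z : 'rV[R]_m) (U : set 'rV[R]_m).

Lemma bounded_on_cball f c (r : R) :
  (forall y, `|y - c| <= r -> {for y, continuous f}) ->
  exists2 k : R, 0 <= k & forall y, `|y - c| <= r -> `|f y| <= k.
Proof.
move=> cf; have [r0|r0] := ltP r 0.
  by exists 0 => // y /le_lt_trans/(_ r0); rewrite normr_lt0.
pose A := [set y : 'rV[R]_m | `|y - c| <= r].
have cA : compact A.
  apply: bounded_closed_compact.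
    exists (`|c| + r); split; first by rewrite num_real.
    move=> k kr y /= yA; apply: le_trans (ltW kr).
    rewrite -[y](subrK c) addrC; apply: le_trans (ler_normD _ _) _.
    by rewrite lerD2l.
  have -> : A = (fun y => `|y - c|) @^-1` [set t | t <= r] by [].
  apply: closed_comp; last exact: closed_le.
  move=> y _; apply: continuous_comp; last exact: norm_continuous.
  by apply: continuousB; [exact: cvg_id|exact: cst_continuous].
have cAf : {within A, continuous (fun y => `|f y|)}.
  apply: continuous_in_subspaceT => y; rewrite inE => /cf fy.
  exact: (continuous_comp fy (@norm_continuous _ R^o (f y))).
have A0 : A !=set0 by exists c; rewrite /A /= subrr normr0.
have [z _ zmax] := EVT_max_rV A0 cA cAf.
by exists `|f z| => // y yA; apply: zmax; rewrite inE.
Qed.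

Lemma cball_convex c (r : R) y k (t : R) : 0 <= t <= 1 ->
  `|y - c| <= r -> `|k + y - c| <= r -> `|t *: k + y - c| <= r.
Proof.
move=> /andP[t0 t1] yr kr.
have -> : t *: k + y - c = t *: (k + y - c) + (1 - t) *: (y - c).
  by apply/rowP => j; rewrite !mxE; ring.
apply: le_trans (ler_normD _ _) _; rewrite !normrZ (ger0_norm t0).
rewrite ger0_norm ?subr_ge0 //.
have -> : r = t * r + (1 - t) * r by ring.
by apply: lerD; apply: ler_wpM2l => //; rewrite subr_ge0.
Qed.

Lemma mvt_cball f c (r : R) y k :
  (forall z, `|z - c| <= r -> differentiable f z) ->
  `|y - c| <= r -> `|k + y - c| <= r ->
  exists2 t, 0 <= t <= 1 & f (k + y) - f y = \sum_j k 0 j * pder j f (t *: k + y).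
Proof.
move=> df yr kr.
have [||t] := @MVT_segment R (fun s : R => f (s *: k + y))
  (fun s => 'D_k f (s *: k + y)) 0 1 ler01.
- move=> t /subset_itv_oo_cc; rewrite /= in_itv /= => tI; apply: is_derive_line.
  by apply/diff_derivable/df; exact: cball_convex.
- apply: derivable_within_continuous => s; rewrite in_itv /= => sI.
  have D : derivable f (s *: k + y) k by apply/diff_derivable/df; exact: cball_convex.
  by have [] := is_derive_line D.
- rewrite in_itv /= => tI; rewrite scale1r scale0r add0r subr0 mulr1 => E.
  by exists t => //; rewrite E derive_pder //; apply: df; exact: cball_convex.
Qed.

Lemma lipschitz_cball f c (r : R) :
  (forall z, `|z - c| <= r -> differentiable f z) ->
  (forall j z, `|z - c| <= r -> {for z, continuous (pder j f)}) ->
  exists2 L : R, 0 <= L & forall y k, `|y - c| <= r -> `|k + y - c| <= r ->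
    `|f (k + y) - f y| <= L * `|k|.
Proof.
move=> df cf.
have /choice[M HM] j : exists M : R, 0 <= M /\ forall y, `|y - c| <= r -> `|pder j f y| <= M.
  by have [M M0 HM] := bounded_on_cball (cf j); exists M.
exists (\sum_j M j); first by apply: sumr_ge0 => j _; exact: (HM j).1.
move=> y k yr kr; have [t tI ->] := mvt_cball df yr kr.
apply: le_trans (ler_norm_sum _ _ _) _; rewrite mulr_suml; apply: ler_sum => j _.
rewrite normrM mulrC; apply: ler_pM => //; last exact: mx_norm_entry.
by apply: (HM j).2; exact: cball_convex.
Qed.

(** The mean value theorem leaves the increment of each partial derivative, which is Lipschitz
    because the second derivatives are bounded on the compact ball. What matters is that [L] is
    uniform in the base point: the estimate will be integrated along a segment. *)
Lemma taylor_cball U f c (r : R) : smooth U f -> (forall z, `|z - c| <= r -> U z) ->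
  exists2 L : R, 0 <= L & forall y k, `|y - c| <= r -> `|k + y - c| <= r ->
    `|f (k + y) - f y - \sum_j k 0 j * pder j f y| <= L * (`|k| * `|k|).
Proof.
move=> sf rU.
have df z : `|z - c| <= r -> differentiable f z by move=> /rU; exact: smooth_diff.
have /choice[L HL] j : exists L : R, 0 <= L /\ forall y k, `|y - c| <= r ->
    `|k + y - c| <= r -> `|pder j f (k + y) - pder j f y| <= L * `|k|.
  have [L L0 HL] : exists2 L : R, 0 <= L & forall y k, `|y - c| <= r ->
    `|k + y - c| <= r -> `|pder j f (k + y) - pder j f y| <= L * `|k|.
    apply: lipschitz_cball => [z /rU|l z /rU]; first exact: (smooth_diff (smooth_pder j sf)).
    exact: (smooth_continuous (smooth_pder l (smooth_pder j sf))).
  by exists L.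
exists (\sum_j L j); first by apply: sumr_ge0 => j _; exact: (HL j).1.
move=> y k yr kr; have [t tI ->] := mvt_cball df yr kr.
rewrite -sumrB; apply: le_trans (ler_norm_sum _ _ _) _; rewrite mulr_suml; apply: ler_sum => j _.
rewrite -mulrBr normrM mulrCA; apply: ler_pM => //; first exact: mx_norm_entry.
apply: le_trans ((HL j).2 _ _ yr _) _; first exact: cball_convex.
apply: ler_wpM2l; first exact: (HL j).1.
case/andP: tI => t0 t1; rewrite normrZ ger0_norm //.
by rewrite ler_piMl.
Qed.

End LocalBounds.

(** * Antiderivatives in one coordinate *)

Definition cube {R : realType} {m : nat} (c : 'rV[R]_m) (r : R) : set 'rV[R]_m :=
  [set x | `|x - c| < r].

(* Multiplies the [i]-th coordinate of [x - c] by [s]. *)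
Definition slide {R : realType} {m : nat} (i : 'I_m) (c : 'rV[R]_m) (s : R) (x : 'rV[R]_m)
    : 'rV[R]_m :=
  s *: ((x 0 i - c 0 i) *: delta_mx 0 i) + (x - (x 0 i - c 0 i) *: delta_mx 0 i).

Section CoordinateAntiderivative.
Context {R : realType} {m : nat}.
Context (c : 'rV[R]_m) (i : 'I_m).
Implicit Types (f g : 'rV[R]_m -> R) (x y z : 'rV[R]_m) (U : set 'rV[R]_m) (s : R).

Lemma slide0E s x j : slide i 0 s x 0 j = s ^+ (j == i) * x 0 j.
Proof. by rewrite !mxE eqxx /=; case: eqVneq => [->|_]; rewrite /= ?expr1 ?expr0; ring. Qed.

Lemma slideD s h x : slide i c s (h + x) = slide i 0 s h + slide i c s x.
Proof. by apply/rowP => j; rewrite !mxE; ring. Qed.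

Lemma slide1 x : slide i c 1 x = x.
Proof. by rewrite /slide scale1r addrC subrK. Qed.

Lemma slide0_norm s x : 0 <= s <= 1 -> `|slide i 0 s x| <= `|x|.
Proof.
move=> /andP[s0 s1]; apply: mx_norm_leP => // p j; rewrite (ord1 p) slide0E normrM.
apply: le_trans (mx_norm_entry x 0 j); rewrite ler_piMl // normrX ger0_norm //.
by case: (j == i); rewrite ?expr0 ?expr1.
Qed.

Lemma slide_dist s x : 0 <= s <= 1 -> `|slide i c s x - c| <= `|x - c|.
Proof.
move=> sI; have -> : slide i c s x - c = slide i 0 s (x - c).
  by apply/rowP => j; rewrite !mxE; ring.
exact: slide0_norm.
Qed.

Context (r : R).
Let B := cube c r.

Lemma open_cube : open B.
Proof.
have -> : B = ball c r.
  by apply/funext => y; rewrite -ball_normE /= distrC.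
exact: ball_open.
Qed.

(** The weight s^w makes the family stable under differentiation: a derivative in the direction [i]
    under the integral sign brings out one factor s, the other directions none. *)
Definition slide_int w g x := int01 (fun s => s ^+ w * g (slide i c s x)).

Lemma slide_continuous01 w g x : smooth B g -> B x ->
  continuous01 (fun s => s ^+ w * g (slide i c s x)).
Proof.
move=> sg Bx; apply: continuous01M => s sI; first exact: exprn_continuous.
apply/differentiable_continuous/derivable1_diffP.
set v := (x 0 i - c 0 i) *: (delta_mx 0 i : 'rV[R]_m).
have D : derivable g (s *: v + (x - v)) v.
  apply/diff_derivable/(smooth_diff sg); rewrite /B /cube /=.
  exact: le_lt_trans (slide_dist x sI) Bx.
by have [] := is_derive_line D.
Qed.

(** Differentiation under the integral sign. The error of the linear approximation is the integral
    of the Taylor remainders of [g] along the slide, all bounded by the same multiple of |h|^2. *)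
Lemma slide_int_pder w g x : smooth B g -> B x ->
  differentiable (slide_int w g) x /\
  forall j, pder j (slide_int w g) x = slide_int (w + (j == i)) (pder j g) x.
Proof.
move=> sg Bx.
suff [d E] : differentiable (slide_int w g) x /\ forall j, pder j (slide_int w g) x =
   (\col_j slide_int (w + (j == i)) (pder j g) x) j 0.
  by split=> // j; rewrite E mxE.
apply: pder_approx => e e0.
(* An intermediate radius: the closed ball of radius [r'] lies in the open cube and still contains a
   neighbourhood of [x]. *)
pose r' := (`|x - c| + r) / 2.
have xr' : `|x - c| < r' by rewrite /r' ltr_pdivlMr // mulr2n mulrDr mulr1 ltrD2l.
have r'r : r' < r by rewrite /r' ltr_pdivrMr // mulr2n mulrDr mulr1 ltrD2r.
have [|L L0 HL] := @taylor_cball _ _ B g c r' sg.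
  by move=> z zr; rewrite /B /cube /=; exact: le_lt_trans r'r.
(* The first bound keeps h + x in the closed ball, the second turns L |h|^2 into at most e |h|. The
   denominator L + 1 is positive even when [L] is 0. *)
have d0 : 0 < Num.min (r' - `|x - c|) (e / (L + 1)).
  by rewrite lt_min subr_gt0 xr' divr_gt0 // ltr_wpDl.
apply/near_dist; exists (Num.min (r' - `|x - c|) (e / (L + 1))) => // h.
rewrite subr0 lt_min => /andP[hr he].
have hxr : `|h + x - c| <= r'.
  rewrite -addrA; apply: le_trans (ler_normD _ _) _.
  by rewrite -lerBrDr ltW.
have Bhx : B (h + x) by rewrite /B /cube /=; exact: le_lt_trans r'r.
pose T s := s ^+ w * (g (slide i c s (h + x)) - g (slide i c s x)
   - \sum_j slide i 0 s h 0 j * pder j g (slide i c s x)).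
have Tb s : 0 <= s <= 1 -> `|T s| <= e * `|h|.
  move=> sI; rewrite /T normrM slideD.
  have sw : `|s ^+ w| <= 1.
    case/andP: sI => s0 s1; rewrite ger0_norm ?exprn_ge0 //.
    by rewrite exprn_ile1.
  apply: le_trans (_ : _ <= 1 * (L * (`|slide i 0 s h| * `|slide i 0 s h|))) _.
    apply: ler_pM => //; apply: HL.
      exact: le_trans (slide_dist x sI) (ltW xr').
    by rewrite -slideD; exact: le_trans (slide_dist _ sI) hxr.
  rewrite mul1r; have hh := slide0_norm h sI.
  apply: le_trans (_ : _ <= L * (`|h| * `|h|)) _.
    by apply: ler_wpM2l => //; exact: ler_pM.
  rewrite mulrA ler_wpM2r //; move: he; rewrite ltr_pdivlMr ?ltr_wpDl // => /ltW.
  by apply: le_trans; rewrite mulrC ler_wpM2l // lerDl.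
have E : slide_int w g (h + x) - slide_int w g x -
    (h *m (\col_j slide_int (w + (j == i)) (pder j g) x)) 0 0 = int01 T.
  have cT j : continuous01 (fun s => s ^+ (w + (j == i)) * pder j g (slide i c s x)).
    exact: (slide_continuous01 (smooth_pder j sg) Bx).
  have c1 := slide_continuous01 (w := w) sg Bhx; have c2 := slide_continuous01 (w := w) sg Bx.
  have c3 : continuous01 (fun s => -1 * (s ^+ w * g (slide i c s x))).
    by apply: continuous01M => //; exact: continuous01_cst.
  have c4 j : continuous01 (fun s => - h 0 j * (s ^+ (w + (j == i)) * pder j g (slide i c s x))).
    by apply: continuous01M => //; exact: continuous01_cst.
  transitivity (int01 (fun s => (s ^+ w * g (slide i c s (h + x)) + -1 * (s ^+ w * g (slide i c s x)))
      + \sum_j (- h 0 j * (s ^+ (w + (j == i)) * pder j g (slide i c s x))))).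
    rewrite int01D; [|exact: continuous01D|exact: continuous01_sum].
    rewrite int01D // int01Z // int01_sum // mulN1r; congr (_ + _).
    rewrite mxE -sumrN; apply: eq_bigr => j _; rewrite int01Z // mxE.
    by rewrite mulNr.
  apply: int01_eq => s _; rewrite /T !mulrBr mulN1r; congr (_ + _).
  rewrite mulr_sumr -sumrN; apply: eq_bigr => j _.
  by rewrite slide0E exprD; ring.
rewrite E; apply: int01_bound => //; apply: continuous01M.
  by move=> s _; exact: exprn_continuous.
have c0 y : B y -> continuous01 (fun s => g (slide i c s y)).
  move=> By; have := slide_continuous01 (w := 0) sg By.
  by congr continuous01; apply/funext => s; rewrite expr0 mul1r.
apply: (@continuous01D _ _ (fun s => - _)).
  apply: (@continuous01D _ _ (fun s => - _)); first exact: c0.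
  by move=> s sI; apply: continuousN; exact: c0.
move=> s sI; apply: continuousN.
have K : continuous01 (fun s => \sum_j (h 0 j * (s ^+ (j == i) * pder j g (slide i c s x)))).
  apply: continuous01_sum => j; apply: continuous01M; first exact: continuous01_cst.
  exact: (slide_continuous01 (smooth_pder j sg) Bx).
have := K s sI; congr (continuous_at _ _); apply/funext => t.
by apply: eq_bigr => j _; rewrite slide0E; ring.
Qed.

Lemma slide_int_smooth w g : smooth B g -> smooth B (slide_int w g).
Proof.
move=> sg k; elim: k w g sg => // k IH w g sg; split=> [x Bx|j].
  exact: (slide_int_pder w sg Bx).1.
apply: (diff_times_eq open_cube _ (IH (w + (j == i))%N _ (smooth_pder j sg))) => x Bx.
by rewrite (slide_int_pder w sg Bx).2.
Qed.

(** The combined integrand is the derivative of s * g (slide i c s x) in s, and this function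
    vanishes at s = 0 and equals g x at s = 1. *)
Lemma slide_int_FTC g x : smooth B g -> B x ->
  slide_int 0 g x + (x 0 i - c 0 i) * slide_int 1 (pder i g) x = g x.
Proof.
move=> sg Bx; have c0 := slide_continuous01 (w := 0) sg Bx.
have c1 := slide_continuous01 (w := 1) (smooth_pder i sg) Bx.
rewrite /slide_int -int01Z // -int01D //; last first.
  by apply: continuous01M => //; exact: continuous01_cst.
apply: etrans (int01_FTC (F := fun s => s * g (slide i c s x)) _ _) _; last first.
- by rewrite mul1r mul0r subr0 slide1.
- move=> s sI; set v := (x 0 i - c 0 i) *: (delta_mx 0 i : 'rV[R]_m).
  have Dg : differentiable g (s *: v + (x - v)).
    apply/(smooth_diff sg); rewrite /B /cube /=.
    exact: le_lt_trans (slide_dist x sI) Bx.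
  have [d1 d2] := is_derive_line (@diff_derivable _ _ _ _ _ v Dg).
  have -> : s ^+ 0 * g (slide i c s x) + (x 0 i - c 0 i) * (s ^+ 1 * pder i g (slide i c s x)) =
      s * 'D_1 (fun t : R => g (t *: v + (x - v))) s + g (s *: v + (x - v)) * 1.
    rewrite d2 derive_pder // (bigD1 i) //= big1 => [|j ji]; last first.
      by rewrite !mxE eqxx (negPf ji) /= mulr0 mul0r.
    by rewrite !mxE !eqxx /= expr0 expr1 addr0 -/(slide i c s x); ring.
  by apply: is_deriveM; split.
- by apply: continuous01D => //; apply: continuous01M => //; exact: continuous01_cst.
Qed.

(** [G] is the integral of [g] in the i-th coordinate from c_i to x_i, rescaled to the unit
    interval. Derivatives in the other directions pass under the integral sign, so [G] inherits from
    [g] its independence of another coordinate; the inductions on coordinates rest on this. *)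
Lemma coord_antiderivative g : smooth B g -> exists G : 'rV[R]_m -> R,
  [/\ smooth B G, (forall x, B x -> pder i G x = g x) &
      forall j, j != i -> (forall x, B x -> pder j g x = 0) ->
        forall x, B x -> pder j G x = 0].
Proof.
move=> sg; have oB := open_cube.
have sI := slide_int_smooth 0 sg.
have sc : smooth B (fun x => x 0 i - c 0 i).
  by apply: smoothB => //; [exact: smooth_coord|exact: smooth_cst].
have dc x j : B x -> pder j (fun x => x 0 i - c 0 i) x = (j == i)%:R.
  move=> Bx; rewrite /pder deriveD_fun; [|exact: differentiable_coord|exact: differentiable_cst].
  by rewrite derive_cst addr0 derive_coord mxE eqxx /= eq_sym.
have dG x j : B x -> pder j (fun x => (x 0 i - c 0 i) * slide_int 0 g x) x =
   (j == i)%:R * slide_int 0 g x + (x 0 i - c 0 i) * slide_int (j == i) (pder j g) x.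
  move=> Bx; rewrite {1}/pder deriveM_fun; [|exact: smooth_diff Bx|exact: smooth_diff Bx].
  have e1 : 'D_(delta_mx 0 j) (fun y : 'rV[R]_m => y 0 i - c 0 i) x = (j == i)%:R := dc x j Bx.
  have e2 : 'D_(delta_mx 0 j) (slide_int 0 g) x = slide_int (j == i) (pder j g) x :=
    (slide_int_pder 0 sg Bx).2 j.
  by rewrite e1 e2.
exists (fun x => (x 0 i - c 0 i) * slide_int 0 g x); split.
- exact: smoothM.
- by move=> x Bx; rewrite dG // eqxx mul1r slide_int_FTC.
- move=> j ji gj x Bx; rewrite dG // (negPf ji) mul0r add0r.
  rewrite [slide_int _ _ _](_ : _ = 0) ?mulr0 // -[RHS]int01_0; apply: int01_eq => s sI'.
  by rewrite gj ?mulr0 //; exact: le_lt_trans (slide_dist x sI') Bx.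
Qed.

End CoordinateAntiderivative.

(** * The Poincare lemma for 1-forms and, relative to a fibration, for 2-forms *)

Section Poincare.
Context {R : realType} {m : nat}.
Implicit Types (f g : 'rV[R]_m -> R) (x y c : 'rV[R]_m) (U : set 'rV[R]_m) (r : R).

Lemma pderB_fun U f g i x : open U -> smooth U f -> smooth U g -> U x ->
  pder i (fun y => f y - g y) x = pder i f x - pder i g x.
Proof.
move=> oU sf sg Ux; rewrite /pder deriveB //; apply: diff_derivable; exact: smooth_diff Ux.
Qed.

Lemma pder_zero U f i x : open U -> (forall y, U y -> f y = 0) -> U x -> pder i f x = 0.
Proof.
move=> oU f0 Ux; rewrite (pder_eq_on (g := fun=> 0) i oU Ux f0); exact: derive_cst.
Qed.

Lemma mvt_cube f c r x y : smooth (cube c r) f -> cube c r x -> cube c r y ->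
  exists2 z, cube c r z & f y - f x = \sum_j (y - x) 0 j * pder j f z.
Proof.
move=> sf cx cy; pose r' := Num.max `|x - c| `|y - c|.
have r'r : r' < r by rewrite gt_max cx cy.
have r'c z : `|z - c| <= r' -> cube c r z by move=> zr; exact: le_lt_trans r'r.
have xr : `|x - c| <= r' by rewrite le_max lexx.
have yr : `|y - x + x - c| <= r' by rewrite subrK le_max lexx orbT.
have [|t tI] := @mvt_cball _ _ f c r' x (y - x) _ xr yr.
  by move=> z /r'c; exact: smooth_diff.
rewrite subrK => E; exists (t *: (y - x) + x) => //.
by apply: r'c; exact: cball_convex.
Qed.

Lemma cube_constant f c r x y : smooth (cube c r) f -> cube c r x -> cube c r y ->
  (forall j, (y - x) 0 j != 0 -> forall z, cube c r z -> pder j f z = 0) -> f y = f x.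
Proof.
move=> sf cx cy H; apply/eqP; rewrite -subr_eq0.
have [z cz ->] := mvt_cube sf cx cy; apply/eqP; apply: big1 => j _.
have [->|j0] := eqVneq ((y - x) 0 j) 0; first by rewrite mul0r.
by rewrite (H j j0 z cz) mulr0.
Qed.

(** Induction on the number [s] of coordinates in which the derivative of [f] is already right. The
    defect a_s - d_s f is integrated in the s-th coordinate. Closedness says that it does not depend
    on the earlier coordinates, so its antiderivative does not disturb them. *)
Lemma poincare1 (a : 'rV[R]_m -> 'cV[R]_m) c r : smooth_mx (cube c r) a ->
  (forall x, cube c r x -> ext_d1 a x = 0) ->
  exists2 f, smooth (cube c r) f & forall x, cube c r x -> ext_d0 f x = a x.
Proof.
move=> sa da; set B := cube c r; have oB : open B by exact: open_cube.
suff [f [sf df]] : exists f, smooth B f /\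
    forall j : 'I_m, (j < m)%N -> forall x, B x -> pder j f x = a x j 0.
  by exists f => // x Bx; apply/colP => j; rewrite mxE df.
suff main s : (s <= m)%N -> exists f, smooth B f /\
    forall j : 'I_m, (j < s)%N -> forall x, B x -> pder j f x = a x j 0.
  exact: (main m).
elim: s => [|s IH] sm.
  by exists (fun=> 0); split=> //; exact: smooth_cst.
have [f [sf df]] := IH (ltnW sm); pose i := Ordinal sm.
have sai : smooth B (fun x => a x i 0) by exact: sa.
have sg := smoothB oB sai (smooth_pder i sf).
have [G [sG dG zG]] := coord_antiderivative i sg.
exists (fun x => f x + G x); split=> [|j js x Bx]; first exact: smoothD.
rewrite /pder deriveD_fun; [|exact: smooth_diff Bx|exact: smooth_diff Bx].
rewrite -[X in X + _]/(pder j f x) -[X in _ + X]/(pder j G x).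
have [E|ne] := eqVneq j i; first by rewrite E dG // addrC subrK.
have {}js : (j < s)%N.
  rewrite ltn_neqAle -ltnS js andbT; apply: contra ne => /eqP E.
  by apply/eqP/val_inj.
rewrite zG // ?df ?addr0 // => y By.
rewrite (pderB_fun _ oB sai (smooth_pder i sf) By) (pder_comm j i oB sf By).
rewrite (pder_eq_on (g := fun y => a y j 0) i oB By (df j js)).
by have /matrixP/(_ j i) := da y By; rewrite !mxE.
Qed.

Lemma closed_2formB U (s t : 'rV[R]_m -> 'M[R]_m) : open U ->
  smooth_mx U s -> smooth_mx U t -> closed_2form U s -> closed_2form U t ->
  closed_2form U (fun y => s y - t y).
Proof.
move=> oU ss st cs ct x Ux i j l.
have E p q k : pder p (fun y => (s y - t y) q k) x =
    pder p (fun y => s y q k) x - pder p (fun y => t y q k) x.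
  rewrite -(pderB_fun p oU (ss q k) (st q k) Ux).
  by apply: eq_derive => y; rewrite !mxE.
rewrite !E; have := cs x Ux i j l; have := ct x Ux i j l.
move: (pder i _ x) (pder j _ x) (pder l _ x) => p q k.
move: (pder i _ x) (pder j _ x) (pder l _ x) => p' q' k' H H'.
have -> : p' - p + (q' - q) + (k' - k) = (p' + q' + k') - (p + q + k) by ring.
by rewrite H H' subr0.
Qed.

Lemma smooth_mx_col U (b : 'I_m -> 'rV[R]_m -> R) : open U -> (forall j, smooth U (b j)) ->
  smooth_mx U (fun x => \col_j b j x).
Proof. by move=> oU sb i j; apply: (smooth_eq oU _ (sb i)) => y _; rewrite mxE. Qed.

(* Coordinates are eliminated one at a time, starting with the last one. *)
Lemma poincare2 (s : 'rV[R]_m -> 'M[R]_m) c r (z : nat) : smooth_mx (cube c r) s ->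
  (forall x, cube c r x -> (s x)^T = - s x) -> closed_2form (cube c r) s ->
  (forall x, cube c r x -> forall i j : 'I_m, (z <= i)%N -> (z <= j)%N -> s x i j = 0) ->
  exists a : 'rV[R]_m -> 'cV[R]_m, [/\ smooth_mx (cube c r) a,
    (forall x, cube c r x -> forall j : 'I_m, (z <= j)%N -> a x j 0 = 0) &
    forall x, cube c r x -> ext_d1 a x = s x].
Proof.
set B := cube c r; have oB : open B by exact: open_cube.
(* The invariant is that the rows of [s] from [t] on vanish, hence also the columns. The indices
   from [z] on are those of the fibre directions, and the primitive must have no component there. *)
suff main t : (t <= m)%N -> forall s : 'rV[R]_m -> 'M[R]_m, smooth_mx B s ->
  (forall x, B x -> (s x)^T = - s x) -> closed_2form B s ->
  (forall x, B x -> forall i j : 'I_m, (z <= i)%N -> (z <= j)%N -> s x i j = 0) ->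
  (forall x, B x -> forall i j : 'I_m, (t <= i)%N -> s x i j = 0) ->
  exists a : 'rV[R]_m -> 'cV[R]_m, [/\ smooth_mx B a,
    (forall x, B x -> forall j : 'I_m, (z <= j)%N -> a x j 0 = 0) &
    forall x, B x -> ext_d1 a x = s x].
  move=> ss sk cs zs; apply: (main m) => // x Bx i j.
  by rewrite leqNgt ltn_ord.
elim: t => [|t IH] tm {}s ss sk cs zs ts.
  exists (fun=> 0); split=> [|x Bx j _|x Bx]; first exact: smooth_mx_cst.
    by rewrite mxE.
  apply/matrixP => i j; rewrite ts // [LHS]mxE !(pder_zero _ oB _ Bx) ?subr0 //;
  by move=> y _; rewrite mxE.
pose i0 := Ordinal tm.
have sk' x i j : B x -> s x i j = - s x j i.
  by move=> Bx; have /matrixP/(_ j i) := sk x Bx; rewrite !mxE.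
have sl x (l : 'I_m) j : B x -> (t < l)%N -> s x j l = 0.
  by move=> Bx tl; rewrite sk' // ts // oppr0.
(* Subtracting the differential of the form with components [b j] clears row [t]. Taking b j = 0 for
   z <= j keeps the primitive semi-basic and is consistent: when z <= j < t, the entry (t, j) lies
   in the block where [s] vanishes. Independence of the coordinates beyond [t] keeps the later rows
   zero. *)
have /choice[b Hb] (j : 'I_m) : exists b : 'rV[R]_m -> R, [/\ smooth B b,
    ((j < t)%N -> forall x, B x -> pder i0 b x = s x i0 j),
    (forall l : 'I_m, (t < l)%N -> forall x, B x -> pder l b x = 0) &
    ((t <= j)%N || (z <= j)%N -> b = fun=> 0)].
  have [jz|/norP[]] := boolP ((t <= j)%N || (z <= j)%N).
    exists (fun=> 0); split=> // [|jt x Bx|l _ x Bx]; first exact: smooth_cst.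
      rewrite (pder_zero _ oB _ Bx) // zs //.
        by move: jz; rewrite leqNgt jt /= => zj; exact: leq_trans zj (ltnW jt).
      by move: jz; rewrite leqNgt jt.
    exact: (pder_zero _ oB _ Bx).
  rewrite -!ltnNge => jt jz.
  have [G [sG dG zG]] := coord_antiderivative i0 (ss i0 j).
  exists G; split=> // l tl x Bx.
  apply: zG => //; first by rewrite -val_eqE /= gtn_eqF.
  (* In the closedness relation for l, t, j the other two terms involve column or row [l], which is
     already zero. *)
  move=> y By; have := cs y By l i0 j.
  rewrite (pder_zero i0 oB _ By); last by move=> w Bw; exact: sl.
  by rewrite (pder_zero j oB _ By) ?addr0 // => w Bw; rewrite ts.
have sb j : smooth B (b j) by have [] := Hb j.
have scb := smooth_mx_col oB sb; pose cb x := \col_j b j x.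
have dbE x i j : B x -> ext_d1 cb x i j = pder i (b j) x - pder j (b i) x.
  move=> Bx; rewrite mxE; congr (_ - _); apply: (pder_eq_on _ oB Bx) => y _;
  by rewrite mxE.
have b0 (i j : 'I_m) x : (t <= j)%N || (z <= j)%N -> B x -> pder i (b j) x = 0.
  move=> tj Bx; apply: (pder_zero _ oB _ Bx) => y _.
  by have [_ _ _ ->] := Hb j.
have [|||||a [sa za da]] := IH (ltnW tm) (fun x => s x - ext_d1 cb x).
- by apply: smooth_mxB => //; exact: smooth_ext_d1.
- move=> x Bx; rewrite linearB /= (sk x Bx) ext_d1_skew.
  by rewrite opprB opprK addrC.
- by apply: closed_2formB => //; [exact: smooth_ext_d1|exact: ext_d1_closed].
- move=> x Bx i j zi zj; rewrite mxE [X in _ + X]mxE dbE // zs // !b0 ?subrr ?oppr0 ?addr0 //.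
  + by rewrite zi orbT.
  + by rewrite zj orbT.
- move=> x Bx i j ti; rewrite mxE [X in _ + X]mxE dbE // (b0 j i) ?ti // subr0.
  have [E|ne] := eqVneq i i0.
    rewrite E; have [jt|tj] := ltnP j t.
      by have [_ -> // _ _] := Hb j; rewrite subrr.
    rewrite (b0 i0 j) ?tj // subr0; move: tj; rewrite leq_eqVlt => /orP[/eqP tj|tj].
      have -> : j = i0 by exact/val_inj.
      have := sk' x i0 i0 Bx; move: (s x i0 i0) => u /eqP.
      by rewrite -addr_eq0 -mulr2n mulrn_eq0 => /eqP.
    exact: sl.
  have {}ti : (t < i)%N.
    rewrite ltn_neqAle ti andbT; apply: contra ne => /eqP E.
    by apply/eqP/val_inj.
  rewrite ts //; have [_ _ H _] := Hb j; by rewrite H // subr0.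
exists (fun x => 1 *: cb x + a x); split=> [|x Bx j zj|x Bx].
- by apply: smooth_mxD => //; apply: smooth_mxZ => //; exact: smooth_cst.
- rewrite mxE [X in _ + X]za // addr0 mxE [X in _ * X]mxE.
  by have [_ _ _ ->] := Hb j; rewrite ?mulr0 // zj orbT.
- by rewrite (ext_d1_comb 1 oB scb sa Bx) scale1r da // addrC subrK.
Qed.

End Poincare.

(** * Coframes *)

Section Coframes.
Context {R : realType} {k : nat}.
Notation m := (k.+1 + k)%N.
Implicit Types (U : set 'rV[R]_m) (x u v w : 'rV[R]_m) (eps : 'M[R]_k).
Implicit Types (a : 'rV[R]_m -> 'cV[R]_m) (om th : 'rV[R]_m -> 'M[R]_(m, k)).
Implicit Types (r : 'rV[R]_m -> 'rV[R]_m) (N T : 'rV[R]_m -> 'M[R]_(k, m)).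

(* [r], [N], [T] is the frame dual to the coframe [a], [om], [th]; the rows of
   [T] span the common kernel of [a] and [om], and [r] is the Reeb field. *)
Record coframe U eps a om th r N T : Prop := Coframe {
  cf_open : open U;
  cf_sym : eps^T = eps;
  cf_unit : eps \in unitmx;
  cf_sa : smooth_mx U a;
  cf_som : smooth_mx U om;
  cf_sth : smooth_mx U th;
  cf_sr : smooth_mx U r;
  cf_sN : smooth_mx U N;
  cf_sT : smooth_mx U T;
  cf_ra : forall y, U y -> r y *m a y = 1%:M;
  cf_rom : forall y, U y -> r y *m om y = 0;
  cf_rth : forall y, U y -> r y *m th y = 0;
  cf_Na : forall y, U y -> N y *m a y = 0;
  cf_Nom : forall y, U y -> N y *m om y = 1%:M;
  cf_Nth : forall y, U y -> N y *m th y = 0;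
  cf_Ta : forall y, U y -> T y *m a y = 0;
  cf_Tom : forall y, U y -> T y *m om y = 0;
  cf_Tth : forall y, U y -> T y *m th y = 1%:M;
  cf_id : forall y, U y -> a y *m r y + om y *m N y + th y *m T y = 1%:M;
  cf_da : forall y, U y ->
    ext_d1 a y = th y *m eps *m (om y)^T - om y *m eps *m (th y)^T;
  cf_dom : forall y, U y -> forall c u v, u *m om y = 0 -> v *m om y = 0 ->
    u *m ext_d1 (fun z => col c (om z)) y *m v^T =
      (u *m a y) *m (v *m col c (th y))^T - (u *m col c (th y)) *m (v *m a y)^T }.

Lemma coframe_sub U U' eps a om th r N T : open U' -> U' `<=` U ->
  coframe U eps a om th r N T -> coframe U' eps a om th r N T.
Proof.
move=> oU' sU [oU es eu *]; split=> //; by [exact: smooth_mx_sub sU _|move=> y /sU; auto].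
Qed.

Section CoframeTheory.
Context (U : set 'rV[R]_m) (eps : 'M[R]_k) (a : 'rV[R]_m -> 'cV[R]_m)
  (om th : 'rV[R]_m -> 'M[R]_(m, k)) (r : 'rV[R]_m -> 'rV[R]_m)
  (N T : 'rV[R]_m -> 'M[R]_(k, m)).
Context (cf : coframe U eps a om th r N T).

Lemma coframe_da_r y : U y -> r y *m ext_d1 a y = 0.
Proof.
move=> Uy; rewrite (cf_da cf Uy) mulmxBr !mulmxA (cf_rom cf Uy) (cf_rth cf Uy).
by rewrite !mul0mx subrr.
Qed.

Lemma coframe_daT y : U y -> ext_d1 a y *m (T y)^T = - (om y *m eps).
Proof.
move=> Uy; rewrite (cf_da cf Uy) mulmxBl -!mulmxA -!trmx_mul.
by rewrite (cf_Tom cf Uy) (cf_Tth cf Uy) trmx0 trmx1 !mulmx0 mulmx1 sub0r.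
Qed.

Lemma coframe_daN y : U y -> ext_d1 a y *m (N y)^T = th y *m eps.
Proof.
move=> Uy; rewrite (cf_da cf Uy) mulmxBl -!mulmxA -!trmx_mul.
by rewrite (cf_Nom cf Uy) (cf_Nth cf Uy) trmx0 trmx1 !mulmx0 mulmx1 subr0.
Qed.

(** Contracting da with [T] and with [N] returns [om] and [th] up to sign and the invertible matrix
    [eps]. *)
Lemma coframe_ker y b (v : 'M[R]_(b, m)) : U y -> v *m ext_d1 a y = 0 ->
  v *m om y = 0 /\ v *m th y = 0.
Proof.
move=> Uy v0; split.
  have := congr1 (mulmx^~ (T y)^T) v0; rewrite /= -mulmxA (coframe_daT Uy) mul0mx.
  rewrite mulmxN mulmxA => /eqP; rewrite oppr_eq0 => /eqP /(congr1 (mulmx^~ (invmx eps))) /=.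
  by rewrite mulmxK ?(cf_unit cf) // mul0mx.
have := congr1 (mulmx^~ (N y)^T) v0; rewrite /= -mulmxA (coframe_daN Uy) mul0mx.
rewrite mulmxA => /(congr1 (mulmx^~ (invmx eps))) /=.
by rewrite mulmxK ?(cf_unit cf) // mul0mx.
Qed.

Lemma coframe_decomp y b (v : 'M[R]_(b, m)) : U y ->
  v = v *m a y *m r y + v *m om y *m N y + v *m th y *m T y.
Proof. by move=> Uy; rewrite -!mulmxA -!mulmxDr (cf_id cf Uy) mulmx1. Qed.

Lemma coframe_decomp_l y b (v : 'M[R]_(m, b)) : U y ->
  v = a y *m (r y *m v) + om y *m (N y *m v) + th y *m (T y *m v).
Proof. by move=> Uy; rewrite !mulmxA -!mulmxDl (cf_id cf Uy) mul1mx. Qed.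

Lemma coframe_kerE y b (v : 'M[R]_(b, m)) : U y -> v *m ext_d1 a y = 0 ->
  v = v *m a y *m r y.
Proof.
move=> Uy /(coframe_ker Uy)[v1 v2].
by rewrite {1}(coframe_decomp v Uy) v1 v2 !mul0mx !addr0.
Qed.

Lemma coframe_kermx y : U y -> (kermx (ext_d1 a y) :=: r y)%MS.
Proof.
move=> Uy; apply/eqmxP/andP; split; last first.
  by apply/sub_kermxP; exact: coframe_da_r.
by rewrite [X in (X <= _)%MS](coframe_kerE Uy (mulmx_ker _)) submxMl.
Qed.

Lemma coframe_r_neq0 y : U y -> r y != 0.
Proof.
move=> Uy; apply/eqP => r0; have := cf_ra cf Uy; rewrite r0 mul0mx.
by move=> /matrixP/(_ 0 0); rewrite !mxE /= => /eqP; rewrite eq_sym oner_eq0.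
Qed.

Lemma coframe_rank y : U y -> \rank (ext_d1 a y) = (k + k)%N.
Proof.
move=> Uy; have := mxrank_ker (ext_d1 a y); rewrite (coframe_kermx Uy).
rewrite rank_rV coframe_r_neq0 //= => E; have le := rank_leq_row (ext_d1 a y).
by move: E le; move: (\rank _) => n; rewrite addSn => /esym/eqP; lia.
Qed.

Lemma coframe_vert y b (v : 'M[R]_(b, m)) : U y ->
  (v <= T y)%MS <-> v *m a y = 0 /\ v *m om y = 0.
Proof.
move=> Uy; split=> [/submxP[D ->]|[v1 v2]].
  by rewrite -!mulmxA (cf_Ta cf Uy) (cf_Tom cf Uy) !mulmx0.
by rewrite (coframe_decomp v Uy) v1 v2 !mul0mx !add0r submxMl.
Qed.

Lemma coframe_vertE y b (v : 'M[R]_(b, m)) : U y -> (v <= T y)%MS ->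
  v = v *m th y *m T y.
Proof.
move=> Uy /(coframe_vert _ Uy)[v1 v2].
by rewrite {1}(coframe_decomp v Uy) v1 v2 !mul0mx !add0r.
Qed.

Lemma coframe_T_free y : U y -> row_free (T y).
Proof. by move=> Uy; apply/row_freeP; exists (th y); exact: (cf_Tth cf). Qed.

Lemma col_mulmx b (A : 'M[R]_(b, m)) c (B : 'M[R]_(m, c)) j : col j (A *m B) = A *m col j B.
Proof. by rewrite !colE mulmxA. Qed.

(** Each omega^c vanishes on [e] and on [X], so Cartan's formula gives omega^c([e, X]) = -
    domega^c(e, X). The structure equation, evaluated on the kernel of [om], turns the right-hand
    side into - a(e) theta^c(X). *)
Lemma coframe_bracket (W : set 'rV[R]_m) (e X : 'rV[R]_m -> 'rV[R]_m) x :
  open W -> W `<=` U -> smooth_mx W e -> smooth_mx W X ->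
  (forall y, W y -> e y *m ext_d1 a y = 0) -> (forall y, W y -> (X y <= T y)%MS) ->
  W x -> lie_bracket e X x *m om x = - (e x *m a x *m (X x *m th x)).
Proof.
move=> oW WU se sX ke vX Wx; have Ux := WU _ Wx.
have eom y : W y -> e y *m om y = 0.
  by move=> Wy; have [] := coframe_ker (WU _ Wy) (ke _ Wy).
have Xom y : W y -> X y *m om y = 0.
  by move=> Wy; have [] := (coframe_vert (X y) (WU _ Wy)).1 (vX _ Wy).
have [Xa _] := (coframe_vert (X x) Ux).1 (vX _ Wx).
have sW := smooth_mx_sub WU (cf_som cf).
apply/rowP => j.
have soj : smooth_mx W (fun y => col j (om y)).
  move=> p q; apply: (smooth_eq oW _ (sW p j)) => y _; by rewrite mxE.
have := cf_dom cf Ux j (eom _ Wx) (Xom _ Wx).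
rewrite (ext_d1_fields oW soj se sX Wx).
have D1 : 'D_(e x) (fun y => X y *m col j (om y)) x = 0.
  apply: (derive_const _ oW Wx (A := 0)) => y Wy.
  by rewrite -col_mulmx Xom // colE mul0mx.
have D2 : 'D_(X x) (fun y => e y *m col j (om y)) x = 0.
  apply: (derive_const _ oW Wx (A := 0)) => y Wy.
  by rewrite -col_mulmx eom // colE mul0mx.
rewrite D1 D2 subrr sub0r Xa trmx0 mulmx0 subr0 => E.
have := congr1 (fun A : 'M[R]_1 => - (A 0 0)) E.
rewrite /= [X in - X = _]mxE opprK -!col_mulmx => {E}E.
have -> : (lie_bracket e X x *m om x) 0 j = (col j (lie_bracket e X x *m om x)) 0 0.
  by rewrite [RHS]mxE.
by rewrite E [in RHS]mxE !mxE !big_ord1 !mxE.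
Qed.

(** As [v] is annihilated by [om], only the term - om eps th^T of da contributes, and
    [coframe_bracket] supplies omega([e, X]). *)
Lemma coframe_metric (W : set 'rV[R]_m) (e X : 'rV[R]_m -> 'rV[R]_m) x v :
  open W -> W `<=` U -> smooth_mx W e -> smooth_mx W X ->
  (forall y, W y -> e y *m ext_d1 a y = 0) -> (forall y, W y -> (X y <= T y)%MS) ->
  W x -> (v <= T x)%MS ->
  lie_bracket e X x *m ext_d1 a x *m v^T =
    e x *m a x *m (X x *m (th x *m eps *m (th x)^T) *m v^T).
Proof.
move=> oW WU se sX ke vX Wx vv; have Ux := WU _ Wx.
have E := coframe_bracket oW WU se sX ke vX Wx.
have [_ vom] := (coframe_vert v Ux).1 vv.
rewrite (cf_da cf Ux) mulmxBr mulmxBl.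
rewrite -[X in X - _]mulmxA -[X in _ *m X]mulmxA -trmx_mul vom trmx0 !mulmx0 sub0r.
by rewrite !mulmxA E !mulNmx opprK !mulmxA.
Qed.

End CoframeTheory.

(** The two coframes share the form [a], hence also its Reeb field, and both metrics equal
    da([r, X], Y) on vertical fields. *)
Lemma coframe_metric_unique U eps a om th r N T eps' om' th' r' N' T' x :
  coframe U eps a om th r N T -> coframe U eps' a om' th' r' N' T' ->
  (forall y, U y -> (T y :=: T' y)%MS) -> U x ->
  T x *m (th x *m eps *m (th x)^T) *m (T x)^T =
  T x *m (th' x *m eps' *m (th' x)^T) *m (T x)^T.
Proof.
move=> c c' TT Ux; apply: mx_bilinP => u v; have oU := cf_open c.
pose X y := u *m T y.
have sX : smooth_mx U X by apply: smooth_mxM => //; [exact: smooth_mx_cst|exact: cf_sT c].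
have vX y : (X y <= T y)%MS by exact: submxMl.
have vX' y : U y -> (X y <= T' y)%MS by move=> Uy; rewrite -(TT _ Uy).
have rk y : U y -> r y *m ext_d1 a y = 0 := coframe_da_r c (y := y).
have vv : (v *m T x <= T x)%MS by exact: submxMl.
have vv' : (v *m T x <= T' x)%MS by rewrite -(TT _ Ux).
have := coframe_metric c oU (@subset_refl _ U) (cf_sr c) sX rk (fun y _ => vX y) Ux vv.
rewrite (coframe_metric c' oU (@subset_refl _ U) (cf_sr c) sX rk vX' Ux vv').
by rewrite (cf_ra c Ux) !mul1mx trmx_mul !mulmxA => ->.
Qed.

End Coframes.

(** * Uniqueness of the quasi-symplectic form up to a constant *)

Section DerivativesOfTwoForms.
Context {R : realType} {m : nat}.
Implicit Types (x u v w : 'rV[R]_m) (U : set 'rV[R]_m) (s t : 'rV[R]_m -> 'M[R]_m).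

Lemma d2_atZ U f s x u v w : open U -> smooth U f -> smooth_mx U s -> U x ->
  d2_at (fun y => f y *: s y) x u v w =
    'D_u f x *: (v *m s x *m w^T) + 'D_v f x *: (w *m s x *m u^T)
    + 'D_w f x *: (u *m s x *m v^T) + f x *: d2_at s x u v w.
Proof.
move=> oU sf ss Ux; rewrite /d2_at.
have E p := derive_mxZ p oU sf ss Ux.
rewrite (E u) (E v) (E w).
move: ('D_u s x) ('D_v s x) ('D_w s x) ('D_u f x) ('D_v f x) ('D_w f x) (f x) (s x).
move=> A B C p q t f0 S.
rewrite !mulmxDr !mulmxDl !scalerDr -!scalemxAr -!scalemxAl.
move: (v *m S *m _) (w *m S *m _) (u *m S *m _) (v *m A *m _) (w *m B *m _) (u *m C *m _).
move=> a1 a2 a3 b1 b2 b3.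
by apply/matrixP => i j; rewrite !mxE; ring.
Qed.

Lemma d2_atB U s t x u v w : smooth_mx U s -> smooth_mx U t -> U x ->
  d2_at (fun y => s y - t y) x u v w = d2_at s x u v w - d2_at t x u v w.
Proof.
move=> ss st Ux; rewrite /d2_at.
have E p : 'D_p (fun y => s y - t y) x = 'D_p s x - 'D_p t x.
  by rewrite deriveB //; exact: smooth_mx_derivable Ux.
rewrite (E u) (E v) (E w).
move: ('D_u s x) ('D_v s x) ('D_w s x) ('D_u t x) ('D_v t x) ('D_w t x).
move=> A B C A' B' C'; rewrite !mulmxBr !mulmxBl.
move: (v *m A *m _) (w *m B *m _) (u *m C *m _) (v *m A' *m _) (w *m B' *m _) (u *m C' *m _).
move=> a1 a2 a3 b1 b2 b3.
by apply/matrixP => i j; rewrite !mxE; ring.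
Qed.

End DerivativesOfTwoForms.

Lemma mxrank_wedge {F : fieldType} {m : nat} (p q : 'cV[F]_m) :
  (\rank (p *m q^T - q *m p^T)%R <= 2)%N.
Proof.
apply: leq_trans (mxrank_add _ _) _; rewrite mxrank_opp -[2%N]/(1 + 1)%N.
by apply: leq_add; apply: leq_trans (mxrankM_maxl _ _) (rank_leq_col _).
Qed.

Lemma skew_sym_eq0 {F : numFieldType} {n : nat} (A : 'M[F]_n) (c : F) (S : 'M[F]_n) :
  A^T = - A -> S^T = S -> A = c *: S -> A = 0 /\ c *: S = 0.
Proof.
move=> kA sS E; suff : A = 0 by move=> A0; rewrite -E.
have := kA; rewrite {1}E linearZ /= sS -E => /eqP; rewrite -addr_eq0 => /eqP E2.
apply/matrixP => i j; have /matrixP/(_ i j) := E2; rewrite !mxE => /eqP.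
by rewrite -mulr2n mulrn_eq0 => /eqP.
Qed.

Section QuasiSymplecticUniqueness.
Context {R : realType} {k : nat}.
Notation m := (k.+1 + k)%N.
Implicit Types (U : set 'rV[R]_m) (x u v w : 'rV[R]_m) (eps : 'M[R]_k).

(* Write [t = s - mu da].  It is semi-basic; [dt (r, X, .)] shows that the
   derivative of [mu] along [r] and [t] vanish because [t] is skew and [eps]
   is symmetric, and then [dmu /\ da = 0] forces [dmu = 0] since the rank of
   [da] exceeds 2. *)
Lemma quasi_symplectic_unique U eps a om th r N T (s : 'rV[R]_m -> 'M[R]_m) mu :
  (1 < k)%N -> coframe U eps a om th r N T ->
  smooth_mx U s -> (forall y, U y -> (s y)^T = - s y) -> closed_2form U s ->
  smooth U mu -> (forall y, U y -> r y *m s y = 0) ->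
  (forall y, U y -> T y *m s y *m (T y)^T = 0) ->
  (forall y c, U y -> lie_bracket r (fun z => c *m T z) y *m s y *m (T y)^T = mu y *: (c *m eps)) ->
  forall y, U y -> s y = mu y *: ext_d1 a y /\ forall u, 'D_u mu y = 0.
Proof.
move=> k1 cf ss sk cs smu rs TT brs; have oU := cf_open cf.
pose rho := ext_d1 a; have srho : smooth_mx U rho := smooth_ext_d1 oU (cf_sa cf).
have crho : closed_2form U rho := ext_d1_closed oU (cf_sa cf).
pose murho y := mu y *: rho y; have smurho : smooth_mx U murho := smooth_mxZ oU smu srho.
pose t y := s y - murho y; have st : smooth_mx U t := smooth_mxB oU ss smurho.
have rho_skew y : (rho y)^T = - rho y := ext_d1_skew a y.
have tk y : U y -> (t y)^T = - t y.
  move=> Uy; rewrite /t /murho linearB /= (sk y Uy) linearZ /= rho_skew scalerN.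
  by rewrite opprB opprK addrC.
have rt y : U y -> r y *m t y = 0.
  by move=> Uy; rewrite mulmxBr (rs y Uy) -scalemxAr (coframe_da_r cf Uy) scaler0 subrr.
have sX c : smooth_mx U (fun z => c *m T z).
  by move=> b; apply: smooth_mxM => //; [exact: smooth_mx_cst|exact: cf_sT cf].
pose br (c : 'rV_k) y := lie_bracket r (fun z => c *m T z) y.
have br_om c y : U y -> br c y *m om y = - c.
  move=> Uy.
  rewrite (coframe_bracket cf oU (@subset_refl _ U) (cf_sr cf) (sX _ c)
    (fun y => coframe_da_r cf (y := y)) (fun y _ => submxMl _ _) Uy).
  by rewrite (cf_ra cf Uy) mul1mx -mulmxA (cf_Tth cf Uy) mulmx1.
have tTT y : U y -> T y *m t y *m (T y)^T = 0.
  move=> Uy; rewrite mulmxBr mulmxBl (TT y Uy) -scalemxAr -scalemxAl -mulmxA.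
  by rewrite (coframe_daT cf Uy) mulmxN mulmxA (cf_Tom cf Uy) mul0mx oppr0 scaler0 subrr.
have br_dec c y : U y -> br c y = br c y *m a y *m r y - c *m N y + br c y *m th y *m T y.
  by move=> Uy; rewrite {1}(coframe_decomp cf (br c y) Uy) (br_om c y Uy) mulNmx.
have brt c y : U y -> br c y *m t y *m (T y)^T = 0.
  move=> Uy; rewrite mulmxBr mulmxBl (brs y c Uy) -scalemxAr -scalemxAl -[X in _ - _ *: X]mulmxA.
  by rewrite (coframe_daT cf Uy) mulmxN mulmxA (br_om c y Uy) mulNmx opprK subrr.
(* The bracket [r, cT] has [N]-component -c. Its components along [r] and [T] contribute nothing to
   t([r, cT], T), which vanishes because [s] and [mu] da induce the same metric. *)
have NtT y : U y -> N y *m t y *m (T y)^T = 0.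
  move=> Uy; apply/row_matrixP => i; rewrite row0 !rowE !mulmxA; set c := delta_mx 0 i.
  have := brt c y Uy; rewrite (br_dec c y Uy); move: (br c y *m a y) (br c y *m th y) => A B.
  rewrite !mulmxDl !mulNmx -!(mulmxA A) rt // mul0mx mulmx0 add0r.
  rewrite -!(mulmxA B) tTT // mulmx0 addr0 => /eqP.
  by rewrite oppr_eq0 => /eqP.
have tT y : U y -> t y *m (T y)^T = 0.
  move=> Uy; rewrite (coframe_decomp_l cf (t y *m (T y)^T) Uy).
  rewrite (mulmxA (r y)) rt // mul0mx (mulmxA (N y)) NtT // (mulmxA (T y)) tTT //.
  by rewrite !mulmx0 !addr0.
have Tt y : U y -> T y *m t y = 0.
  by move=> Uy; rewrite -[LHS]trmxK trmx_mul tk // mulNmx tT // oppr0 trmx0.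
have rhoTN y : U y -> T y *m rho y *m (N y)^T = eps.
  by move=> Uy; rewrite -mulmxA (coframe_daN cf Uy) mulmxA (cf_Tth cf Uy) mul1mx.
have d2t y u v w : U y -> d2_at t y u v w = - ('D_u mu y *: (v *m rho y *m w^T) +
    'D_v mu y *: (w *m rho y *m u^T) + 'D_w mu y *: (u *m rho y *m v^T)).
  move=> Uy; rewrite (d2_atB u v w ss smurho Uy) (d2_atZ u v w oU smu srho Uy).
  rewrite ((closed_2formP ss).1 cs y Uy) ((closed_2formP srho).1 crho y Uy).
  by rewrite scaler0 addr0 sub0r.
have tN y c : U y -> c *m N y *m t y = - (br c y *m t y).
  move=> Uy; rewrite (br_dec c y Uy); move: (br c y *m a y) (br c y *m th y) => A B.
  rewrite !mulmxDl mulNmx -(mulmxA A) rt // mulmx0 add0r -(mulmxA B) Tt //.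
  by rewrite mulmx0 addr0 opprK.
(* Both [r] and cT lie in the kernel of [t], so t([r, cT], c'N) is, up to sign, dt(r, cT, c'N), and
   dt = - dmu /\ da because [s] and da are closed. Only the derivative of [mu] along [r] survives
   there, as [r] is in the kernel of da. *)
have NtN y : U y -> N y *m t y *m (N y)^T = - 'D_(r y) mu y *: eps.
  move=> Uy; apply: mx_bilinP => c c'.
  have -> : c *m (N y *m t y *m (N y)^T) *m c'^T = c *m N y *m t y *m (c' *m N y)^T.
    by rewrite trmx_mul !mulmxA.
  rewrite tN // mulNmx.
  rewrite -(d2_null (c' *m N y) oU st (cf_sr cf) (sX _ c) tk rt _ Uy); last first.
    by move=> z Uz; rewrite -mulmxA Tt // mulmx0.
  rewrite d2t // (coframe_da_r cf Uy) mul0mx scaler0 addr0.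
  have -> : c' *m N y *m rho y *m (r y)^T = 0.
    rewrite -mulmxA -[rho y *m _]trmxK trmx_mul trmxK rho_skew mulmxN (coframe_da_r cf Uy).
    by rewrite oppr0 trmx0 mulmx0.
  rewrite scaler0 addr0 trmx_mul -!mulmxA (mulmxA (T y)) (mulmxA (T y *m _)) rhoTN //.
  by rewrite -[in RHS]scalemxAl -[in RHS]scalemxAr scaleNr.
have [t0 dr0] : (forall y, U y -> t y = 0) /\ forall y, U y -> 'D_(r y) mu y = 0.
  have H y : U y -> N y *m t y *m (N y)^T = 0 /\ - 'D_(r y) mu y *: eps = 0.
    move=> Uy; apply: (skew_sym_eq0 _ (cf_sym cf) (NtN y Uy)).
    by rewrite !trmx_mul trmxK tk // mulNmx mulmxN mulmxA.
  split=> y Uy; have [H1 H2] := H y Uy.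
    have Nt : N y *m t y = 0.
      rewrite -[LHS]trmxK trmx_mul tk // mulNmx (coframe_decomp_l cf (t y *m (N y)^T) Uy).
      rewrite (mulmxA (r y)) rt // mul0mx (mulmxA (N y)) H1 (mulmxA (T y)) Tt // mul0mx.
      by rewrite !mulmx0 !addr0 oppr0 trmx0.
    by rewrite (coframe_decomp_l cf (t y) Uy) rt // Nt Tt // !mulmx0 !addr0.
  move/eqP: H2; rewrite scaler_eq0 oppr_eq0 => /orP[/eqP //|/eqP e0].
  have := mulVmx (cf_unit cf); rewrite e0 mulmx0.
  move=> /matrixP/(_ (Ordinal (ltnW k1)) (Ordinal (ltnW k1))); rewrite !mxE eqxx => /eqP.
  by rewrite eq_sym oner_eq0.
move=> y Uy; have E : s y = murho y by apply/eqP; rewrite -subr_eq0; apply/eqP; exact: t0.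
split=> // u; apply/eqP; apply/negP => /negP u0.
have sd v : 'D_v mu y = (v *m ext_d0 mu y) 0 0.
  by rewrite (derive_ext_d0 _ (smooth_diff smu Uy)) mxE eqxx mulr1n.
have dt0 v w : d2_at t y u v w = 0.
  have D0 p : 'D_p t y = 0 by apply: (derive_const p oU Uy (A := 0)).
  by rewrite /d2_at !D0 !(mulmx0, mul0mx) !addr0.
have [q Eq] : exists q, q = rho y *m u^T by exists (rho y *m u^T).
move: (ext_d0 mu y) sd => d sd.
(* This is dmu /\ da = 0 contracted with [u]: if the derivative along [u] were nonzero, da would be
   decomposable and of rank at most 2. *)
have F : 'D_u mu y *: rho y = q *m d^T - d *m q^T.
  apply: mx_bilinP => v w.
  have := d2t y u v w Uy; rewrite dt0 => /eqP; rewrite eq_sym oppr_eq0.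
  rewrite -addrA addr_eq0 -scalemxAr -scalemxAl => /eqP ->.
  have -> : u *m rho y *m v^T = - (v *m q).
    rewrite Eq (_ : v *m _ = (u *m (rho y)^T *m v^T)^T).
      rewrite rho_skew mulmxN mulNmx linearN /= opprK.
      by apply/matrixP => i j; rewrite !ord1 [RHS]mxE.
    by rewrite !trmx_mul !trmxK.
  have -> : w *m rho y *m u^T = w *m q by rewrite Eq mulmxA.
  rewrite mulmxBr mulmxBl !mulmxA -![_ *m _^T *m w^T]mulmxA -!trmx_mul.
  rewrite !sd; move: (v *m d) (w *m d) (v *m q) (w *m q) => A B C D.
  by apply/matrixP => i j; rewrite !mxE !big_ord1 !mxE !ord1; ring.
have := mxrank_wedge q d; rewrite -F mxrank_scale_nz // (coframe_rank cf Uy).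
by rewrite leqNgt -[2%N]/(1 + 1)%N -addSn leq_add // ltnW.
Qed.

End QuasiSymplecticUniqueness.

(** * Diffeomorphisms and fibrations *)

Section Diffeomorphisms.
Context {R : realType} {m : nat}.
Implicit Types (U W : set 'rV[R]_m) (g h : 'rV[R]_m -> 'rV[R]_m).

Lemma smooth_row_continuous {n : nat} (U : set 'rV[R]_m) (g : 'rV[R]_m -> 'rV[R]_n) x :
  smooth_mx U g -> U x -> {for x, continuous g}.
Proof.
move=> sg Ux; apply/differentiable_continuous/differentiable_row => j.
exact: (smooth_diff (sg 0 j) Ux).
Qed.

Lemma open_preimage {n : nat} (U : set 'rV[R]_m) (W : set 'rV[R]_n)
    (g : 'rV[R]_m -> 'rV[R]_n) : open U -> open W -> smooth_mx U g ->
  open (U `&` g @^-1` W).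
Proof.
move=> oU oW sg; rewrite openE => x [Ux Wx]; apply: filterI; first exact: open_near.
have cg := smooth_row_continuous sg Ux; apply: cg.
by apply: open_nbhs_nbhs.
Qed.

Lemma jacobian_id_on U h x : open U -> smooth_mx U h -> (forall y, U y -> h y = y) ->
  U x -> jacobian h x = 1%:M.
Proof.
move=> oU sh hE Ux; apply/row_matrixP => i.
rewrite !rowE -(derive_jacobian _ sh Ux) mulmx1 (derive_eq_on _ oU Ux hE).
exact: derive_id.
Qed.

Lemma diffeoP U W g : diffeo U W g -> exists g', [/\ diffeo W U g',
  (forall x, U x -> W (g x)), (forall y, W y -> U (g' y)),
  (forall x, U x -> g' (g x) = x) & (forall y, W y -> g (g' y) = y)].
Proof.
move=> [oU oW sg gW [g' [sg' g'U gK g'K]]]; exists g'; split=> //.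
- by split=> //; exists g; split.
- by move=> x Ux; rewrite gK // inE.
- by move=> x Ux; rewrite g'K // inE.
Qed.

Lemma diffeo_jacobian U W g g' x : diffeo U W g -> diffeo W U g' ->
  (forall x, U x -> g' (g x) = x) -> U x ->
  jacobian g x *m jacobian g' (g x) = 1%:M.
Proof.
move=> [oU oW sg gW _] [_ _ sg' g'U _] gK Ux.
rewrite -(jacobian_comp oU gW sg sg' Ux).
by apply: (jacobian_id_on oU _ gK Ux); exact: (smooth_mx_comp oU gW sg sg').
Qed.

Lemma diffeo_unitmx U W g x : diffeo U W g -> U x -> jacobian g x \in unitmx.
Proof.
move=> dg Ux; have [g' [dg' _ _ gK _]] := diffeoP dg.
have E := diffeo_jacobian dg dg' gK Ux.
have [u _] := mulmx1_unit E.
exact: u.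
Qed.

(** The image of [U'] is open because it is a preimage under the inverse map. *)
Lemma diffeo_restrict U W U' g : diffeo U W g -> open U' -> U' `<=` U ->
  exists W', [/\ W' `<=` W, diffeo U' W' g & forall y, W' y <-> exists2 x, U' x & g x = y].
Proof.
move=> dg oU' sU; have [g' [dg' gW g'U gK g'K]] := diffeoP dg.
have [oU oW sg _ _] := dg; have [_ _ sg' _ _] := dg'.
have W'E y : (W `&` g' @^-1` U') y <-> exists2 x, U' x & g x = y.
  split=> [[Wy U'y]|[x U'x <-]]; first by exists (g' y) => //; exact: g'K.
  by have Ux := sU _ U'x; split; [exact: gW|rewrite /preimage /= gK].
exists (W `&` g' @^-1` U'); split=> [y []||] //.
split=> //.
- exact: open_preimage.
- exact: smooth_mx_sub sg.
- by move=> x U'x; apply/W'E; exists x.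
exists g'; split.
- by apply: smooth_mx_sub sg' => y [].
- by move=> y [].
- by move=> x; rewrite inE => /sU; exact: gK.
- by move=> y; rewrite inE => -[/g'K].
Qed.

End Diffeomorphisms.

Section Fibrations.
Context {R : realType} {k : nat}.
Notation m := (k.+1 + k)%N.
Implicit Types (C U : set 'rV[R]_m) (nu : 'rV[R]_m -> 'rV[R]_k.+1).

Lemma jacobian_chart U W nu phi y : diffeo U W phi -> (forall y, U y -> nu y = lsubmx (phi y)) ->
  U y -> jacobian nu y = lsubmx (jacobian phi y).
Proof.
move=> [oU oW sphi _ _] nuE Uy.
have sl : smooth_mx U (fun y => lsubmx (phi y)).
  by move=> i j; apply: (smooth_eq oU _ (sphi i (lshift k j))) => z _; rewrite mxE.
have snu : smooth_mx U nu by apply: (smooth_mx_eq oU _ sl) => z /nuE.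
apply/matrixP => i j; rewrite (jacobianE _ _ snu Uy) [RHS]mxE (jacobianE _ _ sphi Uy).
by apply: (pder_eq_on _ oU Uy) => z Uz; rewrite nuE // mxE.
Qed.

Lemma fibration_rank C M nu x : fibration C M nu -> C x -> \rank (jacobian nu x) = k.+1.
Proof.
move=> [_ _ _ _ chart] Cx; have [U [W [phi [[oU Ux] UC dphi nuE]]]] := chart x Cx.
have Ju := diffeo_unitmx dphi Ux; rewrite (jacobian_chart dphi nuE Ux).
suff : row_full (lsubmx (jacobian phi x)) by move/eqP.
apply/row_fullP; exists (usubmx (invmx (jacobian phi x))).
have -> : usubmx (invmx (jacobian phi x)) *m lsubmx (jacobian phi x) =
    ulsubmx (invmx (jacobian phi x) *m jacobian phi x).
  apply/matrixP => i j; rewrite [LHS]mxE [RHS]mxE [RHS]mxE [RHS]mxE.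
  by apply: eq_bigr => l _; rewrite [X in X * _]mxE [X in _ * X]mxE.
rewrite mulVmx //; apply/matrixP => i j; rewrite !mxE.
by congr ((_ _)%:R); apply/eqP/eqP => [/lshift_inj|->].
Qed.

Lemma vertical_rank C M nu x : fibration C M nu -> C x -> \rank (vertical nu x) = k.
Proof.
by move=> fib Cx; rewrite mxrank_ker (fibration_rank fib Cx) addKn.
Qed.

(** Semi-basic forms annihilate the vertical bundle, which gives one inclusion. The other is a count
    of dimensions: the vertical bundle has rank k and [T] has k rows. *)
Lemma coframe_vertical C M nu eps a om th r N T x : fibration C M nu ->
  coframe C eps a om th r N T -> semibasic C nu a -> semibasic C nu om -> C x ->
  (T x :=: vertical nu x)%MS.
Proof.
move=> fib cf sa so Cx; apply/eqmxP.
have VT : (vertical nu x <= T x)%MS by apply/(coframe_vert cf _ Cx); split; [exact: sa|exact: so].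
rewrite VT andbT -(geq_leqif (mxrank_leqif_sup VT)) (vertical_rank fib Cx).
exact: rank_leq_row.
Qed.

End Fibrations.

Section PulledBackCoframe.
Context {R : realType} {k : nat}.
Notation m := (k.+1 + k)%N.

(** Brings the coframe of the second structure to the domain of the first, where the two can be
    compared. Forms are pulled back by the Jacobian and fields by its inverse, so the duality
    relations are unchanged. *)
Lemma coframe_pull U1 U2 (g : 'rV[R]_m -> 'rV[R]_m) eps a om th r N T :
  diffeo U1 U2 g -> coframe U2 eps a om th r N T ->
  coframe U1 eps (pull1 g a) (pull1 g om) (pull1 g th)
    (fun y => r (g y) *m invmx (jacobian g y))
    (fun y => N (g y) *m invmx (jacobian g y))
    (fun y => T (g y) *m invmx (jacobian g y)).
Proof.
move=> dg cf; have [oU oW sg gW _] := dg; have uJ y := diffeo_unitmx dg (x := y).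
have sJ := smooth_invmx oU uJ (smooth_jacobian oU sg).
have K y b c (A : 'M[R]_(b, m)) (B : 'M[R]_(m, c)) : U1 y ->
    A *m invmx (jacobian g y) *m (jacobian g y *m B) = A *m B.
  by move=> Uy; rewrite mulmxA mulmxKV ?uJ.
have sP b (F : 'rV[R]_m -> 'M[R]_(b, m)) : smooth_mx U2 F ->
    smooth_mx U1 (fun y => F (g y) *m invmx (jacobian g y)).
  by move=> sF; apply: smooth_mxM => //; exact: smooth_mx_comp gW sg sF.
have sQ b (F : 'rV[R]_m -> 'M[R]_(m, b)) : smooth_mx U2 F -> smooth_mx U1 (pull1 g F).
  exact: smooth_pull1.
split.
- by [].
- exact: cf_sym cf.
- exact: cf_unit cf.
- exact: sQ (cf_sa cf).
- exact: sQ (cf_som cf).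
- exact: sQ (cf_sth cf).
- exact: sP (cf_sr cf).
- exact: sP (cf_sN cf).
- exact: sP (cf_sT cf).
- by move=> y Uy; rewrite K // (cf_ra cf) //; exact: gW.
- by move=> y Uy; rewrite K // (cf_rom cf) //; exact: gW.
- by move=> y Uy; rewrite K // (cf_rth cf) //; exact: gW.
- by move=> y Uy; rewrite K // (cf_Na cf) //; exact: gW.
- by move=> y Uy; rewrite K // (cf_Nom cf) //; exact: gW.
- by move=> y Uy; rewrite K // (cf_Nth cf) //; exact: gW.
- by move=> y Uy; rewrite K // (cf_Ta cf) //; exact: gW.
- by move=> y Uy; rewrite K // (cf_Tom cf) //; exact: gW.
- by move=> y Uy; rewrite K // (cf_Tth cf) //; exact: gW.
- move=> y Uy; rewrite /pull1 !mulmxA -!mulmxDl -!(mulmxA (jacobian g y)) -!mulmxDr.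
  by rewrite (cf_id cf (gW _ Uy)) mulmx1 mulmxV // uJ.
- move=> y Uy; rewrite (ext_d1_pull oU gW sg (cf_sa cf) Uy) /pull2 (cf_da cf (gW _ Uy)).
  by rewrite mulmxBr mulmxBl /pull1 !trmx_mul !mulmxA.
- move=> y Uy c u v; rewrite /pull1 !mulmxA => u0 v0.
  have soc : smooth_mx U2 (fun z => col c (om z)).
    by move=> p q; apply: (smooth_eq oW _ (cf_som cf p c)) => z _; rewrite mxE.
  rewrite (ext_d1_eq_on (b := pull1 g (fun z => col c (om z))) oU Uy); last first.
    by move=> z _; rewrite /pull1 col_mulmx.
  rewrite (ext_d1_pull oU gW sg soc Uy) /pull2.
  have := cf_dom cf (gW _ Uy) c u0 v0.
  rewrite !col_mulmx !mulmxA !trmx_mul !mulmxA => <-.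
  by [].
Qed.

End PulledBackCoframe.

(** * Adapted coframings and their dual frames *)

Section AdaptedCoframings.
Context {R : realType}.

Lemma wedge_sumE {m k : nat} (eps : 'M[R]_k) (om th : 'M[R]_(m, k)) :
  \sum_a \sum_b eps a b *: wedge (col a th) (col b om) =
  th *m eps *m om^T - om *m eps^T *m th^T.
Proof.
apply/matrixP => i j; rewrite [RHS]mxE [X in _ + X]mxE summxE.
have -> : (th *m eps *m om^T) i j = \sum_a \sum_b th i a * eps a b * om j b.
  rewrite mxE exchange_big /=; apply: eq_bigr => b _; rewrite [X in X * _]mxE mulr_suml.
  by apply: eq_bigr => a _; rewrite [om^T _ _]mxE.
have -> : (om *m eps^T *m th^T) i j = \sum_a \sum_b om i b * eps a b * th j a.
  rewrite mxE; apply: eq_bigr => a _; rewrite [X in X * _]mxE mulr_suml.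
  by apply: eq_bigr => b _; rewrite [th^T _ _]mxE [eps^T _ _]mxE.
rewrite -sumrB; apply: eq_bigr => a _; rewrite summxE -sumrB; apply: eq_bigr => b _.
by rewrite /wedge !mxE !big_ord1 !mxE; ring.
Qed.

Lemma wedge_bilin {m : nat} (p q : 'cV[R]_m) (u v : 'rV[R]_m) :
  u *m wedge p q *m v^T = (u *m p) *m (v *m q)^T - (u *m q) *m (v *m p)^T.
Proof. by rewrite /wedge mulmxBr mulmxBl !trmx_mul !mulmxA. Qed.

Lemma signature_unit p q (G : 'M[R]_(p + q)) : has_signature p q G -> G \in unitmx.
Proof.
move=> [_ [P uP]]; set D := block_mx _ _ _ _ => E.
have : D *m D = 1%:M.
  rewrite mulmx_block !mul0mx !mulmx0 !addr0 !add0r mulmx1 -scalar_mxM.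
  by rewrite mulrNN mulr1 -scalar_mx_block.
move=> /mulmx1_unit[uD _]; move: uD; rewrite -E !unitmx_mul => /andP[/andP[_ ->]] //.
Qed.

Lemma frame_blocks {m k : nat} (r : 'rV[R]_m) (N T : 'M[R]_(k, m)) (a : 'cV[R]_m)
    (om th : 'M[R]_(m, k)) :
  col_mx r (col_mx N T) *m row_mx a (row_mx om th) = 1%:M ->
  [/\ [/\ r *m a = 1%:M, r *m om = 0 & r *m th = 0],
      [/\ N *m a = 0, N *m om = 1%:M & N *m th = 0] &
      [/\ T *m a = 0, T *m om = 0 & T *m th = 1%:M]].
Proof.
rewrite mul_col_row scalar_mx_block => /eq_block_mx[-> ].
rewrite mul_mx_row -[0 in X in X -> _]row_mx0 => /eq_row_mx[-> ->].
rewrite mul_col_mx -[0 in X in X -> _]col_mx0 => /eq_col_mx[-> ->].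
by rewrite mul_col_row scalar_mx_block => /eq_block_mx[-> -> -> ->].
Qed.

(** The dual frame consists of the blocks of rows of the inverse of the matrix of the coframing. In
    the structure equation the terms P_b /\ omega^b vanish on pairs of vectors annihilated by [om],
    which is how the unspecified forms P_b disappear. *)
Lemma adapted_coframe p q (S : finsler_data R (p + q)) eps om th :
  open (fcar S) -> smooth_mx (fcar S) (fhilbert S) -> adapted_coframing p q S eps om th ->
  exists r N T, coframe (fcar S) eps (fhilbert S) om th r N T.
Proof.
set C := fcar S; set a := fhilbert S; set k := (p + q)%N.
move=> oC sa [sig [som sth] free _ str].
pose F y : 'M[R]_(1 + (k + k)) := row_mx (a y) (row_mx (om y) (th y)).
have uF y : C y -> F y \in unitmx by move=> Cy; rewrite -row_free_unit; exact: free.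
have sF : smooth_mx C F by apply: smooth_row_mx => //; exact: smooth_row_mx.
have sI := smooth_invmx oC uF sF.
pose Fr y : 'M[R]_(1 + (k + k), k.+1 + k) := invmx (F y).
exists (fun y => usubmx (Fr y)), (fun y => usubmx (dsubmx (Fr y))),
  (fun y => dsubmx (dsubmx (Fr y))).
have FrE y : Fr y = col_mx (usubmx (Fr y)) (col_mx (usubmx (dsubmx (Fr y))) (dsubmx (dsubmx (Fr y)))).
  by rewrite !vsubmxK.
have K1 y : C y -> Fr y *m (row_mx (a y) (row_mx (om y) (th y))) = (1%:M : 'M[R]_(1 + (k + k))).
  by move=> Cy; exact: (mulVmx (uF y Cy)).
have K2 y : C y -> row_mx (a y) (row_mx (om y) (th y)) *m Fr y = 1%:M.
  by move=> Cy; exact: (mulmxV (uF y Cy)).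
have blocks y (Cy : C y) := frame_blocks (etrans (congr1 (mulmx^~ _) (esym (FrE y))) (K1 y Cy)).
have so j : smooth_mx C (fun y => col j (om y)).
  by move=> u v; apply: (smooth_eq oC _ (som u j)) => y _; rewrite mxE.
split.
- by [].
- exact: (proj1 sig).
- exact: signature_unit sig.
- by [].
- by [].
- by [].
- by move=> i j; apply: (smooth_eq oC _ (sI (lshift (k + k) i) j)) => y _; rewrite [RHS]mxE.
- by move=> i j; apply: (smooth_eq oC _ (sI (rshift 1 (lshift k i)) j)) => y _; rewrite [RHS]mxE [RHS]mxE.
- by move=> i j; apply: (smooth_eq oC _ (sI (rshift 1 (rshift k i)) j)) => y _; rewrite [RHS]mxE [RHS]mxE.
- by move=> y /blocks[[]].
- by move=> y /blocks[[]].
- by move=> y /blocks[[]].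
- by move=> y /blocks[_ []].
- by move=> y /blocks[_ []].
- by move=> y /blocks[_ []].
- by move=> y /blocks[_ _ []].
- by move=> y /blocks[_ _ []].
- by move=> y /blocks[_ _ []].
- by move=> y Cy; rewrite -(K2 y Cy) [in RHS]FrE mul_row_col mul_row_col addrA.
- by move=> y Cy; have [-> _] := str y Cy; rewrite wedge_sumE (proj1 sig).
- move=> y Cy c u v u0 v0; have [_ /(_ c)[P ->]] := str y Cy.
  rewrite mulmxDr mulmxDl wedge_bilin mulmx_sumr mulmx_suml big1 ?addr0 // => b _.
  by rewrite wedge_bilin -!col_mulmx u0 v0 !colE !mul0mx trmx0 mulmx0 subrr.
Qed.

End AdaptedCoframings.

Lemma mul11mx {R : pzRingType} {b} (A : 'M[R]_1) (B : 'M[R]_(1, b)) : A *m B = A 0 0 *: B.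
Proof. by rewrite {1}(mx11_scalar A) mul_scalar_mx. Qed.

(** * The orthopath geometry carried by a coframe *)

Section CoframeGeometry.
Context {R : realType} {k : nat}.
Notation m := (k.+1 + k)%N.
Context (U : set 'rV[R]_m) (eps : 'M[R]_k) (a : 'rV[R]_m -> 'cV[R]_m)
  (om th : 'rV[R]_m -> 'M[R]_(m, k)) (r : 'rV[R]_m -> 'rV[R]_m)
  (N T : 'rV[R]_m -> 'M[R]_(k, m)) (cf : coframe U eps a om th r N T)
  (E V : 'rV[R]_m -> 'M[R]_m)
  (Er : forall y, U y -> (E y :=: r y)%MS) (VT : forall y, U y -> (V y :=: T y)%MS).

Lemma coframe_sum y b (v : 'M[R]_(b, m)) : U y -> (v <= E y + V y)%MS <-> v *m om y = 0.
Proof.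
move=> Uy; have ET := adds_eqmx (Er Uy) (VT Uy); rewrite ET; split.
  case/sub_addsmxP => -[A B] /= ->; rewrite mulmxDl -!mulmxA.
  by rewrite (cf_rom cf Uy) (cf_Tom cf Uy) !mulmx0 addr0.
move=> v0; rewrite (coframe_decomp cf v Uy) v0 mul0mx addr0.
by apply: addmx_sub_adds; exact: submxMl.
Qed.

Lemma coframe_line_ker y b (e : 'M[R]_(b, m)) : U y -> (e <= E y)%MS -> e *m ext_d1 a y = 0.
Proof.
by move=> Uy; rewrite (Er Uy) => /submxP[D ->]; rewrite -mulmxA (coframe_da_r cf Uy) mulmx0.
Qed.

Lemma coframe_line_neq0 y (e : 'rV[R]_m) : U y -> (e <= E y)%MS -> e != 0 ->
  (e *m a y) 0 0 != 0.
Proof.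
move=> Uy eE; apply: contra => /eqP e0; rewrite (coframe_kerE cf Uy (coframe_line_ker Uy eE)).
by rewrite mul11mx e0 scale0r.
Qed.

(** E + V is the kernel of [om], so [om] measures the bracket modulo E + V. By [coframe_bracket] the
    map sends theta(X) to - a(e) theta(X), and a(e) is nonzero. *)
Lemma coframe_bracket_iso : bracket_iso U E V.
Proof.
move=> x Ux e [W [[oW Wx] se eE]] e0; have oU := cf_open cf.
have eE' y : (W `&` U) y -> e y *m ext_d1 a y = 0.
  by move=> [Wy Uy]; apply: (coframe_line_ker Uy); exact: eE.
have ea0 := coframe_line_neq0 Ux (eE x Wx) e0.
split=> [X [W' [[oW' W'x] sX XV]]|w].
  rewrite (coframe_sum _ Ux) => br0.
  pose D := W `&` U `&` W'.
  have oD : open D by do 2! [apply: openI => //].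
  have Dx : D x by [].
  have XT y : D y -> (X y <= T y)%MS.
    by move=> [[_ Uy] W'y]; rewrite -(VT Uy); exact: XV.
  have DU : D `<=` U by move=> y [[]].
  have DW : D `<=` W by move=> y [[]].
  have DW' : D `<=` W' by move=> y [].
  have eD y : D y -> e y *m ext_d1 a y = 0 by move=> [Wy _]; exact: eE'.
  have := coframe_bracket cf oD DU (smooth_mx_sub DW se) (smooth_mx_sub DW' sX) eD XT Dx.
  rewrite br0 mul11mx => /eqP; rewrite eq_sym oppr_eq0 scaler_eq0 (negPf ea0) /= => /eqP X0.
  by rewrite (coframe_vertE cf Ux (XT x Dx)) X0 mul0mx.
(* [c] solves - a(e) c = omega(w) at [x]; the frame [T] extends it to a vertical field. *)
pose c := - (((e x *m a x) 0 0)^-1 *: (w *m om x)); pose X y := c *m T y.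
have sX : smooth_mx U X by apply: smooth_mxM => //; [exact: smooth_mx_cst|exact: cf_sT cf].
have XT y : (X y <= T y)%MS by exact: submxMl.
exists X.
  by exists U; split=> // y Uy; rewrite (VT Uy).
apply/(coframe_sum _ Ux); rewrite mulmxBl.
have oD : open (W `&` U) by exact: openI.
rewrite (coframe_bracket cf oD (@subIsetr _ W U) (smooth_mx_sub (@subIsetl _ W U) se)
   (smooth_mx_sub (@subIsetr _ W U) sX) eE' (fun y _ => XT y) (conj Wx Ux)).
rewrite opprK /X -(mulmxA c) (cf_Tth cf Ux) mulmx1 mul11mx /c scalerN scalerA mulfV //.
by rewrite scale1r subrr.
Qed.

Lemma coframe_smooth_line : smooth_distribution 1 U E.
Proof.
move=> x Ux; exists U, r; split=> [|//||y Uy].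
- by split=> //; exact: cf_open cf.
- exact: cf_sr cf.
- split; last exact/eqmx_sym/Er.
  by rewrite /row_free rank_rV (coframe_r_neq0 cf Uy).
Qed.

Lemma coframe_smooth_vert : smooth_distribution k U V.
Proof.
move=> x Ux; exists U, T; split=> [|//||y Uy].
- by split=> //; exact: cf_open cf.
- exact: cf_sT cf.
- by split; [exact: (coframe_T_free cf Uy)|exact/eqmx_sym/VT].
Qed.

Lemma coframe_cap y : U y -> (E y :&: V y)%MS = 0.
Proof.
move=> Uy; apply/eqP; rewrite -submx0; set M := (_ :&: _)%MS.
have /(coframe_line_ker Uy)/(coframe_kerE cf Uy) ME : (M <= E y)%MS by exact: capmxSl.
have MT : (M <= T y)%MS by rewrite -(VT Uy) capmxSr.
have [Ma _] := (coframe_vert cf M Uy).1 MT.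
by rewrite ME Ma mul0mx sub0mx.
Qed.

Lemma coframe_quasi_symplectic (O : orthopath_data R k) :
  (forall y, oline O y = E y) -> (forall y, overt O y = V y) ->
  (forall y, omet O y = th y *m eps *m (th y)^T) ->
  compatible_quasi_symplectic O U (ext_d1 a).
Proof.
move=> OE OV Oh; have oU := cf_open cf; split.
- split; first exact: smooth_ext_d1 (cf_sa cf).
  by move=> x _; exact: ext_d1_skew.
- exact: ext_d1_closed oU (cf_sa cf).
- move=> x Ux; split; first exact: (coframe_rank cf Ux).
  rewrite OE; apply: eqmx_trans (coframe_kermx cf Ux) _.
  exact/eqmx_sym/Er.
- move=> x Ux; rewrite OV.
  have /submxP[D ->] : (V x <= T x)%MS by rewrite (VT Ux).
  rewrite trmx_mul !mulmxA -(mulmxA _ (ext_d1 a x)) (coframe_daT cf Ux) mulmxN -mulmxA.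
  by rewrite (mulmxA (T x)) (cf_Tom cf Ux) mul0mx mulmx0 oppr0 mul0mx.
(* The conformal factor is a(e), nonzero because [e] is a nonzero multiple of the Reeb field. *)
move=> W e oW WU se eE; exists (fun y => (e y *m a y) 0 0); split.
- have sea : smooth_mx W (fun y => e y *m a y).
    by apply: smooth_mxM => //; exact: smooth_mx_sub WU (cf_sa cf).
  exact: sea.
- move=> y Wy; have [ey e0] := eE y Wy; apply: (coframe_line_neq0 (WU _ Wy)) => //.
  by rewrite -OE.
move=> y X Y Wy [W' [[oW' W'y] sX XV]] [W2 [[_ W2y] _ YV]].
have oD : open (W `&` W') by exact: openI.
have DU : W `&` W' `<=` U by move=> z [/WU].
rewrite Oh -mul11mx; apply: (coframe_metric cf oD DU
   (smooth_mx_sub (@subIsetl _ W W') se) (smooth_mx_sub (@subIsetr _ W W') sX)).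
- move=> z [Wz _]; apply: (coframe_line_ker (WU z Wz)).
  by rewrite -OE; have [] := eE z Wz.
- move=> z [Wz W'z]; rewrite -(VT (WU z Wz)) -OV; exact: XV.
- by [].
- by rewrite -(VT (WU y Wy)) -OV; exact: YV.
Qed.

End CoframeGeometry.

(** * From Finsler structures to variational orthopath geometries *)

Section FinslerToOrthopath.
Context {R : realType} {p q : nat}.
Notation k := (p + q)%N.
Notation m := (k.+1 + k)%N.

Lemma finsler_coframe (S : finsler_data R k) eps om th :
  finsler_structure p q S -> adapted_coframing p q S eps om th ->
  exists r N T, coframe (fcar S) eps (fhilbert S) om th r N T /\
    forall y, fcar S y -> (T y :=: vertical (fproj S) y)%MS.
Proof.
move=> [fib [sa _] _] ad; have [oC _ _ _ _] := fib.
have [r [N [T cf]]] := adapted_coframe oC sa ad.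
exists r, N, T; split=> // y Cy; have [_ _ _ [sba sbo] _] := ad.
exact: (coframe_vertical fib cf sba sbo Cy).
Qed.

(** Two adapted coframings of one structure give the same metric on V and not merely the same class,
    since the Hilbert form determines it. Hence the conformal factor 1 in the correspondence. *)
Lemma finsler_conformal_class (S : finsler_data R k) (V : 'rV[R]_m -> 'M[R]_m) eps om th eps' om' th' :
  finsler_structure p q S -> adapted_coframing p q S eps om th ->
  adapted_coframing p q S eps' om' th' ->
  (forall y, fcar S y -> (V y :=: vertical (fproj S) y)%MS) ->
  forall y, fcar S y -> V y *m (th y *m eps *m (th y)^T) *m (V y)^T =
    V y *m (th' y *m eps' *m (th' y)^T) *m (V y)^T.
Proof.
move=> fS ad ad' VV y Cy.
have [r [N [T [cf TV]]]] := finsler_coframe fS ad.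
have [r' [N' [T' [cf' TV']]]] := finsler_coframe fS ad'.
have TT z : fcar S z -> (T z :=: T' z)%MS.
  by move=> Cz; apply: eqmx_trans (TV z Cz) _; exact/eqmx_sym/TV'.
have /submxP[D ->] : (V y <= T y)%MS by rewrite (VV y Cy) (TV y Cy).
rewrite !trmx_mul !mulmxA; have := coframe_metric_unique cf cf' TT Cy.
by move=> /(congr1 (fun A => D *m A *m D^T)); rewrite !mulmxA.
Qed.

Lemma finsler_to_orthopath (S : finsler_data R k) : finsler_structure p q S ->
  exists O : orthopath_data R k,
    [/\ corresponds p q S O, orthopath p q O, variational O &
        compatible_quasi_symplectic O (ocar O) (ext_d1 (fhilbert S))].
Proof.
move=> fS; have [fib _ [eps [om [th ad]]]] := fS; have [oC oM snu nuC chart] := fib.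
have [r [N [T [cf TV]]]] := finsler_coframe fS ad.
have [sig [som sth] _ _ _] := ad.
pose E y := genmx (r y); pose V := vertical (fproj S).
have Er y : fcar S y -> (E y :=: r y)%MS by move=> _; exact: genmxE.
have VT y : fcar S y -> (V y :=: T y)%MS by move=> Cy; exact/eqmx_sym/TV.
pose O := OrthopathData (fcar S) E V (fun y => th y *m eps *m (th y)^T).
have qs : compatible_quasi_symplectic O (ocar O) (ext_d1 (fhilbert S)).
  exact: (coframe_quasi_symplectic cf Er VT).
exists O; split=> //.
- split=> //.
  + move=> x Cx; exists (r x); last exact/eqmx_sym/Er.
    by split; [exact: (cf_ra cf Cx)|exact: (coframe_da_r cf Cx)].
  + move=> eps' om' th' ad'; exists (fun=> 1); split=> [|x _|x Cx].
    * exact: smooth_cst.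
    * exact: oner_neq0.
    * by rewrite scale1r; exact: (finsler_conformal_class fS ad' ad).
- split.
  + split=> //; split.
    * exact: (coframe_smooth_line cf Er).
    * exact: (coframe_smooth_vert cf VT).
    * move=> x Cx; exists (fcar S), (fproj S); split=> //.
      by split=> //; rewrite nuC.
    * move=> x Cx; exact: (coframe_cap cf Er VT Cx).
    * exact: (coframe_bracket_iso cf Er VT).
  + apply: smooth_mxM => //; last exact: smooth_mxT.
    by apply: smooth_mxM => //; exact: smooth_mx_cst.
  + by move=> x _; rewrite !trmx_mul trmxK (proj1 sig) mulmxA.
  + move=> x Cx; exists (T x); first exact: TV.
    rewrite /= !mulmxA (cf_Tth cf Cx) mul1mx -mulmxA -trmx_mul (cf_Tth cf Cx) trmx1 mulmx1.
    exact: sig.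
- move=> x Cx; exists (fcar S), (ext_d1 (fhilbert S)); split=> //.
Qed.

End FinslerToOrthopath.

(** * Divergence equivalence *)

Section CoframeComparison.
Context {R : realType} {k : nat}.
Notation m := (k.+1 + k)%N.
Implicit Types (U : set 'rV[R]_m).

Lemma ext_d0_comp {l n : nat} (U : set 'rV[R]_l) (W : set 'rV[R]_n) (g : 'rV[R]_l -> 'rV[R]_n) (f : 'rV[R]_n -> R) x :
  (forall x, U x -> W (g x)) -> smooth_mx U g -> smooth W f -> U x ->
  ext_d0 (f \o g) x = jacobian g x *m ext_d0 f (g x).
Proof.
move=> gW sg sf Ux; apply/colP => i; rewrite [LHS]mxE [RHS]mxE.
have dg j : differentiable (fun y => g y 0 j) x := smooth_diff (sg 0 j) Ux.
rewrite [LHS](derive_comp_fun _ dg (smooth_diff sf (gW x Ux))).2.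
by apply: eq_bigr => j _; rewrite (jacobianE _ _ sg Ux) [ext_d0 _ _ _ _]mxE.
Qed.

Lemma trmx11 (A : 'M[R]_1) : A^T = A.
Proof. by apply: scal_mxP; rewrite mxE. Qed.

(** [r] spans the Reeb line of [a'] without being normalised for it, so the metric of [a'] appears
    with the factor a'(r). This is how both structures are tested with the single field [r]. *)
Lemma coframe_metric_ratio U eps a om th r N T eps' a' om' th' r' N' T' x :
  coframe U eps a om th r N T -> coframe U eps' a' om' th' r' N' T' ->
  (forall y, U y -> (T y :=: T' y)%MS) -> (forall y, U y -> r y *m ext_d1 a' y = 0) ->
  U x -> forall u, lie_bracket r (fun y => u *m T y) x *m ext_d1 a' x *m (T x)^T =
    (r x *m a' x) 0 0 *: (u *m T x *m (th' x *m eps' *m (th' x)^T) *m (T x)^T).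
Proof.
move=> c c' TT rk Ux u; have oU := cf_open c.
have sX : smooth_mx U (fun y => u *m T y).
  by apply: smooth_mxM => //; [exact: smooth_mx_cst|exact: cf_sT c].
have vX y : U y -> (u *m T y <= T' y)%MS by move=> Uy; rewrite -(TT _ Uy) submxMl.
apply: mx_bilinP => p v; rewrite (mx11_scalar p) !mul_scalar_mx -!scalemxAl; congr (_ *: _).
have vv : (v *m T x <= T' x)%MS by rewrite -(TT _ Ux) submxMl.
have := coframe_metric c' oU (@subset_refl _ U) (cf_sr c) sX rk vX Ux vv.
by rewrite mul11mx trmx_mul !mulmxA.
Qed.

End CoframeComparison.

Section DivergenceEquivalence.
Context {R : realType} {p q : nat}.
Notation k := (p + q)%N.
Notation m := (k.+1 + k)%N.
Lemma corresponds_coframe (S : finsler_data R k) (O : orthopath_data R k) :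
  finsler_structure p q S -> corresponds p q S O ->
  exists eps om th r N T lam, [/\ coframe (fcar S) eps (fhilbert S) om th r N T,
    (forall y, fcar S y -> (T y :=: vertical (fproj S) y)%MS),
    (forall y, fcar S y -> (oline O y :=: r y)%MS),
    (forall y, fcar S y -> (overt O y :=: T y)%MS) &
    [/\ smooth (fcar S) lam, (forall x, fcar S x -> lam x != 0) &
      forall x, fcar S x -> T x *m (th x *m eps *m (th x)^T) *m (T x)^T =
        lam x *: (T x *m omet O x *m (T x)^T)]].
Proof.
move=> fS [_ lin ver conf]; have [_ _ [eps [om [th ad]]]] := fS.
have [r [N [T [cf TV]]]] := finsler_coframe fS ad.
have [lam [slam lam0 lamE]] := conf eps om th ad.
have VT y : fcar S y -> (overt O y :=: T y)%MS.
  by move=> Cy; apply: eqmx_trans (ver y Cy) _; exact/eqmx_sym/TV.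
exists eps, om, th, r, N, T, lam; split=> //.
  move=> y Cy; have [r' [ra rd] rO] := lin y Cy.
  have E := coframe_kerE cf Cy rd.
  by rewrite ra mul1mx in E; rewrite -E; exact/eqmx_sym.
split=> // x Cx; have /submxP[D ->] : (T x <= overt O x)%MS by rewrite (VT x Cx).
rewrite !trmx_mul; have /(congr1 (fun A => D *m A *m D^T)) := lamE x Cx.
by rewrite -scalemxAr -scalemxAl !mulmxA.
Qed.

Lemma eqmx_unitP {b c n : nat} (A : 'M[R]_(b, n)) (B : 'M[R]_(c, n)) (J : 'M[R]_n) :
  J \in unitmx -> (A *m J :=: B)%MS <-> (B *m invmx J :=: A)%MS.
Proof.
move=> uJ; split=> H.
  have E : (B *m invmx J :=: A *m J *m invmx J)%MS := eqmxMr (invmx J) (eqmx_sym H).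
  by rewrite mulmxK in E.
have E : (A *m J :=: B *m invmx J *m J)%MS := eqmxMr J (eqmx_sym H).
by rewrite mulmxKV in E.
Qed.

Context (S1 S2 : finsler_data R k) (O1 O2 : orthopath_data R k).
Context (fS1 : finsler_structure p q S1) (fS2 : finsler_structure p q S2).
Context (co1 : corresponds p q S1 O1) (co2 : corresponds p q S2 O2).

(** Adding df does not change the differential, so da2 = c da1 and the Reeb lines agree. Testing
    this equality on brackets of the first Reeb field with vertical fields compares the two
    metrics. *)
Lemma divergence_orthopath x1 x2 :
  divergence_equivalent S1 x1 S2 x2 -> orthopath_equivalent O1 x1 O2 x2.
Proof.
move=> [U1 [U2 [g [[oU1 sU1] [oU2 sU2] [dg gx] gV [c [f [c0 sf fE]]]]]]].
have [eps1 [om1 [th1 [r1 [N1 [T1 [lam1 [cf1 TV1 Er1 VT1 [slam1 lam10 h1]]]]]]]]] :=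
  corresponds_coframe fS1 co1.
have [eps2 [om2 [th2 [r2 [N2 [T2 [lam2 [cf2 TV2 Er2 VT2 [slam2 lam20 h2]]]]]]]]] :=
  corresponds_coframe fS2 co2.
have [oU oW sg gW _] := dg; have uJ y := diffeo_unitmx dg (x := y).
have {}cf1 := coframe_sub oU sU1 cf1.
have cf2' := coframe_pull dg (coframe_sub oW sU2 cf2).
set a2 := pull1 g (fhilbert S2) in cf2'; set th2' := pull1 g th2 in cf2'.
set r2' := fun y => r2 (g y) *m _ in cf2'; set T2' := fun y => T2 (g y) *m _ in cf2'.
have TT y : U1 y -> (T1 y :=: T2' y)%MS.
  move=> Uy; apply: eqmx_trans (TV1 _ (sU1 _ Uy)) _; apply: eqmx_sym.
  have vv := (eqmx_unitP _ _ (uJ y Uy)).1 (gV y Uy).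
  by apply: eqmx_trans vv; apply: eqmxMr; exact: TV2 (sU2 _ (gW _ Uy)).
have [_ _ snu _ _] : fibration (fcar S1) (fbase S1) (fproj S1) by have [] := fS1.
have sfn : smooth U1 (f \o fproj S1).
  apply: (smooth_comp oU _ (smooth_mx_sub sU1 snu) sf) => y Uy.
  by exists y.
have da2 y : U1 y -> ext_d1 a2 y = c *: ext_d1 (fhilbert S1) y.
  move=> Uy; rewrite (ext_d1_eq_on oU Uy fE).
  rewrite (ext_d1_comb c oU (cf_sa cf1) (smooth_ext_d0 oU sfn) Uy).
  by rewrite (ext_d1_ext_d0 oU sfn Uy) addr0.
have rk y : U1 y -> r1 y *m ext_d1 a2 y = 0.
  by move=> Uy; rewrite da2 // -scalemxAr (coframe_da_r cf1 Uy) scaler0.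
(* The factor between the two Reeb fields on their common line; df need not vanish on [r1], so it is
   a function and not just [c]. *)
pose s y := (r1 y *m a2 y) 0 0.
have rr y : U1 y -> r1 y = s y *: r2' y.
  by move=> Uy; rewrite {1}(coframe_kerE cf2' Uy (rk y Uy)) mul11mx.
have s0 y : U1 y -> s y != 0.
  move=> Uy; apply: contra (coframe_r_neq0 cf1 Uy) => /eqP s0.
  by rewrite (rr y Uy) s0 scale0r.
have VV y : U1 y -> (overt O1 y *m jacobian g y :=: overt O2 (g y))%MS.
  move=> Uy; apply: eqmx_trans (eqmxMr _ (VT1 _ (sU1 _ Uy))) _.
  apply: eqmx_trans (eqmxMr _ (TV1 _ (sU1 _ Uy))) _; apply: eqmx_trans (gV y Uy) _.
  apply: eqmx_sym; apply: eqmx_trans (VT2 _ (sU2 _ (gW _ Uy))) _.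
  exact: TV2 (sU2 _ (gW _ Uy)).
have [oc1 _ _ _] := co1; have [oc2 _ _ _] := co2.
exists U1, U2, g; split; rewrite ?oc1 ?oc2 //.
  move=> y Uy; split; last exact: VV.
  apply: eqmx_trans (eqmxMr _ (Er1 _ (sU1 _ Uy))) _.
  rewrite (rr y Uy) -scalemxAl /r2' mulmxKV ?uJ //.
  apply: eqmx_trans (eqmx_scale _ (s0 y Uy)) _.
  exact/eqmx_sym/(Er2 _ (sU2 _ (gW _ Uy))).
have ssm : smooth U1 s.
  have A : smooth_mx U1 (fun y => r1 y *m a2 y).
    by apply: smooth_mxM => //; [exact: cf_sr cf1|exact: cf_sa cf2'].
  exact: A.
have slam2g : smooth U1 (fun y => lam2 (g y)).
  have A := smooth_comp oU gW sg (smooth_sub sU2 slam2); exact: A.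
have l20 y : U1 y -> lam2 (g y) != 0 by move=> Uy; apply: lam20; exact: sU2 (gW _ Uy).
(* Three ratios are composed: from [omet O2] to the metric of the second coframe, from there to
   [eps1], from there to [omet O1]. They are H2, H1 and H3 below. *)
exists (fun y => (lam2 (g y))^-1 * (c * (s y)^-1 * lam1 y)); split.
- apply: smoothM => //; first exact: smoothV.
  apply: smoothM => //; last exact: smooth_sub slam1.
  by apply: smoothM => //; [exact: smooth_cst|exact: smoothV].
- move=> y Uy; rewrite !mulf_neq0 ?invr_neq0 ?l20 ?s0 //.
  exact: lam10 (sU1 _ Uy).
move=> y Uy; have Wy := gW _ Uy.
have /submxP[D1 ->] : (overt O1 y <= T1 y)%MS by rewrite (VT1 _ (sU1 _ Uy)).
suff H : T1 y *m (jacobian g y *m omet O2 (g y) *m (jacobian g y)^T) *m (T1 y)^T =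
    ((lam2 (g y))^-1 * (c * (s y)^-1 * lam1 y)) *: (T1 y *m omet O1 y *m (T1 y)^T).
  have /(congr1 (fun A => D1 *m A *m D1^T)) := H.
  by rewrite -scalemxAr -scalemxAl !trmx_mul !mulmxA.
(* da2([r1, X], Y) is computed twice: as [s] times the second metric and as [c] times the first. *)
have H1 : T1 y *m (th2' y *m eps2 *m (th2' y)^T) *m (T1 y)^T = (c * (s y)^-1) *: eps1.
  apply/row_matrixP => i; rewrite !rowE; set e := delta_mx 0 i.
  have := coframe_metric_ratio cf1 cf2' TT rk Uy e.
  rewrite (da2 y Uy) -scalemxAr -scalemxAl -(mulmxA _ (ext_d1 (fhilbert S1) y)) (coframe_daT cf1 Uy) mulmxN (mulmxA _ (om1 y)).
  rewrite (coframe_bracket cf1 oU (@subset_refl _ U1) (cf_sr cf1) _ (fun z => coframe_da_r cf1 (y := z))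
    (fun z _ => submxMl _ _) Uy); last first.
    by apply: smooth_mxM => //; [exact: smooth_mx_cst|exact: cf_sT cf1].
  rewrite (cf_ra cf1 Uy) mul1mx -(mulmxA e (T1 y) (th1 y)) (cf_Tth cf1 Uy) mulmx1 mulNmx opprK.
  move=> /(congr1 (fun A => (s y)^-1 *: A)); rewrite [in RHS]scalerA mulVf ?s0 // scale1r.
  by rewrite scalerA mulrC -scalemxAr !mulmxA => ->.
have H2 : T1 y *m (th2' y *m eps2 *m (th2' y)^T) *m (T1 y)^T =
    lam2 (g y) *: (T1 y *m (jacobian g y *m omet O2 (g y) *m (jacobian g y)^T) *m (T1 y)^T).
  have /submxP[D2 ->] : (T1 y <= T2' y)%MS by rewrite (TT y Uy).
  have /(congr1 (fun A => D2 *m A *m D2^T)) := h2 _ (sU2 _ Wy).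
  rewrite -scalemxAr -scalemxAl /th2' /T2' /pull1 !trmx_mul !mulmxA.
  rewrite -!(mulmxA _ (invmx _) (jacobian g y)) mulVmx ?uJ // ?mulmx1.
  rewrite -!(mulmxA _ (jacobian g y)^T (invmx (jacobian g y))^T) -trmx_mul mulVmx ?uJ // trmx1 !mulmx1.
  by [].
have H3 : eps1 = lam1 y *: (T1 y *m omet O1 y *m (T1 y)^T).
  rewrite -(h1 _ (sU1 _ Uy)) !mulmxA (cf_Tth cf1 Uy) mul1mx -mulmxA -trmx_mul (cf_Tth cf1 Uy).
  by rewrite trmx1 mulmx1.
move: H1; rewrite H2 H3 scalerA => /(congr1 (fun A => (lam2 (g y))^-1 *: A)).
by rewrite !scalerA mulVf ?l20 // scale1r mulrA.
Qed.

Lemma orthopath_divergence x1 x2 : (1 < k)%N ->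
  orthopath_equivalent O1 x1 O2 x2 -> divergence_equivalent S1 x1 S2 x2.
Proof.
move=> k1 [U1 [U2 [g [[[oU Ux1] sU1] [_ sU2] [dg gx] EV [lam [slam lam0 lamE]]]]]].
have [oc1 _ ver1 _] := co1; have [oc2 _ ver2 _] := co2; rewrite oc1 in sU1; rewrite oc2 in sU2.
have [eps1 [om1 [th1 [r1 [N1 [T1 [lam1 [cf1 TV1 Er1 VT1 [slam1 lam10 h1]]]]]]]]] :=
  corresponds_coframe fS1 co1.
have [eps2 [om2 [th2 [r2 [N2 [T2 [lam2 [cf2 TV2 Er2 VT2 [slam2 lam20 h2]]]]]]]]] :=
  corresponds_coframe fS2 co2.
have [_ oW sg gW _] := dg; have uJ y := diffeo_unitmx dg (x := y).
have cf1' := coframe_sub oU sU1 cf1.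
have cf2' := coframe_pull dg (coframe_sub oW sU2 cf2).
set a2 := pull1 g (fhilbert S2) in cf2'; set th2' := pull1 g th2 in cf2'.
set r2' := fun y => r2 (g y) *m _ in cf2'; set T2' := fun y => T2 (g y) *m _ in cf2'.
have TT y : U1 y -> (T1 y :=: T2' y)%MS.
  move=> Uy; apply: eqmx_trans (eqmx_sym (VT1 _ (sU1 _ Uy))) _; apply: eqmx_sym.
  have vv := (eqmx_unitP _ _ (uJ y Uy)).1 (EV y Uy).2.
  apply: eqmx_trans vv; apply: eqmxMr; exact/eqmx_sym/(VT2 _ (sU2 _ (gW _ Uy))).
have rk y : U1 y -> r1 y *m ext_d1 a2 y = 0.
  move=> Uy; have rE := (eqmx_unitP _ _ (uJ y Uy)).1 (EV y Uy).1.
  have : (r1 y <= r2' y)%MS.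
    rewrite -(Er1 _ (sU1 _ Uy)) -rE; apply: submxMr.
    by rewrite (Er2 _ (sU2 _ (gW _ Uy))).
  by move=> /submxP[D ->]; rewrite -mulmxA (coframe_da_r cf2' Uy) mulmx0.
pose s y := (r1 y *m a2 y) 0 0.
have s0 y : U1 y -> s y != 0.
  move=> Uy; apply: contra (coframe_r_neq0 cf1' Uy) => /eqP s0.
  by rewrite (coframe_kerE cf2' Uy (rk y Uy)) mul11mx -/(s y) s0 scale0r.
have ssm : smooth U1 s.
  have A : smooth_mx U1 (fun y => r1 y *m a2 y).
    by apply: smooth_mxM => //; [exact: cf_sr cf1'|exact: cf_sa cf2'].
  exact: A.
have slam2g : smooth U1 (fun y => lam2 (g y)).
  have A := smooth_comp oU gW sg (smooth_sub sU2 slam2); exact: A.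
have l20 y : U1 y -> lam2 (g y) != 0 by move=> Uy; apply: lam20; exact: sU2 (gW _ Uy).
(* The ratio of the pulled-back second metric to the first one, through the representatives
   [omet]. *)
pose nu y := lam2 (g y) * (lam y * (lam1 y)^-1).
have snu : smooth U1 nu.
  apply: smoothM => //; apply: smoothM => //; apply: smoothV => //; last exact: smooth_sub slam1.
  by move=> y Uy; apply: lam10; exact: sU1.
have H1 y : U1 y -> T1 y *m (th2' y *m eps2 *m (th2' y)^T) *m (T1 y)^T = nu y *: eps1.
  move=> Uy; have Wy := gW _ Uy.
  have /submxP[D2 E2] : (T1 y <= T2' y)%MS by rewrite (TT y Uy).
  have /submxP[D1 E1] : (T1 y <= overt O1 y)%MS by rewrite (VT1 _ (sU1 _ Uy)).
  have -> : T1 y *m (th2' y *m eps2 *m (th2' y)^T) *m (T1 y)^T =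
    lam2 (g y) *: (T1 y *m (jacobian g y *m omet O2 (g y) *m (jacobian g y)^T) *m (T1 y)^T).
    rewrite E2; have /(congr1 (fun A => D2 *m A *m D2^T)) := h2 _ (sU2 _ Wy).
    rewrite -scalemxAr -scalemxAl /th2' /T2' /pull1 !trmx_mul !mulmxA.
    rewrite -!(mulmxA _ (invmx _) (jacobian g y)) mulVmx ?uJ // ?mulmx1.
    rewrite -!(mulmxA _ (jacobian g y)^T (invmx (jacobian g y))^T) -trmx_mul mulVmx ?uJ // trmx1 !mulmx1.
    by [].
  have -> : T1 y *m (jacobian g y *m omet O2 (g y) *m (jacobian g y)^T) *m (T1 y)^T =
      lam y *: (T1 y *m omet O1 y *m (T1 y)^T).
    rewrite E1; have /(congr1 (fun A => D1 *m A *m D1^T)) := lamE y Uy.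
    by rewrite -scalemxAr -scalemxAl !trmx_mul !mulmxA.
  have -> : eps1 = lam1 y *: (T1 y *m omet O1 y *m (T1 y)^T).
    rewrite -(h1 _ (sU1 _ Uy)) !mulmxA (cf_Tth cf1' Uy) mul1mx -mulmxA -trmx_mul (cf_Tth cf1' Uy).
    by rewrite trmx1 mulmx1.
  rewrite !scalerA /nu -!mulrA mulVf ?mulr1 //; exact: lam10 (sU1 _ Uy).
(* da2([r1, X], Y) is [s] times the second metric, hence [s] times [nu] times the first: the only
   candidate for the factor between da2 and da1. *)
pose mu y := s y * nu y; have smu : smooth U1 mu by exact: smoothM.
have sa2 := cf_sa cf2'; have sa1 := cf_sa cf1'.
have prop := quasi_symplectic_unique k1 cf1' (smooth_ext_d1 oU sa2)
  (fun y _ => ext_d1_skew a2 y) (ext_d1_closed oU sa2) smu rk.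
have {}prop y : U1 y -> ext_d1 a2 y = mu y *: ext_d1 (fhilbert S1) y /\ forall u, 'D_u mu y = 0.
  apply: prop => {}y.
    move=> Uy; have /submxP[D2 ->] : (T1 y <= T2' y)%MS by rewrite (TT y Uy).
    move: (T2' y) (coframe_daT cf2' Uy) (cf_Tom cf2' Uy) => A EA EB.
    rewrite trmx_mul !mulmxA -(mulmxA _ (ext_d1 a2 y)) EA mulmxN mulmxA.
    by rewrite -(mulmxA D2) EB mulmx0 mul0mx oppr0 mul0mx.
  move=> c Uy; rewrite (coframe_metric_ratio cf1' cf2' TT rk Uy c) -/(s y).
  rewrite -(mulmxA c) -(mulmxA c) H1 // -scalemxAr scalerA.
  by [].
pose c := mu x1.
have c0 : c != 0.
  rewrite /c /mu /nu !mulf_neq0 ?invr_neq0 ?s0 ?l20 ?lam0 //.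
  exact: lam10 (sU1 _ Ux1).
have fib : fibration (fcar S1) (fbase S1) (fproj S1) by have [] := fS1.
have [_ _ _ _ /(_ x1 (sU1 _ Ux1))[Uf [W [phi [[oUf Ufx] sUf dphi nuE]]]]] := fib.
have [phi' [dphi' phiW phi'U phiK phi'K]] := diffeoP dphi.
have [_ oWp sphi _ _] := dphi; have [_ _ sphi' _ _] := dphi'.
pose z0 := phi x1.
(* Everything is restricted to a cube in a fibred chart: it is connected, the Poincare lemma holds
   on it, and it is a product of a base cube and a fibre cube. *)
have [rr rr0 cubeW] : exists2 rr : R, 0 < rr & cube z0 rr `<=` W `&` phi' @^-1` U1.
  have /near_dist[d d0 H] : \forall z \near z0, (W `&` phi' @^-1` U1) z.
    apply: open_near; first exact: open_preimage.
    by split; [exact: phiW|rewrite /preimage /= phiK].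
  by exists d.
set Q := cube z0 rr in cubeW; have oQ : open Q by exact: open_cube.
have QW : Q `<=` W by move=> z /cubeW[].
have Qz0 : Q z0 by rewrite /Q /cube /= subrr normr0.
have [U1' [sU1' dQ U1'E]] := diffeo_restrict dphi' oQ QW.
have [_ oU1' sphiQ phiQ _] := dQ.
have U1'U1 : U1' `<=` U1 by move=> y /U1'E[z /cubeW[_ Uz] <-].
have U1'x : U1' x1 by apply/U1'E; exists z0 => //; exact: phiK.
have phiU1' y : U1' y -> Q (phi y).
  by move=> /U1'E[z Qz <-]; rewrite phi'K //; exact: QW.
have [U2' [sU2' dg' U2'E]] := diffeo_restrict dg oU1' U1'U1.
have [_ oU2' _ _ _] := dg'.
(* So far only the derivatives of [mu] are known to vanish; the cube turns this into equality with
   the value at [x1]. *)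
have muc y : U1' y -> mu y = c.
  move=> U1'y; have muphi : smooth Q (mu \o phi').
    by apply: (smooth_comp oQ _ sphiQ smu) => z /cubeW[].
  have := cube_constant muphi Qz0 (phiU1' y U1'y); rewrite /= !phiK //; last exact: sU1'.
  apply=> j _ z Qz; have [Wz U1z] := cubeW z Qz.
  have dp i : differentiable (fun y => phi' y 0 i) z := smooth_diff (sphi' 0 i) Wz.
  rewrite [LHS](derive_comp_fun _ dp (smooth_diff smu U1z)).2 big1 // => i _.
  by rewrite [pder i mu _](proj2 (prop _ U1z)) mulr0.
(* The form that has to be df: it is closed because da2 = c da1, and it kills vertical vectors
   because both Hilbert forms do. *)
pose ga y := - c *: fhilbert S1 y + a2 y.
have sga : smooth_mx U1 ga.
  by apply: smooth_mxD => //; apply: smooth_mxZ => //; exact: smooth_cst.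
have dga y : U1' y -> ext_d1 ga y = 0.
  move=> U1'y; have U1y := U1'U1 _ U1'y.
  rewrite (ext_d1_comb (- c) oU sa1 sa2 U1y) (proj1 (prop _ U1y)) muc // scaleNr.
  by rewrite addNr.
have gaV y b (v : 'M[R]_(b, m)) : U1 y -> (v <= vertical (fproj S1) y)%MS -> v *m ga y = 0.
  move=> Uy; rewrite -(TV1 _ (sU1 _ Uy)) => vT.
  have [v1 _] := (coframe_vert cf1' v Uy).1 vT.
  have [v2 _] : v *m a2 y = 0 /\ v *m pull1 g om2 y = 0.
    by apply/(coframe_vert cf2' v Uy); rewrite -(TT _ Uy).
  by rewrite mulmxDr -scalemxAr v1 v2 scaler0 addr0.
have phiQU1 z : Q z -> U1 (phi' z) by move=> /cubeW[].
have phiQU1' z : Q z -> U1' (phi' z) by move=> Qz; apply/U1'E; exists z.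
pose be := pull1 phi' ga.
have sbe : smooth_mx Q be := smooth_pull1 oQ phiQU1 sphiQ sga.
have dbe z : Q z -> ext_d1 be z = 0.
  move=> Qz; rewrite (ext_d1_pull oQ phiQU1 sphiQ sga Qz) /pull2 dga ?mulmx0 ?mul0mx //.
  exact: phiQU1'.
have [F sF dF] := poincare1 sbe dbe.
have beV z (j : 'I_k) : Q z -> be z (rshift k.+1 j) 0 = 0.
  move=> Qz; have Wz := QW z Qz.
  have -> : be z (rshift k.+1 j) 0 = ((delta_mx 0 (rshift k.+1 j) : 'rV[R]_m) *m be z) 0 0.
    by rewrite -rowE [RHS]mxE.
  rewrite /be /pull1 mulmxA gaV ?mxE //; first exact: phiQU1.
  apply/sub_kermxP; rewrite (jacobian_chart dphi nuE (phi'U _ Wz)).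
  have AB := diffeo_jacobian dphi' dphi phi'K Wz.
  move: (jacobian phi' z) (jacobian phi (phi' z)) AB => A B AB.
  rewrite mulmx_lsub -mulmxA AB mulmx1; apply/rowP => i; rewrite !mxE eqxx /=.
  by rewrite eq_lrshift.
(* The fibre derivatives of [F] vanish by [beV], so [F] is determined by its values on the slice
   through [z0]. In the sup norm, moving a point of the cube to this slice does not leave the
   cube. *)
pose f (t : 'rV[R]_k.+1) := F (row_mx t (rsubmx z0)).
have Qrow t : cube (lsubmx z0) rr t -> Q (row_mx t (rsubmx z0)).
  move=> tQ; rewrite /Q /cube /=.
  have -> : row_mx t (rsubmx z0) - z0 = row_mx (t - lsubmx z0) 0.
    by rewrite -[X in _ - X](hsubmxK z0) opp_row_mx add_row_mx subrr.
  apply: le_lt_trans tQ.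
  apply: mx_norm_leP => // i j; case: (split_ordP j) => l ->.
    by rewrite row_mxEl mx_norm_entry.
  by rewrite row_mxEr mxE normr0.
have lQ z : Q z -> cube (lsubmx z0) rr (lsubmx z).
  move=> Qz; rewrite /cube /=; apply: le_lt_trans Qz.
  apply: mx_norm_leP => // i j; rewrite -linearB mxE; exact: mx_norm_entry.
have sf : smooth (cube (lsubmx z0) rr) f.
  have oL : open (cube (lsubmx z0) rr) by exact: open_cube.
  have sr : smooth_mx (cube (lsubmx z0) rr) (fun t => row_mx t (rsubmx z0)).
    by apply: smooth_row_mx => //; [exact: smooth_mx_id|exact: smooth_mx_cst].
  have A := smooth_comp oL Qrow sr sF; exact: A.
have fF y : U1' y -> f (fproj S1 y) = F (phi y).
  move=> U1'y; have Uy := sU1' _ U1'y; rewrite nuE //; have Qy := phiU1' y U1'y.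
  apply: (cube_constant sF Qy (Qrow _ (lQ _ Qy))) => j.
  case: (split_ordP j) => l ->.
    by rewrite mxE row_mxEl [X in X + _]mxE [X in _ + X]mxE subrr eqxx.
  move=> _ z Qz; have /matrixP/(_ (rshift k.+1 l) 0) := dF z Qz.
  by rewrite mxE beV.
exists U1', U2', g; split=> //.
- by split=> // y /U1'U1/sU1.
- split; last by move=> y /sU2'/sU2.
  by split=> //; apply/U2'E; exists x1.
- move=> y /U1'U1 Uy; have Cy := sU1 _ Uy.
  apply: eqmx_trans (eqmxMr _ (eqmx_sym (ver1 y Cy))) _.
  apply: eqmx_trans (EV y Uy).2 _; exact: ver2 (sU2 _ (gW _ Uy)).
exists c, f; split=> //.
  apply: smooth_sub sf => t [y U1'y <-]; rewrite nuE; last exact: sU1'.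
  exact/lQ/phiU1'.
move=> y U1'y; have Uy := U1'U1 _ U1'y; have Ufy := sU1' _ U1'y.
have -> : ext_d0 (f \o fproj S1) y = ext_d0 (F \o phi) y.
  apply/colP => i; rewrite !mxE; exact: (pder_eq_on i oU1' U1'y fF).
rewrite (ext_d0_comp phiU1' (smooth_mx_sub sU1' sphi) sF U1'y) (dF _ (phiU1' y U1'y)).
have AB := diffeo_jacobian dphi dphi' phiK Ufy.
rewrite /be /pull1 (phiK _ Ufy); move: (jacobian phi y) (jacobian phi' (phi y)) AB => A B AB.
by rewrite mulmxA AB mul1mx /ga scaleNr addrA subrr add0r.
Qed.

End DivergenceEquivalence.

(** * Finsler structures from quasi-symplectic forms *)

Section SmoothDiagonalization.
Context {R : realType} {l : nat}.

Lemma open_smooth_pos (U : set 'rV[R]_l) f : open U -> smooth U f ->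
  open (U `&` [set y | 0 < f y]).
Proof.
move=> oU sf; rewrite openE => y [Uy fy]; apply: filterI; first exact: open_near.
have A : nbhs (f y) [set s | 0 < s] by apply: open_nbhs_nbhs; split=> //; exact: open_gt.
by have := smooth_continuous sf Uy; move=> /(_ _ A).
Qed.

(* Gaussian elimination of a symmetric matrix: the pivots keep their sign near
   [x], so they can be normalised by a smooth square root. *)
Lemma smooth_diagonalize n (U : set 'rV[R]_l) (H : 'rV[R]_l -> 'M[R]_n) x :
  open U -> U x -> smooth_mx U H -> (forall y, U y -> (H y)^T = H y) ->
  (forall i j, i != j -> H x i j = 0) -> (forall i, H x i i != 0) ->
  exists U' P, [/\ open_nbhs x U', U' `<=` U, smooth_mx U' P &
    forall y, U' y -> P y *m H y *m (P y)^T = H x].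
Proof.
elim: n U H => [|n IH] U H oU Ux sH symH offd diagd.
  exists U, (fun=> 0); split=> // [|y _]; first by move=> [].
  by apply/matrixP => -[].
pose H' y : 'M[R]_(1 + n) := H y.
pose al y := H y ord0 ord0; pose b y := dlsubmx (H' y); pose D y := drsubmx (H' y).
have sal : smooth U al by exact: sH.
have sb : smooth_mx U b.
  by move=> i j; apply: (smooth_eq oU _ (sH (rshift 1 i) (lshift n j))) => y _; rewrite !mxE.
have sD : smooth_mx U D.
  by move=> i j; apply: (smooth_eq oU _ (sH (rshift 1 i) (rshift 1 j))) => y _; rewrite !mxE.
have symE y i j : U y -> H y i j = H y j i.
  by move=> Uy; rewrite -{1}(symH y Uy) mxE.
have HE y : U y -> H' y = block_mx (al y)%:M (b y)^T (b y) (D y).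
  move=> Uy; rewrite -[LHS]submxK; congr block_mx.
    by rewrite [LHS]mx11_scalar !mxE; congr (H y _ _)%:M; exact/val_inj.
  by apply/matrixP => i j; rewrite !mxE; exact: symE.
have al0 : al x != 0 by exact: diagd.
pose U1 := U `&` [set y | 0 < al y * al x].
have oU1 : open U1 by apply: open_smooth_pos => //; apply: smoothM => //; exact: smooth_cst.
have U1x : U1 x by split=> //=; rewrite -expr2 exprn_even_gt0.
have U1U : U1 `<=` U by move=> y [].
have al1 y : U1 y -> al y != 0.
  by move=> [_ /=]; apply: contraTneq => ->; rewrite mul0r ltxx.
have q0 y : U1 y -> 0 < al x * (al y)^-1.
  move=> U1y; have [_ /= h] := U1y; have := al1 y U1y => ay.
  have -> : al x * (al y)^-1 = (al y * al x) * ((al y)^-1) ^+ 2.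
    by rewrite expr2 mulrACA mulfV // mul1r.
  by rewrite mulr_gt0 // exprn_even_gt0 //= invr_eq0.
have sV : smooth U1 (fun y => (al y)^-1) by apply: smoothV => //; exact: smooth_sub U1U sal.
pose s y := Num.sqrt (al x * (al y)^-1).
have ss : smooth U1 s.
  by apply: smooth_sqrt => //; apply: smoothM => //; exact: smooth_cst.
have s2 y : U1 y -> s y * s y * al y = al x.
  move=> U1y; rewrite -expr2 sqr_sqrtr ?ltW ?q0 // mulfVK //; exact: al1.
(* The Schur complement of the pivot. At [x] the column [b] vanishes, so [G] is there the diagonal
   lower block and the induction hypothesis applies. *)
pose G y := D y - (al y)^-1 *: (b y *m (b y)^T).
have sG : smooth_mx U1 G.
  apply: smooth_mxB => //; first exact: smooth_mx_sub U1U sD.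
  apply: smooth_mxZ => //; apply: smooth_mxM => //; first exact: smooth_mx_sub U1U sb.
  by apply: smooth_mxT => //; exact: smooth_mx_sub U1U sb.
have symG y : U1 y -> (G y)^T = G y.
  move=> /U1U Uy; rewrite /G linearB /= linearZ /= trmx_mul trmxK; congr (_ - _).
  by apply/matrixP => i j; rewrite !mxE; exact: symE.
have b0 : b x = 0.
  by apply/matrixP => i j; rewrite (ord1 j) !mxE; apply: offd; rewrite -val_eqE.
have Gx : G x = D x by rewrite /G b0 mul0mx scaler0 subr0.
have [||U' [P' [[oU' U'x] U'U1 sP PE]]] := IH U1 G oU1 U1x sG symG.
- move=> i j ij; rewrite Gx !mxE; apply: offd.
  by apply: contra ij => /eqP E; apply/eqP/(@rshift_inj 1 n).
- by move=> i; rewrite Gx !mxE; exact: diagd.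
have U'U y : U' y -> U y by move=> /U'U1/U1U.
(* The lower left block clears the first column, and s^2 al = al x restores the pivot to its value
   at [x]. *)
pose P y : 'M[R]_(1 + n) := block_mx (s y)%:M 0 (- (al y)^-1 *: (P' y *m b y)) (P' y).
exists U', P; split=> // [|y U'y].
  have s1 : smooth_mx U' (fun y => (s y)%:M : 'M[R]_1).
    move=> i j; apply: (smooth_eq oU' _ (smooth_sub U'U1 ss)) => y _.
    by rewrite !mxE !ord1.
  have s21 : smooth_mx U' (fun y => - (al y)^-1 *: (P' y *m b y)).
    apply: smooth_mxZ => //; first by apply: smoothN => //; exact: smooth_sub U'U1 sV.
    by apply: smooth_mxM => //; exact: smooth_mx_sub U'U sb.
  have A1 := smooth_row_mx oU' s1 (smooth_mx_cst U' (0 : 'M[R]_(1, n))).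
  exact: (smooth_col_mx oU' A1 (smooth_row_mx oU' s21 sP)).
suff E : P y *m H' y *m (P y)^T = H' x by exact: E.
rewrite (HE x Ux) (HE y (U'U y U'y)).
have ay := al1 y (U'U1 y U'y).
rewrite /P (@tr_block_mx _ 1 n 1 n) mulmx_block mulmx_block !trmx0 !mul0mx !mulmx0 !addr0.
rewrite tr_scalar_mx -!scalar_mxM mulrAC s2; last exact: U'U1.
have Z1 : - (al y)^-1 *: (P' y *m b y) *m (al y)%:M + P' y *m b y = 0.
  by rewrite mul_mx_scalar scalerA mulrN mulfV // scaleN1r addNr.
rewrite Z1 !mul0mx add0r b0 trmx0.
have Z2 : (s y * al y)%:M *m (- (al y)^-1 *: (P' y *m b y))^T + (s y)%:M *m (b y)^T *m (P' y)^T = 0.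
  rewrite linearZ /= trmx_mul !mul_scalar_mx scalerA -scalemxAl -scalerDl.
  by rewrite mulrN mulfK // addNr scale0r.
rewrite Z2; congr block_mx; rewrite -Gx -(PE y U'y); congr (_ *m _).
by rewrite /G mulmxBr scaleNr mulNmx -scalemxAl -mulmxA -scalemxAr addrC.
Qed.

End SmoothDiagonalization.

(** * From dual frames back to adapted coframings *)

Section CoframeConstruction.
Context {R : realType} {k : nat}.
Notation m := (k.+1 + k)%N.

(** A 2-form that vanishes on the kernel of [om] lies in the ideal generated by the omega^b. [Q] is
    the projection onto that kernel along [N], and expanding [s] with Q + om N = 1 leaves only terms
    with a factor [om]. *)
Lemma wedge_decomposition (s : 'M[R]_m) (om : 'M[R]_(m, k)) (N : 'M[R]_(k, m)) :
  s^T = - s -> N *m om = 1%:M ->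
  (forall u v : 'rV[R]_m, u *m om = 0 -> v *m om = 0 -> u *m s *m v^T = 0) ->
  exists P : 'I_k -> 'cV[R]_m, s = \sum_b wedge (P b) (col b om).
Proof.
move=> sk Nom H; pose Q := 1%:M - om *m N.
have Qom : Q *m om = 0 by rewrite mulmxBl mul1mx -mulmxA Nom mulmx1 subrr.
have Qs : Q *m s *m Q^T = 0.
  apply: mx_bilinP => u v; rewrite mulmx0 mul0mx.
  have := H (u *m Q) (v *m Q); rewrite -!mulmxA Qom !mulmx0 => /(_ erefl erefl).
  by rewrite trmx_mul !mulmxA.
have QE : Q + om *m N = 1%:M by rewrite subrK.
(* The block N s N^T is produced by both terms of the wedge product, hence the factor one half. *)
pose A := Q *m s *m N^T + 2^-1 *: (om *m (N *m s *m N^T)).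
exists (fun b => col b A).
have -> : \sum_b wedge (col b A) (col b om) = A *m om^T - om *m A^T.
  rewrite -[A in A *m _]mulmx1 -[om in om *m A^T]mulmx1 -[X in om *m X]trmx1 -wedge_sumE.
  apply: eq_bigr => b _; rewrite (bigD1 b) //= big1 => [|c cb].
    by rewrite mxE eqxx scale1r addr0.
  by rewrite mxE eq_sym (negPf cb) scale0r.
have AT : A^T = - (N *m s *m Q^T) - 2^-1 *: (N *m s *m N^T *m om^T).
  rewrite linearD linearZ /= !trmx_mul !trmxK sk !(mulNmx, mulmxN) scalerN.
  by rewrite !mulmxA.
have sE : s = (Q + om *m N) *m s *m (Q^T + N^T *m om^T).
  by rewrite -trmx_mul -linearD /= QE trmx1 mul1mx mulmx1.
move: @A AT; move: (Q) Qs sE {Qom QE} => {}Q Qs sE A AT.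
rewrite AT /A mulmxBr mulmxN -scalemxAr (mulmxDl (Q *m _ *m _)) -scalemxAl.
rewrite [LHS]sE mulmxDr !mulmxDl Qs add0r !mulmxA.
rewrite opprD !opprK.
move: (Q *m s *m N^T *m om^T) (om *m N *m s *m Q^T) (om *m N *m s *m N^T *m om^T) => X Y Z.
by apply/matrixP => i j; rewrite !mxE; field.
Qed.

End CoframeConstruction.

(** Converse of [adapted_coframe]: the structure equation, known only on the kernel of [om], gets
    its forms P_b back from [wedge_decomposition]. *)
Lemma coframe_adapted {R : realType} p q (S : finsler_data R (p + q)) eps om th r N T :
  coframe (fcar S) eps (fhilbert S) om th r N T -> has_signature p q eps ->
  (forall y, fcar S y -> (T y :=: vertical (fproj S) y)%MS) ->
  adapted_coframing p q S eps om th.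
Proof.
move=> cf sig TV; split=> //.
- by split; [exact: cf_som cf|exact: cf_sth cf].
- move=> y Cy; apply/row_freeP; exists (col_mx (r y) (col_mx (N y) (T y))).
  by rewrite mul_row_col mul_row_col addrA (cf_id cf Cy).
- split=> y Cy.
    by have [] := (coframe_vert cf (vertical (fproj S) y) Cy).1 _; rewrite ?(TV y Cy).
  by have [] := (coframe_vert cf (vertical (fproj S) y) Cy).1 _; rewrite ?(TV y Cy).
move=> y Cy; split; first by rewrite wedge_sumE (cf_sym cf) (cf_da cf Cy).
move=> c; have [|||P E] := @wedge_decomposition _ _
  (ext_d1 (fun z => col c (om z)) y - wedge (fhilbert S y) (col c (th y))) (om y) (N y).
- by rewrite linearB /= ext_d1_skew /wedge linearB /= !trmx_mul !trmxK !opprB addrC.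
- exact: (cf_Nom cf Cy).
- move=> u v u0 v0; rewrite mulmxBr mulmxBl (cf_dom cf Cy c u0 v0) wedge_bilin.
  exact: subrr.
by exists P; rewrite -E addrC subrK.
Qed.

(** * A coframe from a Reeb field and a normalised vertical frame *)

Section CoframeOfReebField.
Context {R : realType} {k : nat}.
Notation m := (k.+1 + k)%N.

Lemma smooth_row {l b c : nat} (U : set 'rV[R]_l) (F : 'rV[R]_l -> 'M[R]_(b, c)) i :
  open U -> smooth_mx U F -> smooth_mx U (fun y => row i (F y)).
Proof. by move=> oU sF i0 j; apply: (smooth_eq oU _ (sF i j)) => y _; rewrite mxE. Qed.

Lemma smooth_col {l b c : nat} (U : set 'rV[R]_l) (F : 'rV[R]_l -> 'M[R]_(b, c)) j :
  open U -> smooth_mx U F -> smooth_mx U (fun y => col j (F y)).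
Proof. by move=> oU sF i j0; apply: (smooth_eq oU _ (sF i j)) => y _; rewrite mxE. Qed.

Lemma skew_trmx {b c n : nat} (s : 'M[R]_n) (A : 'M[R]_(b, n)) (B : 'M[R]_(c, n)) :
  s^T = - s -> A *m s *m B^T = - (B *m s *m A^T)^T.
Proof. by move=> sk; rewrite !trmx_mul trmxK sk mulNmx mulmxN opprK mulmxA. Qed.

(** Each component of [nu] has a closed differential that vanishes on [X] and on [Y]; Cartan's
    formula then makes it vanish on the bracket. *)
Lemma lie_bracket_vertical (U : set 'rV[R]_m) (nu : 'rV[R]_m -> 'rV[R]_k.+1) X Y x :
  open U -> smooth_mx U nu -> smooth_mx U X -> smooth_mx U Y ->
  (forall y, U y -> X y *m jacobian nu y = 0) ->
  (forall y, U y -> Y y *m jacobian nu y = 0) -> U x ->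
  lie_bracket X Y x *m jacobian nu x = 0.
Proof.
move=> oU snu sX sY X0 Y0 Ux; apply/matrixP => i0 l; rewrite [RHS]mxE.
pose f y := nu y 0 l; have sf : smooth U f by exact: snu.
have JE y : U y -> col l (jacobian nu y) = ext_d0 f y.
  by move=> Uy; apply/matrixP => i j; rewrite mxE (jacobianE _ _ snu Uy) mxE.
have Xf y : U y -> X y *m ext_d0 f y = 0.
  by move=> Uy; rewrite -(JE y Uy) -col_mulmx X0 // col0.
have Yf y : U y -> Y y *m ext_d0 f y = 0.
  by move=> Uy; rewrite -(JE y Uy) -col_mulmx Y0 // col0.
have sdf := smooth_ext_d0 oU sf.
have := ext_d1_fields oU sdf sX sY Ux.
rewrite (derive_const _ oU Ux Yf) (derive_const _ oU Ux Xf) subrr sub0r.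
rewrite (ext_d1_ext_d0 oU sf Ux) mulmx0 mul0mx => /esym/eqP; rewrite oppr_eq0 => /eqP E.
have : col l (lie_bracket X Y x *m jacobian nu x) = 0 by rewrite col_mulmx JE // E.
by move=> /matrixP/(_ i0 0); rewrite mxE [X in _ = X -> _]mxE.
Qed.

(** The hypothesis on brackets says that the metric da([r, X], Y) has the constant matrix [eps] in
    the frame [T]; the hypothesis before it says that V is isotropic for da. *)
Lemma build_coframe (U : set 'rV[R]_m) eps a (r : 'rV[R]_m -> 'rV[R]_m)
    (T : 'rV[R]_m -> 'M[R]_(k, m)) (nu : 'rV[R]_m -> 'rV[R]_k.+1) :
  open U -> eps^T = eps -> eps \in unitmx ->
  smooth_mx U a -> smooth_mx U r -> smooth_mx U T -> smooth_mx U nu ->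
  (forall y, U y -> (T y :=: vertical nu y)%MS) ->
  (forall y, U y -> r y *m a y = 1%:M) -> (forall y, U y -> T y *m a y = 0) ->
  (forall y, U y -> r y *m ext_d1 a y = 0) ->
  (forall y, U y -> T y *m ext_d1 a y *m (T y)^T = 0) ->
  (forall i y, U y -> lie_bracket r (fun z => row i (T z)) y *m ext_d1 a y *m (T y)^T
     = row i eps) ->
  exists om th N, coframe U eps a om th r N T.
Proof.
move=> oU seps ueps sa sr sT snu TV ra Ta rd TdT br.
(* [da = th /\ eps om] forces [om] and [th] up to the choice of [N], which is
   normalised by [N *m da *m N^T = 0]. *)
pose rho := ext_d1 a.
have srho : smooth_mx U rho by exact: smooth_ext_d1.
have skr y : (rho y)^T = - rho y by exact: ext_d1_skew.
have sTi i : smooth_mx U (fun z => row i (T z)) by exact: smooth_row.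
pose om y := - (rho y *m (T y)^T *m invmx eps).
have sc b c (A : 'M[R]_(b, c)) : smooth_mx U (fun=> A) by exact: smooth_mx_cst.
have som : smooth_mx U om.
  apply: smooth_mxN => //; apply: smooth_mxM => //; apply: smooth_mxM => //.
  exact: smooth_mxT.
(* The structure equation requires omega([r, T_i]) to be minus the i-th basis vector, so the fields
   - [r, T_i] are dual to [om]. *)
pose N0 y : 'M[R]_(k, m) := \matrix_i (- lie_bracket r (fun z => row i (T z)) y).
have sN0 : smooth_mx U N0.
  move=> i j; have sl := smooth_lie_bracket oU sr (sTi i).
  by apply: (smooth_eq oU _ (smooth_mxN oU sl 0 j)) => y _; rewrite [in RHS]mxE.
have N0T y : U y -> N0 y *m rho y *m (T y)^T = - eps.
  move=> Uy; apply/row_matrixP => i; rewrite !row_mul rowK !mulNmx br //.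
  by rewrite linearN.
have TiA i y : U y -> row i (T y) *m a y = 0.
  by move=> Uy; rewrite -row_mul Ta // row0.
have N0a y : U y -> N0 y *m a y = 0.
  move=> Uy; apply/row_matrixP => i; rewrite row_mul rowK row0 mulNmx.
  have := ext_d1_fields oU sa sr (sTi i) Uy.
  rewrite (derive_const _ oU Uy (TiA i)) (derive_const _ oU Uy ra) subrr sub0r rd //.
  by rewrite mul0mx => <-.
have N0om y : U y -> N0 y *m om y = 1%:M.
  by move=> Uy; rewrite mulmxN !mulmxA N0T // mulNmx opprK mulmxV.
pose Z y := N0 y *m rho y *m (N0 y)^T.
(* Adding multiples of [T] changes neither [a] nor [om] on the frame. The correction enters N da N^T
   once from each side with equal contributions, because [Z] is skew, so half of it cancels [Z]. *)
pose N y := N0 y - 2^-1 *: (Z y *m invmx eps *m T y).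
have sN : smooth_mx U N.
  apply: smooth_mxB => //; apply: smooth_mxZ => //; first exact: smooth_cst.
  apply: smooth_mxM => //; apply: smooth_mxM => //; apply: smooth_mxM => //.
    exact: smooth_mxM.
  exact: smooth_mxT.
have TdN0 y : U y -> T y *m rho y *m (N0 y)^T = eps.
  by move=> Uy; rewrite (skew_trmx _ _ (skr y)) N0T // linearN opprK.
have NdT y : U y -> N y *m rho y *m (T y)^T = - eps.
  move=> Uy; rewrite mulmxBl mulmxBl N0T // -scalemxAl -scalemxAl -!mulmxA.
  by rewrite (mulmxA (T y)) TdT // !mulmx0 scaler0 subr0.
have TdN y : U y -> T y *m rho y *m (N y)^T = eps.
  by move=> Uy; rewrite (skew_trmx _ _ (skr y)) NdT // linearN opprK.
have NdN y : U y -> N y *m rho y *m (N y)^T = 0.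
  move=> Uy; rewrite {1}/N !mulmxBl -!scalemxAl -(mulmxA _ (T y)) -(mulmxA _ (T y *m _)).
  rewrite TdN // mulmxKV // /N linearB /= linearZ /= mulmxBr -scalemxAr.
  have -> : N0 y *m rho y *m (Z y *m invmx eps *m T y)^T = - (Z y)^T.
    by rewrite trmx_mul mulmxA N0T // mulNmx trmx_mul trmx_inv seps mulmxA mulmxV // mul1mx.
  rewrite -/(Z y); have ZT : (Z y)^T = - Z y.
    by rewrite {2}/Z (skew_trmx _ _ (skr y)) opprK.
  rewrite ZT opprK; move: (Z y) => z; apply/matrixP => i j; rewrite !mxE; lra.
pose th y := rho y *m (N y)^T *m invmx eps.
have sth : smooth_mx U th.
  by apply: smooth_mxM => //; apply: smooth_mxM => //; exact: smooth_mxT.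
have rom y : U y -> r y *m om y = 0 by move=> Uy; rewrite mulmxN !mulmxA rd // !mul0mx oppr0.
have rth y : U y -> r y *m th y = 0 by move=> Uy; rewrite !mulmxA rd // !mul0mx.
have Na y : U y -> N y *m a y = 0.
  by move=> Uy; rewrite mulmxBl N0a // -scalemxAl -!mulmxA Ta // !mulmx0 scaler0 subr0.
have Nom y : U y -> N y *m om y = 1%:M.
  by move=> Uy; rewrite mulmxN !mulmxA NdT // mulNmx opprK mulmxV.
have Nth y : U y -> N y *m th y = 0 by move=> Uy; rewrite !mulmxA NdN // mul0mx.
have Tom y : U y -> T y *m om y = 0.
  by move=> Uy; rewrite mulmxN !mulmxA TdT // mul0mx oppr0.
have Tth y : U y -> T y *m th y = 1%:M by move=> Uy; rewrite !mulmxA TdN // mulmxV.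
have id y : U y -> a y *m r y + om y *m N y + th y *m T y = 1%:M.
  move=> Uy; rewrite -addrA -!mul_row_col.
  have E : col_mx (r y) (col_mx (N y) (T y)) *m row_mx (a y) (row_mx (om y) (th y)) =
      (1%:M : 'M[R]_(1 + (k + k))).
    rewrite !mul_col_row mul_col_mx mul_mx_row.
    rewrite ra // rom // rth // Na // Nom // Nth // Ta // Tom // Tth //.
    by rewrite row_mx0 col_mx0 -!scalar_mx_block.
  exact: (mulmx1C E).
have rhoN y : rho y *m (N y)^T = th y *m eps by rewrite /th mulmxKV.
have rhoT y : rho y *m (T y)^T = - (om y *m eps) by rewrite /om mulNmx mulmxKV // opprK.
have Nrho y : N y *m rho y = - (eps *m (th y)^T).
  by rewrite -[LHS]trmxK trmx_mul skr mulNmx rhoN linearN /= trmx_mul seps.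
have Trho y : T y *m rho y = eps *m (om y)^T.
  by rewrite -[LHS]trmxK trmx_mul skr mulNmx rhoT opprK trmx_mul seps.
have N0c : N0 = (fun y => \matrix_i (- lie_bracket r (fun z => row i (T z)) y)) by [].
clearbody om th N N0.
exists om, th, N; split=> // [y Uy|y Uy c u v u0 v0].
  rewrite -[LHS]mul1mx -(id y Uy) !mulmxDl -!mulmxA rd // mulmx0 add0r.
  by rewrite -/rho Nrho Trho mulmxN addrC.
pose omc z := col c (om z); have somc : smooth_mx U omc by exact: smooth_col.
have skc : (ext_d1 omc y)^T = - ext_d1 omc y by exact: ext_d1_skew.
have dec (w : 'rV[R]_m) : w *m om y = 0 -> w = w *m a y *m r y + w *m th y *m T y.
  by move=> w0; rewrite -{1}[w]mulmx1 -(id y Uy) !mulmxDr !mulmxA w0 mul0mx addr0.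
(* By Cartan's formula this is omega^c(- [r, T_i]), known from N0 om = 1. With the vanishing of
   domega^c on pairs of vertical vectors it is the whole structure equation on the kernel of [om],
   spanned by [r] and [T]. *)
have rT : r y *m ext_d1 omc y *m (T y)^T = (col c 1%:M)^T.
  have romc z : U z -> r z *m omc z = 0 by move=> Uz; rewrite -col_mulmx rom // col0.
  have Tomc i z : U z -> row i (T z) *m omc z = 0.
    by move=> Uz; rewrite -col_mulmx -row_mul Tom // row0 col0.
  apply/matrixP => i0 i; rewrite (ord1 i0).
  have := ext_d1_fields oU somc sr (sTi i) Uy.
  rewrite (derive_const _ oU Uy (Tomc i)) (derive_const _ oU Uy romc) subrr sub0r.
  rewrite -mulNmx -(rowK (fun i => - lie_bracket r (fun z => row i (T z)) y)).
  rewrite -[\matrix_i _]/((fun y => \matrix_i (- lie_bracket r (fun z => row i (T z)) y)) y) -N0c.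
  rewrite -col_mulmx -row_mul N0om // tr_row -col_mulmx.
  move=> /matrixP/(_ 0 0); rewrite mxE => ->.
  by rewrite !mxE eq_sym.
(* Integrability of V enters here: the bracket of two rows of [T] is vertical and [om] annihilates
   it. *)
have TT : T y *m ext_d1 omc y *m (T y)^T = 0.
  apply/row_matrixP => i; rewrite row0 !row_mul; apply/matrixP => i0 j; rewrite (ord1 i0) [RHS]mxE.
  have Tomc l z : U z -> row l (T z) *m omc z = 0.
    by move=> Uz; rewrite -col_mulmx -row_mul Tom // row0 col0.
  have TJ l z : U z -> row l (T z) *m jacobian nu z = 0.
    move=> Uz; apply/sub_kermxP; apply: submx_trans (row_sub _ _) _.
    by rewrite (TV z Uz).
  have := ext_d1_fields oU somc (sTi i) (sTi j) Uy.
  rewrite (derive_const _ oU Uy (Tomc i)) (derive_const _ oU Uy (Tomc j)) subrr sub0r.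
  have /sub_kermxP := lie_bracket_vertical oU snu (sTi i) (sTi j) (TJ i) (TJ j) Uy.
  rewrite -/(vertical nu y) -(TV y Uy) => /submxP[D ->].
  have -> : D *m T y *m omc y = 0 by rewrite -mulmxA -col_mulmx Tom // col0 mulmx0.
  rewrite oppr0 tr_row -col_mulmx.
  by move=> /matrixP/(_ 0 0); rewrite mxE => ->; rewrite mxE.
have Tr : T y *m ext_d1 omc y *m (r y)^T = - col c 1%:M.
  by rewrite (skew_trmx _ _ skc) rT trmxK.
have rr : r y *m ext_d1 omc y *m (r y)^T = 0.
  have := skew_trmx (r y) (r y) skc; rewrite trmx11.
  move: (_ *m _) => z /(congr1 (fun M : 'M[R]_1 => M 0 0)) E; apply: scal_mxP.
  by move: E; rewrite [in X in _ = X]mxE [RHS in _ -> _ = RHS]mxE; lra.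
have X (A A' : 'M[R]_1) (B B' : 'rV[R]_k) :
    (A *m r y + B *m T y) *m ext_d1 omc y *m (A' *m r y + B' *m T y)^T =
    A *m (r y *m ext_d1 omc y *m (r y)^T) *m A'^T + A *m (r y *m ext_d1 omc y *m (T y)^T) *m B'^T
    + (B *m (T y *m ext_d1 omc y *m (r y)^T) *m A'^T + B *m (T y *m ext_d1 omc y *m (T y)^T) *m B'^T).
  rewrite linearD /= !trmx_mul mulmxDr !mulmxDl !mulmxA; exact: addrACA.
rewrite [in LHS](dec u u0) [in LHS](dec v v0) X rr rT Tr TT.
rewrite !mulmx0 !mul0mx add0r addr0 mulmxN mulNmx -(mulmxA (u *m a y)) -trmx_mul.
have thc : th y *m col c 1%:M = col c (th y) by rewrite !colE mul1mx.
by rewrite -!(mulmxA _ (th y)) thc.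
Qed.

End CoframeOfReebField.

Lemma row_sq_neq0 {R : realDomainType} {n : nat} (v : 'rV[R]_n) : v != 0 -> (v *m v^T) 0 0 != 0.
Proof.
apply: contra => /eqP; rewrite mxE => E; apply/eqP/matrixP => i j; rewrite (ord1 i) [RHS]mxE.
have /psumr_eq0P : forall l, true -> 0 <= v 0 l * v^T l 0.
  by move=> l _; rewrite mxE -expr2 sqr_ge0.
by move=> /(_ E j isT); rewrite mxE => /eqP; rewrite mulf_eq0 orbb => /eqP.
Qed.

(** * Semi-basic primitives and contact forms *)

Section HilbertForm.
Context {R : realType} {k : nat}.
Notation m := (k.+1 + k)%N.

(** The new point is that the image of [U] is open. A chart at [x] gives a local section t |-> phi'
    (j t) of [nu] through [x] with values in [U]. *)
Lemma fibration_restrict (C : set 'rV[R]_m) M nu U : fibration C M nu -> open U -> U `<=` C ->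
  fibration U (nu @` U) nu.
Proof.
move=> [oC oM snu _ charts] oU sU.
have chartU x : U x -> exists U' W (phi : 'rV[R]_m -> 'rV[R]_m),
    [/\ open_nbhs x U', U' `<=` U, diffeo U' W phi & forall y, U' y -> nu y = lsubmx (phi y)].
  move=> Ux; have [Ux' [W [phi [[oUx Uxx] _ dphi nuE]]]] := charts x (sU _ Ux).
  have [W' [_ dphi' _]] := diffeo_restrict dphi (openI oUx oU) (@subIsetl _ Ux' U).
  exists (Ux' `&` U), W', phi; split=> //; first by split=> //; exact: openI.
  by move=> y [/nuE].
split=> //; last exact: smooth_mx_sub snu.
rewrite openE => _ [x Ux <-].
have [U' [W [phi [[oU' U'x] sU' dphi nuE]]]] := chartU x Ux.
have [phi' [_ phiW phi'U phiK phi'K]] := diffeoP dphi.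
pose j (t : 'rV[R]_k.+1) := row_mx t (rsubmx (phi x)).
have sj : smooth_mx setT j.
  by apply: smooth_row_mx; [exact: openT|exact: smooth_mx_id|exact: smooth_mx_cst].
have [_ oW _ _ _] := dphi.
have oj := open_preimage openT oW sj.
have /(open_near oj) : (setT `&` j @^-1` W) (nu x).
  by split=> //=; rewrite /j (nuE x U'x) hsubmxK; exact: phiW.
apply: filterS => t [_ /= Wt]; exists (phi' (j t)); first exact/sU'/phi'U.
by rewrite nuE ?phi'K ?row_mxKl //; exact: phi'U.
Qed.

(* The value on [e] is adjusted by adding the pull-back of a constant form. *)
Lemma vertical_primitive (U : set 'rV[R]_m) M nu rho x (e : 'rV[R]_m) (l : R) :
  fibration U M nu -> smooth_mx U rho -> (forall y, U y -> (rho y)^T = - rho y) ->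
  closed_2form U rho ->
  (forall y, U y -> vertical nu y *m rho y *m (vertical nu y)^T = 0) ->
  U x -> e *m jacobian nu x != 0 ->
  exists U' a, [/\ open_nbhs x U', U' `<=` U, smooth_mx U' a,
    (forall y, U' y -> vertical nu y *m a y = 0 /\ ext_d1 a y = rho y) &
    e *m a x = l%:M].
Proof.
move=> [oU _ _ _ /(_ x)] charts srho skr clr Vrho Ux e0.
have [U0 [W [phi [[oU0 U0x] sU0 dphi nuE]]]] := charts Ux.
have [phi' [dphi' phiW phi'U phiK phi'K]] := diffeoP dphi.
have [_ oW sphi _ _] := dphi; have [_ _ sphi' _ _] := dphi'.
pose z0 := phi x; have [r r0 sB] := (near_dist z0 W).1 (open_near oW (phiW x U0x)).
have oB : open (cube z0 r) by exact: open_cube.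
have BW z : cube z0 r z -> W z by exact: sB.
have BU z : cube z0 r z -> U (phi' z) by move=> /BW/phi'U/sU0.
pose s := pull2 phi' rho.
have sphiB : smooth_mx (cube z0 r) phi' by exact: smooth_mx_sub sphi'.
have ss : smooth_mx (cube z0 r) s by exact: smooth_pull2 BU _ srho.
have sks z : cube z0 r z -> (s z)^T = - s z by move=> /BU Uz; apply: pull2_skew; exact: skr.
have cls : closed_2form (cube z0 r) s by exact: closed_2form_pull oU BU _ srho skr clr.
have JK y : U0 y -> jacobian phi y *m jacobian phi' (phi y) = 1%:M.
  exact: diffeo_jacobian dphi dphi' phiK.
have JK' z : W z -> jacobian phi' z *m jacobian phi (phi' z) = 1%:M.
  exact: diffeo_jacobian dphi' dphi phi'K.
have JnuE y : U0 y -> jacobian nu y = lsubmx (jacobian phi y) by exact: jacobian_chart dphi nuE.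
have rowV z (i : 'I_m) : cube z0 r z -> (k.+1 <= i)%N ->
    (row i (jacobian phi' z) <= vertical nu (phi' z))%MS.
  move=> Bz ki; apply/sub_kermxP; rewrite JnuE; last exact/phi'U/BW.
  rewrite -row_mul mulmx_lsub JK'; last exact: BW.
  apply/matrixP => i0 j; rewrite !mxE; case: eqP => // E.
  by move: ki; rewrite E /= leqNgt ltn_ord.
(* In the chart the last k coordinate directions are vertical, so isotropy of V becomes the
   vanishing of the lower right block, the hypothesis of [poincare2] with z = k + 1. *)
have s0 z : cube z0 r z -> forall i j : 'I_m, (k.+1 <= i)%N -> (k.+1 <= j)%N -> s z i j = 0.
  move=> Bz i j ki kj.
  have /submxP[D1 E1] := rowV z i Bz ki; have /submxP[D2 E2] := rowV z j Bz kj.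
  have : row i (jacobian phi' z) *m rho (phi' z) *m (row j (jacobian phi' z))^T = 0.
    rewrite E1 E2 trmx_mul -2!(mulmxA D1) (mulmxA _ _ D2^T) Vrho; last exact: BU.
    by rewrite mul0mx mulmx0.
  rewrite -(mx_delta_bilin (s z) i j) /s /pull2 !rowE trmx_mul !mulmxA => ->.
  by rewrite mxE.
have [b [sb b0 db]] := poincare2 ss sks cls s0.
pose w := e *m jacobian phi x; pose w1 := lsubmx w.
have w1n : w1 != 0 by rewrite /w1 -mulmx_lsub -JnuE.
(* A covector with base components only, so neither the differential nor the vanishing on V is
   affected. It is scaled so that b + C takes the value [l] on the image [w] of [e], which is
   possible because the base part [w1] is nonzero. *)
pose C : 'cV[R]_m := ((l - (w *m b z0) 0 0) / (w1 *m w1^T) 0 0) *: col_mx w1^T 0.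
have sbC : smooth_mx (cube z0 r) (fun z => 1 *: b z + C).
  apply: smooth_mxD => //; last exact: smooth_mx_cst.
  by apply: smooth_mxZ => //; exact: smooth_cst.
have dbC z : cube z0 r z -> ext_d1 (fun z => 1 *: b z + C) z = s z.
  move=> Bz; rewrite (ext_d1_comb 1 oB sb (smooth_mx_cst _ C) Bz) db // scale1r.
  rewrite [X in _ + X](_ : _ = 0) ?addr0 //.
  by apply/matrixP => i j; rewrite mxE [RHS]mxE /pder !derive_cst subrr.
exists (U0 `&` phi @^-1` cube z0 r), (pull1 phi (fun z => 1 *: b z + C)); split.
- split; first exact: open_preimage.
  by split=> //; rewrite /= /cube /= subrr normr0.
- by move=> y [/sU0].
- apply: (smooth_pull1 (W := cube z0 r)) => //; last exact: smooth_mx_sub sphi.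
    exact: open_preimage.
  by move=> y [].
- move=> y [U0y By]; split.
    rewrite /pull1 mulmxA -[vertical nu y *m _]hsubmxK -mulmx_lsub -JnuE // mulmx_ker.
    rewrite -[X in _ *m X]vsubmxK mul_row_col mul0mx add0r.
    rewrite [X in _ *m X](_ : _ = 0) ?mulmx0 //.
    apply/matrixP => i j; rewrite (ord1 j) [RHS]mxE mxE mxE [X in X + _]mxE [X in _ + X]mxE.
    by rewrite b0 ?leq_addr // mulr0 add0r col_mxEd [X in _ * X]mxE mulr0.
  have oU1 : open (U0 `&` phi @^-1` cube z0 r) by exact: open_preimage.
  have phiB z : (U0 `&` phi @^-1` cube z0 r) z -> cube z0 r (phi z) by move=> [].
  have sphi1 : smooth_mx (U0 `&` phi @^-1` cube z0 r) phi by exact: smooth_mx_sub sphi.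
  rewrite (ext_d1_pull oU1 phiB sphi1 sbC) // /pull2 dbC // /s /pull2 phiK //.
  by rewrite !mulmxA JK // mul1mx -mulmxA -trmx_mul JK // trmx1 mulmx1.
rewrite /pull1 mulmxA -/w -/z0 scale1r mulmxDr -scalemxAr.
have -> : w *m col_mx w1^T 0 = w1 *m w1^T.
  by rewrite -[w in LHS]hsubmxK mul_row_col mulmx0 addr0.
apply: scal_mxP; move: (row_sq_neq0 w1n) => n0.
rewrite mxE [X in _ + X]mxE divfK // [RHS]mxE eqxx mulr1n addrC.
exact: subrK.
Qed.

Lemma coframe_contact (U : set 'rV[R]_m) eps a om th r N T :
  coframe U eps a om th r N T -> contact_form U a.
Proof.
move=> cf; split; first exact: cf_sa cf.
move=> y Uy; split.
  apply/eqP => a0; have := cf_ra cf Uy; rewrite a0 mulmx0 => /matrixP/(_ 0 0)/eqP.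
  by rewrite !mxE eqxx eq_sym oner_eq0.
move=> v va vd.
have A b (w : 'M[R]_(b, m)) : w *m a y = 0 -> v *m ext_d1 a y *m w^T = 0.
  move=> wa; apply/matrixP => i j; rewrite (ord1 i) [RHS]mxE.
  have := vd (row j w); rewrite -row_mul wa row0 tr_row -col_mulmx => /(_ erefl).
  by move=> /matrixP/(_ 0 0); rewrite mxE => ->; rewrite mxE.
have := A _ _ (cf_Ta cf Uy); have := A _ _ (cf_Na cf Uy).
rewrite -!mulmxA (coframe_daN cf Uy) (coframe_daT cf Uy) mulmxN !mulmxA => vth vom.
have ue := cf_unit cf.
have {}vth : v *m th y = 0 by rewrite -[LHS](mulmxK ue) vth mul0mx.
have {}vom : v *m om y = 0.
  by move/eqP: vom; rewrite oppr_eq0 => /eqP vom; rewrite -[LHS](mulmxK ue) vom mul0mx.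
by rewrite (coframe_decomp cf v Uy) va vom vth !mul0mx !addr0.
Qed.

End HilbertForm.

(** The constant congruence [P] makes the matrix diagonal at [x], which is the starting point that
    [smooth_diagonalize] requires. *)
Lemma normalize_metric {R : realType} {l n : nat} (U : set 'rV[R]_l) (H : 'rV[R]_l -> 'M[R]_n)
    (P eta : 'M[R]_n) x : open U -> U x -> smooth_mx U H -> (forall y, U y -> (H y)^T = H y) ->
  P *m H x *m P^T = eta -> (forall i j, i != j -> eta i j = 0) -> (forall i, eta i i != 0) ->
  exists U' L, [/\ open_nbhs x U', U' `<=` U, smooth_mx U' L &
    forall y, U' y -> L y *m H y *m (L y)^T = eta].
Proof.
move=> oU Ux sH symH PE offd diagd.
have [||||U' [L [oU' U'U sL LE]]] := @smooth_diagonalize _ _ _ U (fun y => P *m H y *m P^T) x oU Ux.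
- apply: smooth_mxM => //; last exact: smooth_mx_cst.
  by apply: smooth_mxM => //; exact: smooth_mx_cst.
- by move=> y Uy; rewrite !trmx_mul trmxK symH // mulmxA.
- by rewrite PE.
- by rewrite PE.
exists U', (fun y => L y *m P); split=> //.
  by apply: smooth_mxM => //; [case: oU'|exact: smooth_mx_cst].
by move=> y U'y; rewrite -PE -(LE y U'y) trmx_mul !mulmxA.
Qed.

(** * From variational orthopath geometries to Finsler structures *)

Section OrthopathToFinsler.
Context {R : realType} {p q : nat}.
Notation k := (p + q)%N.
Notation m := (k.+1 + k)%N.
Let eta : 'M[R]_k := block_mx (1%:M : 'M[R]_p) 0 0 ((-1)%:M : 'M[R]_q).

Lemma standard_metric_sym : eta^T = eta.
Proof. by rewrite /eta tr_block_mx !trmx0 !tr_scalar_mx. Qed.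

Lemma standard_metric_off i j : i != j -> eta i j = 0.
Proof.
rewrite /eta; case: (split_ordP i) => i' ->; case: (split_ordP j) => j' -> ij.
- by rewrite block_mxEul mxE (inj_eq (@lshift_inj _ _)) in ij *; rewrite (negPf ij).
- by rewrite block_mxEur mxE.
- by rewrite block_mxEdl mxE.
- by rewrite block_mxEdr mxE (inj_eq (@rshift_inj _ _)) in ij *; rewrite (negPf ij).
Qed.

Lemma standard_metric_diag i : eta i i != 0.
Proof.
rewrite /eta; case: (split_ordP i) => i' ->.
  by rewrite block_mxEul mxE eqxx oner_eq0.
by rewrite block_mxEdr mxE eqxx mulr1n oppr_eq0 oner_eq0.
Qed.

Lemma standard_metric_signature : has_signature p q eta.
Proof.
split; first exact: standard_metric_sym.
by exists 1%:M; rewrite ?unitmx1 // trmx1 mul1mx mulmx1.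
Qed.

Lemma orthopath_to_finsler (O : orthopath_data R k) x :
  orthopath p q O -> variational O -> ocar O x ->
  exists U (S : finsler_data R k),
    [/\ open_nbhs x U, U `<=` ocar O, finsler_structure p q S &
        corresponds p q S (orestrict O U)].
Proof.
move=> [[oC [sE sV iV capEV brEV]] sh symh sigh] var Cx.
have [U0 [rho [[oU0 U0x] sU0 [[srho skr] clr kerr Vrho comp]]]] := var x Cx.
have [Ue [e [[oUe Uex] sUe se eE]]] := sE x Cx.
have [UB [B [[oUB UBx] sUB sB BV]]] := sV x Cx.
have [Uf [nu [[oUf Ufx] sUf fib Vnu]]] := iV x Cx.
pose U1 := U0 `&` Ue `&` (UB `&` Uf).
have oU1 : open U1 by apply: openI; exact: openI.
have U1x : U1 x by [].
have U10 y : U1 y -> U0 y by move=> [[]].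
have U1e y : U1 y -> Ue y by move=> [[]].
have U1B y : U1 y -> UB y by move=> [_ []].
have U1f y : U1 y -> Uf y by move=> [_ []].
have eE1 y : U1 y -> (e y <= oline O y)%MS /\ e y != 0.
  move=> /U1e Uy; have [fr eq] := eE y Uy; split; first by rewrite eq.
  by rewrite -mxrank_eq0 (eqP fr).
have se1 : smooth_mx U1 e by exact: smooth_mx_sub se.
have [lam [slam lam0 lamE]] := comp U1 e oU1 U10 se1 eE1.
have fib1 : fibration U1 (nu @` U1) nu by exact: fibration_restrict fib oU1 U1f.
have [_ _ snu1 _ _] := fib1.
have Vnu1 y : U1 y -> (overt O y :=: vertical nu y)%MS by move=> /U1f; exact: Vnu.
have U1C y : U1 y -> ocar O y by move=> /U10/sU0.
(* E meets V trivially, so [e] is not vertical; this lets the value of [a] on [e] be prescribed. *)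
have ex0 : e x *m jacobian nu x != 0.
  have [ee en] := eE1 x U1x; apply: contra en => /eqP/sub_kermxP ev.
  by rewrite -submx0 -(capEV x Cx) sub_capmx ee (Vnu1 x U1x).
have vrho y : U1 y -> vertical nu y *m rho y *m (vertical nu y)^T = 0.
  move=> Uy; have /submxP[D ->] : (vertical nu y <= overt O y)%MS by rewrite (Vnu1 y Uy).
  by rewrite trmx_mul -2!(mulmxA D) (mulmxA _ _ D^T) Vrho ?mul0mx ?mulmx0 //; exact: U10.
(* Prescribing [a (e x) = lam x] makes [lam / a e] positive near [x], so that the
   metric [da ([r, X], Y)] of the Reeb field has the signature of [omet], and
   not the opposite one. *)
have [Ua [a [[oUa Uax] sUa sa aP ax]]] := vertical_primitive (lam x) fib1
  (smooth_mx_sub U10 srho) (fun y Uy => skr y (U10 y Uy)) (fun y Uy => clr y (U10 y Uy))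
  vrho U1x ex0.
pose kap y := (e y *m a y) 0 0.
have skap : smooth Ua kap.
  have A : smooth_mx Ua (fun y => e y *m a y) by apply: smooth_mxM => //; exact: smooth_mx_sub se1.
  exact: A.
have kapx : kap x = lam x by rewrite /kap ax mxE eqxx mulr1n.
pose U2 := Ua `&` [set y | 0 < kap y * lam y].
have oU2 : open U2.
  by apply: open_smooth_pos => //; apply: smoothM => //; exact: smooth_sub slam.
have U2x : U2 x by split=> //=; rewrite kapx -expr2 exprn_even_gt0 //= lam0.
have U2a y : U2 y -> Ua y by move=> [].
have U21 y : U2 y -> U1 y by move=> /U2a/sUa.
have kap0 y : U2 y -> kap y != 0.
  by move=> [_ /=]; apply: contraTneq => ->; rewrite mul0r ltxx.
have skV : smooth U2 (fun y => (kap y)^-1) by apply: smoothV => //; exact: smooth_sub skap.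
(* The factor between [omet] and the metric da([r, X], Y) of the normalised field r = e / a(e); it
   is positive on [U2] and equals 1 at [x]. *)
pose c y := lam y * (kap y)^-1.
have sc : smooth U2 c by apply: smoothM => //; exact: smooth_sub slam.
have sB2 : smooth_mx U2 B by apply: smooth_mx_sub sB => y /U21/U1B.
pose H y := c y *: (B y *m omet O y *m (B y)^T).
have sH : smooth_mx U2 H.
  apply: smooth_mxZ => //; apply: smooth_mxM => //; last exact: smooth_mxT.
  by apply: smooth_mxM => //; apply: smooth_mx_sub sh => y /U21/U1C.
have symH y : U2 y -> (H y)^T = H y.
  by move=> /U21/U1C Cy; rewrite linearZ /= !trmx_mul trmxK symh // mulmxA.
have [B0 B0V [_ [P0 _ P0E]]] := sigh x Cx.
have /submxP[A AE] : (B0 <= B x)%MS by rewrite B0V (BV x UBx).2.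
(* As c x = 1, the matrix [H x] is that of [omet] itself, so the congruence supplied by the
   signature hypothesis, rewritten in the frame [B], normalises it. *)
have PH : (P0 *m A) *m H x *m (P0 *m A)^T = eta.
  by rewrite /H /c kapx mulfV ?lam0 // scale1r /eta -P0E AE !trmx_mul !mulmxA.
have [U3 [L [[oU3 U3x] sU3 sL LE]]] := normalize_metric oU2 U2x sH symH PH
  standard_metric_off standard_metric_diag.
pose T y := L y *m B y; pose r y := (kap y)^-1 *: e y.
have ueta : eta \in unitmx by exact: signature_unit standard_metric_signature.
have U31 y : U3 y -> U1 y by move=> /sU3/U21.
have uL y : U3 y -> L y \in unitmx.
  by move=> U3y; have := ueta; rewrite -(LE y U3y) !unitmx_mul => /andP[/andP[]].
have TV y : U3 y -> (T y :=: overt O y)%MS.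
  move=> U3y; apply: eqmx_trans (BV y (U1B y (U31 y U3y))).2.
  by apply: eqmxMfull; rewrite row_full_unit; exact: uL.
have THT y : U3 y -> c y *: (T y *m omet O y *m (T y)^T) = eta.
  by move=> U3y; rewrite -(LE y U3y) /H -scalemxAr -scalemxAl /T trmx_mul !mulmxA.
have sT : smooth_mx U3 T by apply: smooth_mxM => //; exact: smooth_mx_sub sB2.
have se3 : smooth_mx U3 e by exact: smooth_mx_sub se1.
have skV3 : smooth U3 (fun y => (kap y)^-1) by exact: smooth_sub skV.
have sr : smooth_mx U3 r by exact: smooth_mxZ.
have U3a y : U3 y -> Ua y by move=> /sU3/U2a.
have sa3 : smooth_mx U3 a by exact: smooth_mx_sub sa.
have snu3 : smooth_mx U3 nu by exact: smooth_mx_sub snu1.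
have TVn y : U3 y -> (T y :=: vertical nu y)%MS.
  by move=> U3y; apply: eqmx_trans (TV y U3y) _; exact: Vnu1 (U31 y U3y).
have da y : U3 y -> ext_d1 a y = rho y by move=> /U3a/aP[].
have ra y : U3 y -> r y *m a y = 1%:M.
  move=> U3y; rewrite -scalemxAl [e y *m a y]mx11_scalar -/(kap y) scale_scalar_mx.
  by rewrite mulVf // kap0 //; exact: sU3.
have erho y : U1 y -> e y *m rho y = 0.
  by move=> Uy; apply/sub_kermxP; rewrite (kerr y (U10 y Uy)).2; have [] := eE1 y Uy.
have rd y : U3 y -> r y *m ext_d1 a y = 0.
  by move=> U3y; rewrite da // -scalemxAl erho ?scaler0 //; exact: U31.
have Ta y : U3 y -> T y *m a y = 0.
  move=> U3y; have /submxP[D ->] : (T y <= vertical nu y)%MS by rewrite (TVn y U3y).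
  by rewrite -mulmxA (aP y (U3a y U3y)).1 mulmx0.
have TdT y : U3 y -> T y *m ext_d1 a y *m (T y)^T = 0.
  move=> U3y; have /submxP[D ->] : (T y <= vertical nu y)%MS by rewrite (TVn y U3y).
  by rewrite da // trmx_mul -2!(mulmxA D) (mulmxA _ _ D^T) vrho ?mul0mx ?mulmx0 //; exact: U31.
have br i y : U3 y -> lie_bracket r (fun z => row i (T z)) y *m ext_d1 a y *m (T y)^T = row i eta.
  (* Passing from [e] to [r] adds to the bracket a multiple of [e], which rho annihilates; only the
     factor 1 / a(e) remains. *)
  move=> U3y; rewrite (lie_bracketZl oU3 skV3 se3 (smooth_row i oU3 sT) U3y) da //.
  rewrite mulmxBl -scalemxAl -[X in _ - X]scalemxAl erho; last exact: U31.
  rewrite scaler0 subr0 -scalemxAl.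
  have secT j : local_section (overt O) y (fun z => row j (T z)).
    exists U3; split=> //; first exact: smooth_row.
    by move=> z U3z; rewrite -(TV z U3z) row_sub.
  have E : lie_bracket e (fun z => row i (T z)) y *m rho y *m (T y)^T =
      lam y *: (row i (T y) *m omet O y *m (T y)^T).
    apply/matrixP => i0 j; rewrite (ord1 i0).
    have := lamE y _ _ (U31 y U3y) (secT i) (secT j).
    rewrite !tr_row -!col_mulmx => /matrixP/(_ 0 0).
    by rewrite mxE => ->; rewrite !mxE.
  by rewrite E scalerA -(THT y U3y) linearZ /= !row_mul mulrC.
have [om [th [N cf]]] := build_coframe oU3 standard_metric_sym ueta sa3 sr sT snu3 TVn
  ra Ta rd TdT br.
pose S := FinslerData U3 (nu @` U3) nu a.
have ad : adapted_coframing p q S eta om th.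
  exact: (@coframe_adapted _ _ _ S _ _ _ _ _ _ cf standard_metric_signature TVn).
have fS : finsler_structure p q S.
  split; last by exists eta, om, th.
    exact: fibration_restrict fib1 oU3 U31.
  exact: coframe_contact cf.
exists U3, S; split=> //; first by move=> y /U31/U1C.
split=> //.
- move=> y U3y; exists (r y); first by split; [exact: ra|exact: rd].
  apply: eqmx_trans (eqmx_scale _ _) _; first by rewrite invr_eq0 kap0 //; exact: sU3.
  by have [] := eE y (U1e y (U31 y U3y)).
- by move=> y U3y; apply: Vnu1; exact: U31.
(* Every adapted coframing gives the same metric on V, so it suffices to compare [omet] with the
   coframing just built, where the factor is [c]. *)
move=> eps' om' th' ad'; exists c; split.
- exact: smooth_sub sc.
- by move=> y /sU3 U2y; rewrite mulf_neq0 ?invr_eq0 ?kap0 ?lam0 //; exact: U21.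
move=> y U3y.
rewrite /= -(finsler_conformal_class (V := overt O) fS ad ad') //; last first.
  by move=> z U3z; apply: Vnu1; exact: U31.
have /submxP[D ->] : (overt O y <= T y)%MS by rewrite (TV y U3y).
have TthT : T y *m (th y *m eta *m (th y)^T) *m (T y)^T = eta.
  by rewrite !mulmxA (cf_Tth cf U3y) mul1mx -mulmxA -trmx_mul (cf_Tth cf U3y) trmx1 mulmx1.
have E0 (h : 'M[R]_m) : (D *m T y) *m h *m (D *m T y)^T = D *m (T y *m h *m (T y)^T) *m D^T.
  by rewrite trmx_mul !mulmxA.
by rewrite !E0 TthT -[in LHS](THT y U3y) -scalemxAr -scalemxAl.
Qed.

End OrthopathToFinsler.

Theorem proposition5p29 (R : realType) (p q : nat) (hpq : (2 <= p + q)%N) :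
  [/\ (forall S : finsler_data R (p + q), finsler_structure p q S ->
         exists O : orthopath_data R (p + q),
           [/\ corresponds p q S O, orthopath p q O, variational O &
               compatible_quasi_symplectic O (ocar O) (ext_d1 (fhilbert S))]),
      (forall (S1 S2 : finsler_data R (p + q)) (O1 O2 : orthopath_data R (p + q))
              (x1 x2 : 'rV[R]_((p + q).+1 + (p + q))),
         finsler_structure p q S1 -> finsler_structure p q S2 ->
         orthopath p q O1 -> orthopath p q O2 -> variational O1 -> variational O2 ->
         corresponds p q S1 O1 -> corresponds p q S2 O2 ->
         fcar S1 x1 -> fcar S2 x2 ->
         (divergence_equivalent S1 x1 S2 x2 <->
          orthopath_equivalent O1 x1 O2 x2))
    & (forall (O : orthopath_data R (p + q))
              (x : 'rV[R]_((p + q).+1 + (p + q))),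
         orthopath p q O -> variational O -> ocar O x ->
         exists U (S : finsler_data R (p + q)),
           [/\ open_nbhs x U, U `<=` ocar O, finsler_structure p q S &
               corresponds p q S (orestrict O U)])].
Proof.
split; [exact: finsler_to_orthopath| |exact: orthopath_to_finsler].
move=> S1 S2 O1 O2 x1 x2 fS1 fS2 _ _ _ _ co1 co2 _ _; split.
  exact: divergence_orthopath.
exact: orthopath_divergence.
Qed.
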